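(* Let $M$ be a quasi-minimal surface in the pseudo-sphere $\mathbb{S}^4_2$, and let $i:\mathbb{S}^4_2\subset\mathbb{E}^5_2$ be the inclusion. Then $M$ has positive relative nullity if and only if it is (locally) congruent to one of the following surfaces, given by an immersion $f$ into $\mathbb{S}^4_2$ with $\hat f=i\circ f$: (i) $\hat f(s,t)=\left(b(t)\cos s,\ \cos s\sinh t,\ \sin s,\ \cos s\cosh t,\ b(t)\cos s\right)$ for a smooth function $b$; (ii) $$\hat f(s,t)=\cos s\,\big(b(t),\alpha_1(t),\alpha_2(t),\alpha_3(t),b(t)\big)+\sin s\,\Big(\int_{t_0}^t\kappa(\xi)b'(\xi)\,d\xi,\ N_1(t),N_2(t),N_3(t),\ \int_{t_0}^t\kappa(\xi)b'(\xi)\,d\xi\Big),$$ where $b$ is a smooth function, $t_0$ is a constant, and $\alpha=(\alpha_1,\alpha_2,\alpha_3)$ is a time-like curve in $\mathbb{S}^2_1\subset\mathbb{E}^3_1$ parametrized by arc-length, with non-vanishing curvature $\kappa$ and unit normal vector field $N=(N_1,N_2,N_3)$; (iii) $\hat f(s,t)=\left(b(t)\cosh s,\ \sinh s,\ \cosh s\cos t,\ \cosh s\sin t,\ b(t)\cosh s\right)$ for a smooth function $b$; (iv) $$\hat f(s,t)=\cosh s\,\big(b(t),\alpha_1(t),\alpha_2(t),\alpha_3(t),b(t)\big)+\varepsilon\sinh s\,\Big(\int_{t_0}^t\kappa(\xi)b'(\xi)\,d\xi,\ N_1(t),N_2(t),N_3(t),\ \int_{t_0}^t\kappa(\xi)b'(\xi)\,d\xi\Big),$$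 where $\varepsilon\in\{1,-1\}$, $b$ is a smooth function, $t_0$ is a constant, and $\alpha=(\alpha_1,\alpha_2,\alpha_3)$ is a space-like curve in $\mathbb{S}^2_1\subset\mathbb{E}^3_1$ parametrized by arc-length, with non-vanishing curvature $\kappa$ and unit normal vector field $N=(N_1,N_2,N_3)$.
   Context: $\mathbb{E}^n_s$ is $\mathbb{R}^n$ with the metric $\langle\cdot,\cdot\rangle=-\sum_{i=1}^s dx_i^2+\sum_{j=s+1}^n dx_j^2$, and $\mathbb{S}^n_s=\{x\in\mathbb{E}^{n+1}_s:\langle x,x\rangle=1\}$ with the induced metric; thus $\mathbb{S}^4_2\subset\mathbb{E}^5_2$ and $\mathbb{S}^2_1\subset\mathbb{E}^3_1$. A non-zero vector $v$ is space-like, light-like or time-like if $\langle v,v\rangle>0$, $=0$ or $<0$ respectively. A surface $M$ in $\mathbb{S}^4_2$ is the image $M=f(\Omega)$ of an isometric immersion $f$ of a 2-dimensional pseudo-Riemannian manifold $\Omega$ (so the induced metric is non-degenerate; in the explicit parametrizations, $(s,t)$ ranges over a domain on which $f$ is such an immersion). Its second fundamental form $\alpha_f$ is the normal part of the Levi-Civita connection of $\mathbb{S}^4_2$: $\widetilde\nabla_XY=\nabla_XY+\alpha_f(X,Y)$. The mean curvature vector is $H=\frac12\operatorname{trace}\alpha_f$ (metric trace). $M$ is quasi-minimal if $H$ is light-like (in particular non-zero) at every point. The relative null space at $p$ is $\mathcal{N}_p=\{X_p\in T_pM:\alpha_f(X_p,Y_p)=0\text{ for all }Y_p\in T_pM\}$,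 and $M$ has positive relative nullity if $\dim\mathcal{N}_p\neq0$ for all $p\in M$. Curves in $\mathbb{S}^2_1$: for a time-like (resp. space-like) curve $\alpha$ parametrized by arc-length, $\langle\alpha',\alpha'\rangle=-1$ (resp. $=1$). $N$ is the unit normal vector field of $\alpha$ in $\mathbb{S}^2_1$ and $\kappa$ its (spherical) curvature, regarded in $\mathbb{E}^3_1$ and satisfying $\alpha''=\kappa N+\alpha$, $N'=\kappa\alpha'$ in the time-like case and $\alpha''=\kappa N-\alpha$, $N'=\kappa\alpha'$ in the space-like case. Congruent means equal up to an isometry of $\mathbb{S}^4_2$. The classification is local: it concerns sufficiently small open pieces of the surface. *)

(* Defs.v *)
From mathcomp Require Import all_boot all_order all_algebra.
From mathcomp Require Import all_classical all_reals all_analysis.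

Set Implicit Arguments.
Unset Strict Implicit.
Unset Printing Implicit Defensive.

Import Order.TTheory GRing.Theory Num.Theory.
Import numFieldNormedType.Exports.

Local Open Scope classical_set_scope.
Local Open Scope ring_scope.

Section SmoothMaps.
Variable R : realType.

Definition partial n m (i : 'I_n) (f : 'rV[R]_n -> 'rV[R]_m) (x : 'rV[R]_n) :
    'rV[R]_m :=
  'D_(delta_mx 0 i) f x.

(* C^k on U.  [partial] is a total function, so [Ck] is only meaningful for
   open U. *)
Fixpoint Ck n m (k : nat) (U : set 'rV[R]_n) (f : 'rV[R]_n -> 'rV[R]_m) : Prop :=
  match k with
  | 0 => forall x, U x -> {for x, continuous f}
  | k'.+1 => (forall x, U x -> differentiable f x) /\
             forall i : 'I_n, Ck k' U (partial i f)
  end.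

Definition smooth_on n m (U : set 'rV[R]_n) (f : 'rV[R]_n -> 'rV[R]_m) : Prop :=
  forall k, Ck k U f.

Definition smooth_curve_on (V : normedModType R) (I : set R) (g : R -> V) : Prop :=
  forall (k : nat) t, I t -> derivable (derive1n k g) t 1.

Definition open_interval (I : set R) : Prop := open I /\ is_interval I.

(* The integral from a to b, with the usual sign convention when b < a. *)
Definition oriented_integral (a b : R) (g : R -> R) : R :=
  if a <= b then \int[@lebesgue_measure R]_(x in `[a, b]) g x
  else - \int[@lebesgue_measure R]_(x in `[b, a]) g x.

Definition cosh (x : R) : R := (expR x + expR (- x)) / 2.
Definition sinh (x : R) : R := (expR x - expR (- x)) / 2.

End SmoothMaps.

Section PseudoEuclidean.
Variable R : realType.

(* E^n_s : the first s coordinates are the negative ones. *)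
Definition pdot (s : nat) n (x y : 'rV[R]_n) : R :=
  \sum_(i < n) (if (i < s)%N then - (x 0 i * y 0 i) else x 0 i * y 0 i).

Definition lightlike (s : nat) n (v : 'rV[R]_n) : Prop :=
  v != 0 /\ pdot s v v = 0.

Definition pseudosphere (s n : nat) : set 'rV[R]_n.+1 :=
  [set x : 'rV[R]_n.+1 | pdot s x x = 1].
Arguments pseudosphere s n _ : clear implicits.

(* A map of the (closed) submanifold S^n_s is smooth iff it extends smoothly to
   a neighbourhood of it; isometries are represented by such extensions, whose
   values off S^n_s are irrelevant. *)
Definition smooth_near_sphere (s n : nat) (T : 'rV[R]_n.+1 -> 'rV[R]_n.+1) :
    Prop :=
  exists O : set 'rV[R]_n.+1,
    [/\ open O, pseudosphere s n `<=` O & smooth_on O T].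

Definition sphere_isometry (s n : nat) (T : 'rV[R]_n.+1 -> 'rV[R]_n.+1) : Prop :=
  [/\ smooth_near_sphere s T,
      forall x, pseudosphere s n x -> pseudosphere s n (T x),
      exists T' : 'rV[R]_n.+1 -> 'rV[R]_n.+1,
        [/\ smooth_near_sphere s T',
            forall x, pseudosphere s n x -> pseudosphere s n (T' x),
            forall x, pseudosphere s n x -> T' (T x) = x
          & forall x, pseudosphere s n x -> T (T' x) = x]
    & forall x u v, pseudosphere s n x -> pdot s x u = 0 -> pdot s x v = 0 ->
        pdot s ('D_u T x) ('D_v T x) = pdot s u v].

End PseudoEuclidean.
Arguments pseudosphere {R} s n _.

Section AbstractSurfaces.
Variable R : realType.

Record chart (M : topologicalType) := Chart {
  cdom : set M;
  cimg : set 'rV[R]_2;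
  cmap : M -> 'rV[R]_2;
  cinv : 'rV[R]_2 -> M;
  cdom_open : open cdom;
  cimg_open : open cimg;
  cmap_img : forall p, cdom p -> cimg (cmap p);
  cinv_dom : forall x, cimg x -> cdom (cinv x);
  cmapK : forall p, cdom p -> cinv (cmap p) = p;
  cinvK : forall x, cimg x -> cmap (cinv x) = x;
  cmap_continuous : forall p, cdom p -> {for p, continuous cmap};
  cinv_continuous : forall x, cimg x -> {for x, continuous cinv}
}.

Definition smooth_transition (M : topologicalType) (c d : chart M) : Prop :=
  smooth_on (cimg c `&` cinv c @^-1` cdom d) (cmap d \o cinv c).

Record surface := Surface {
  carrier :> topologicalType;
  atlas : set (chart carrier);
  surface_hausdorff : hausdorff_space carrier;
  surface_second_countable : @second_countable carrier;
  atlas_cover : forall p : carrier, exists2 c, atlas c & cdom c p;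
  atlas_compatible : forall c d, atlas c -> atlas d -> smooth_transition c d
}.

(* Membership in the maximal atlas. *)
Definition smooth_chart (M : surface) (c : chart M) : Prop :=
  forall d, atlas d -> smooth_transition c d /\ smooth_transition d c.

End AbstractSurfaces.

Section ParametrizedSurfaces.
Variables (R : realType) (s n : nat).
Implicit Types (X : 'rV[R]_2 -> 'rV[R]_n.+1) (x a b : 'rV[R]_2).

(* Here X is a local parametrization of a surface in S^n_s; tangent vectors
   are given by their components in the coordinate frame (X_0, X_1). *)

Definition metric X x : 'M[R]_2 :=
  \matrix_(i, j) pdot s (partial i X x) (partial j X x).

(* Levi-Civita connection of S^n_s on the coordinate fields: the component
   tangent to S^n_s of the flat derivative, X being the unit normal. *)
Definition sphere_connection X x (i j : 'I_2) : 'rV[R]_n.+1 :=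
  let w := partial i (partial j X) x in w - pdot s w (X x) *: X x.

(* Orthogonal projection onto the tangent plane of the surface. *)
Definition tangent_proj X x (w : 'rV[R]_n.+1) : 'rV[R]_n.+1 :=
  \sum_(i < 2) \sum_(j < 2)
    (invmx (metric X x) i j * pdot s w (partial j X x)) *: partial i X x.

Definition sff_coef X x (i j : 'I_2) : 'rV[R]_n.+1 :=
  sphere_connection X x i j - tangent_proj X x (sphere_connection X x i j).

Definition second_fundamental_form X x a b : 'rV[R]_n.+1 :=
  \sum_(i < 2) \sum_(j < 2) (a 0 i * b 0 j) *: sff_coef X x i j.

Definition mean_curvature X x : 'rV[R]_n.+1 :=
  2^-1 *: \sum_(i < 2) \sum_(j < 2) invmx (metric X x) i j *: sff_coef X x i j.

Definition relative_null_space X x : set 'rV[R]_2 :=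
  [set a | forall b, second_fundamental_form X x a b = 0].

Definition positive_nullity_at X x : Prop :=
  exists2 V : {vspace 'rV[R]_2},
    (forall a, (a \in V) <-> relative_null_space X x a) & \dim V <> 0%N.

End ParametrizedSurfaces.

Section SurfacesInSphere.
Variables (R : realType) (s n : nat) (M : surface R).
Implicit Types f : M -> 'rV[R]_n.+1.

(* f is an isometric immersion into S^n_s of M equipped with the metric induced
   by f; non-degeneracy of that metric forces f to be an immersion. *)
Definition pseudo_riemannian_immersion f : Prop :=
  (forall p, pseudosphere s n (f p)) /\
  forall c, atlas c ->
    smooth_on (cimg c) (f \o cinv c) /\
    forall x, cimg c x -> \det (metric s (f \o cinv c) x) != 0.

Definition quasi_minimal f : Prop :=
  forall c x, atlas c -> cimg c x ->
    lightlike s (mean_curvature s (f \o cinv c) x).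

Definition positive_relative_nullity f : Prop :=
  forall c x, atlas c -> cimg c x -> positive_nullity_at s (f \o cinv c) x.

(* Near p, the surface f coincides, up to an isometry of S^n_s, with an open
   piece of the surface parametrized by F on D. *)
Definition congruent_near f (p : M) (D : set 'rV[R]_2)
    (F : 'rV[R]_2 -> 'rV[R]_n.+1) : Prop :=
  exists (c : chart R M) (T : 'rV[R]_n.+1 -> 'rV[R]_n.+1),
    [/\ smooth_chart c, cdom c p, cimg c `<=` D, sphere_isometry s T
      & forall x, cimg c x -> f (cinv c x) = T (F x)].

End SurfacesInSphere.

Section ModelSurfaces.
Variable R : realType.

Definition row5 (x1 x2 x3 x4 x5 : R) : 'rV[R]_5 :=
  \row_(i < 5) nth 0 [:: x1; x2; x3; x4; x5] i.

(* (y, v1, v2, v3, y) *)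
Definition flank (y : R) (v : 'rV[R]_3) : 'rV[R]_5 :=
  row5 y (v 0 0) (v 0 1) (v 0 2%:R) y.

(* alpha is a unit speed curve in S^2_1 with <alpha', alpha'> = c, c = -1 or 1,
   N its unit normal in S^2_1 (so <N, N> = - c) and kappa its curvature. *)
Definition spherical_curve (c : R) (I : set R) (alpha N : R -> 'rV[R]_3)
    (kappa : R -> R) : Prop :=
  smooth_curve_on I alpha /\ smooth_curve_on I N /\
  forall t, I t ->
    [/\ pseudosphere 1 2 (alpha t),
        pdot 1 (derive1 alpha t) (derive1 alpha t) = c,
        [/\ pdot 1 (N t) (alpha t) = 0, pdot 1 (N t) (derive1 alpha t) = 0
          & pdot 1 (N t) (N t) = - c],
        derive1n 2 alpha t = kappa t *: N t - c *: alpha t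
      & derive1 N t = kappa t *: derive1 alpha t].

Definition timelike_spherical_curve := spherical_curve (- 1).
Definition spacelike_spherical_curve := spherical_curve 1.

(* The four families, each given by the domain D = R x I of the parameters
   (s, t) = (x 0 0, x 0 1) and by the map F of x. *)

Definition family_i (D : set 'rV[R]_2) (F : 'rV[R]_2 -> 'rV[R]_5) : Prop :=
  exists (I : set R) (b : R -> R),
    [/\ open_interval I, smooth_curve_on I b,
        D = [set x : 'rV[R]_2 | I (x 0 1)]
      & F = fun x => let s := x 0 0 in let t := x 0 1 in
          row5 (b t * cos s) (cos s * sinh t) (sin s) (cos s * cosh t)
               (b t * cos s)].

Definition family_ii (D : set 'rV[R]_2) (F : 'rV[R]_2 -> 'rV[R]_5) : Prop :=
  exists (I : set R) (t0 : R) (b kappa : R -> R) (alpha N : R -> 'rV[R]_3),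
    [/\ [/\ open_interval I, I t0 & smooth_curve_on I b],
        timelike_spherical_curve I alpha N kappa,
        forall t, I t -> kappa t != 0,
        D = [set x : 'rV[R]_2 | I (x 0 1)]
      & F = fun x => let s := x 0 0 in let t := x 0 1 in
          cos s *: flank (b t) (alpha t) +
          sin s *: flank (oriented_integral t0 t
                            (fun xi => kappa xi * derive1 b xi))
                         (N t)].

Definition family_iii (D : set 'rV[R]_2) (F : 'rV[R]_2 -> 'rV[R]_5) : Prop :=
  exists (I : set R) (b : R -> R),
    [/\ open_interval I, smooth_curve_on I b,
        D = [set x : 'rV[R]_2 | I (x 0 1)]
      & F = fun x => let s := x 0 0 in let t := x 0 1 in
          row5 (b t * cosh s) (sinh s) (cosh s * cos t) (cosh s * sin t)
               (b t * cosh s)].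

Definition family_iv (D : set 'rV[R]_2) (F : 'rV[R]_2 -> 'rV[R]_5) : Prop :=
  exists (I : set R) (t0 eps : R) (b kappa : R -> R) (alpha N : R -> 'rV[R]_3),
    [/\ [/\ open_interval I, I t0, smooth_curve_on I b
          & eps = 1 \/ eps = - 1],
        spacelike_spherical_curve I alpha N kappa,
        forall t, I t -> kappa t != 0,
        D = [set x : 'rV[R]_2 | I (x 0 1)]
      & F = fun x => let s := x 0 0 in let t := x 0 1 in
          cosh s *: flank (b t) (alpha t) +
          (eps * sinh s) *:
            flank (oriented_integral t0 t
                     (fun xi => kappa xi * derive1 b xi))
                  (N t)].

End ModelSurfaces.

(* Main.v *)
(* Let the vector field a span the nullity. The second fundamental form is then
   w w^T Lambda with w(a) = 0 and a single normal vector Lambda, so H is a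
   multiple of <a, a> Lambda: since H is light-like, <a, a> <> 0 and Lambda is
   light-like. Normalize E1 = dX(a) to <E1, E1> = eps = 1 or - 1. Codazzi gives
   D_a E1 = - eps X, so locally X(s, t) = C(s) A(t) + S(s) B(t), where (C, S) is
   (cos, sin) or (cosh, sinh). Rotating (A, B) by an angle depending on t and
   changing t yields a unit speed curve al and a unit vector N with
     al' = T, N' = kappa T, T' = eps al + kappa N + xi, xi light-like.
   The vector xi' is orthogonal to al, N, T and xi, hence parallel to xi, so xi
   has a constant direction; in a basis adapted to it X is of type (ii) if
   eps = 1 and of type (iv) if eps = - 1. Since the initial angle is free,
   kappa can be made non-zero: surfaces of types (i) and (iii) are locally
   also of types (ii) and (iv).

   Conversely the four families have the form C(s) P(t) + S(s) Q(t) with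
   Q' = k P', so that d/ds spans a null direction. This is invariant under an
   isometry T of the pseudosphere, because x |-> |x| T(x / |x|) has vanishing
   second derivative. *)

From HB Require Import structures.
Require Import Defs.
From mathcomp Require Import all_boot all_order all_algebra.
From mathcomp Require Import all_classical all_reals all_analysis.
From mathcomp Require Import perm ring lra.

Set Implicit Arguments.
Unset Strict Implicit.
Unset Printing Implicit Defensive.

Import Order.TTheory GRing.Theory Num.Theory.
Import numFieldNormedType.Exports.

Local Open Scope classical_set_scope.
Local Open Scope ring_scope.

(** * Smooth maps between normed spaces *)

Section DiffEps.
Variables (R : realType) (V W : normedModType R).

Lemma diff_epsP (f : V -> W) (L : {linear V -> W}) x : continuous L ->
  (forall e, 0 < e -> \forall h \near (0 : V),
     `|f (h + x) - f x - L h| <= e * `|h|) ->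
  differentiable f x /\ 'd f x = L :> (V -> W).
Proof.
move=> Lc H.
have E : f \o shift x = cst (f x) + L +o_ (0 : V) id.
  apply/eqaddoP => e e0; have := H e e0; apply: filterS => h.
  by rewrite !fctE /= opprD addrA.
have dE := diff_unique Lc E; split=> //.
by apply/diff_locallyP; rewrite dE.
Qed.

Lemma diff_eps (f : V -> W) x : differentiable f x ->
  forall e, 0 < e -> \forall h \near (0 : V),
     `|f (h + x) - f x - 'd f x h| <= e * `|h|.
Proof.
move=> /diff_locallyP[_ /eqaddoP E] e e0; have := E e e0.
by apply: filterS => h; rewrite !fctE /= opprD addrA.
Qed.

Lemma near_eq_diff (f g : V -> W) x :
  (\forall y \near x, f y = g y) -> differentiable f x -> differentiable g x.
Proof.
move=> fg df; have fgx := nbhs_singleton fg.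
apply: (proj1 (@diff_epsP g ('d f x) x _ _)); first exact: diff_continuous.
move=> e e0; have := diff_eps df e0.
have fg0 : \forall h \near (0 : V), f (h + x) = g (h + x).
  by move: fg; rewrite (near_shift 0)/=; apply: filterS => h /=; rewrite subr0.
by apply: filterS2 fg0 => h fgh; rewrite fgh fgx.
Qed.

End DiffEps.

Section Cn.
Variable R : realType.
Implicit Types V W : normedModType R.

Fixpoint Cn V W (k : nat) (U : set V) (f : V -> W) : Prop :=
  match k with
  | 0 => forall x, U x -> {for x, continuous f}
  | k'.+1 => (forall x, U x -> differentiable f x) /\
             forall v, Cn k' U (fun x => 'D_v f x)
  end.

Definition smooth V W (U : set V) (f : V -> W) := forall k, Cn k U f.

Lemma near_open V (U : set V) x : open U -> U x -> \forall y \near x, U y.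
Proof. by move=> oU Ux; apply: open_nbhs_nbhs. Qed.

Lemma Cn_ext V W k (U : set V) (f g : V -> W) : open U ->
  (forall x, U x -> f x = g x) -> Cn k U f -> Cn k U g.
Proof.
move=> oU; elim: k f g => [|k IH] f g fg /=.
  move=> cf x Ux; have nfg : \forall y \near x, f y = g y.
    by near do apply: fg; exact: near_open.
  rewrite /prop_for /continuous_at -(fg x Ux).
  apply: cvg_trans (cf x Ux).
  by apply: near_eq_cvg; apply: filterS nfg => y ->.
move=> [df Df]; have nfg x : U x -> \forall y \near x, f y = g y.
  by move=> Ux; near do apply: fg; exact: near_open.
split=> [x Ux|v].
  exact: near_eq_diff (nfg x Ux) (df x Ux).
apply: IH (Df v) => x Ux.
exact/near_eq_derive/nfg.
Unshelve. all: by end_near. Qed.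

Lemma Cn_sub V W k (U U' : set V) (f : V -> W) :
  U' `<=` U -> Cn k U f -> Cn k U' f.
Proof.
move=> UU; elim: k f => [|k IH] f /= H; first by move=> x /UU /H.
by case: H => df Df; split=> [x /UU /df//|v]; exact: IH.
Qed.

Lemma Cn_cont V W k (U : set V) (f : V -> W) : Cn k U f ->
  forall x, U x -> {for x, continuous f}.
Proof.
case: k => [//|k] [df _] x Ux; exact/differentiable_continuous/df.
Qed.

Lemma CnW V W k (U : set V) (f : V -> W) : Cn k.+1 U f -> Cn k U f.
Proof.
elim: k f => [|k IH] f; first exact: Cn_cont.
by move=> [df Df]; split=> // v; apply: IH.
Qed.

Lemma Cn_cst V W k (U : set V) (a : W) : Cn k U (fun=> a).
Proof.
elim: k a => [|k IH] a /=; first by move=> x _; apply: cst_continuous.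
split=> [x _|v]; first exact: differentiable_cst.
have -> : (fun x => 'D_v (fun=> a) x) = (fun=> 0) :> (V -> W).
  by apply/funext => x; apply: derive_cst.
exact: IH.
Qed.

Lemma CnD V W k (U : set V) (f g : V -> W) :  open U ->
  Cn k U f -> Cn k U g -> Cn k U (fun x => f x + g x).
Proof.
move=> oU; elim: k f g => [|k IH] f g /=.
  move=> cf cg x Ux; apply: continuousD; [exact: cf|exact: cg].
move=> [df Df] [dg Dg]; split=> [x Ux|v].
  by apply: differentiableD; [exact: df|exact: dg].
apply: Cn_ext (IH _ _ (Df v) (Dg v)) => // x Ux.
by rewrite [RHS]deriveD//; apply: diff_derivable; [exact: df|exact: dg].
Qed.

Lemma diffZr V W (k : V -> R) (f : V -> W) x :
  differentiable k x -> differentiable f x ->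
  differentiable (fun y => k y *: f y) x /\
  forall v, 'D_v (fun y => k y *: f y) x = 'D_v k x *: f x + k x *: 'D_v f x.
Proof.
move=> dk df.
have sb : bilinear_for
    (GRing.Scale.Law.clone _ _ ( *:%R : R -> W -> W) _)
    (GRing.Scale.Law.clone _ _ ( *:%R : R -> W -> W) _)
    ( *:%R : R -> W -> W).
  split=> [u'|u] a x1 y1 /=; first by rewrite scalerDl scalerA.
  by rewrite scalerDr !scalerA mulrC.
pose sm := bilinear_isBilinear.Build R R W W _ _ _ sb.
pose s : {bilinear R -> W -> W} := HB.pack ( *:%R : R -> W -> W) sm.
have sc : continuous (fun p : R * W => s p.1 p.2).
  exact: scale_continuous.
have dp : differentiable (fun y => (k y, f y)) x by apply: differentiable_pair.
have ds := differentiable_bilin (k x, f x) sc.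
have E : (fun y => k y *: f y) = (fun p => s p.1 p.2) \o (fun y => (k y, f y)).
  by [].
have D : differentiable (fun y => k y *: f y) x.
  by rewrite E; apply: differentiable_comp.
split=> // v; rewrite deriveE// {1}E (diff_comp dp ds).
rewrite -[LHS]/('d (fun p => s p.1 p.2) (k x, f x) ('d (fun y => (k y, f y)) x v)).
rewrite (diff_bilin _ sc) diff_pair// -[LHS]/(k x *: 'd f x v + 'd k x v *: f x).
by rewrite addrC !deriveE.
Qed.

Lemma CnZ V W k (U : set V) (c : V -> R) (f : V -> W) : open U ->
  Cn k U c -> Cn k U f -> Cn k U (fun x => c x *: f x).
Proof.
move=> oU; elim: k c f => [|k IH] c f.
  by move=> cc cf x Ux; apply: (@continuousZ R W V c f); [exact: cc|exact: cf].
move=> Hc Hf; have cc := CnW Hc; have cf := CnW Hf.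
case: Hc => dc Dc; case: Hf => df Df.
split=> [x Ux|v]; first by have [] := diffZr (dc x Ux) (df x Ux).
apply: (@Cn_ext _ _ _ _ (fun x => 'D_v c x *: f x + c x *: 'D_v f x)) => //.
  by move=> x Ux; have [_ ->] := diffZr (dc x Ux) (df x Ux).
by apply: CnD => //; apply: IH; [exact: Dc|exact: cf|exact: cc|exact: Df].
Qed.

Lemma Cn_sum V W k (U : set V) n (F : 'I_n -> V -> W) : open U ->
  (forall i, Cn k U (F i)) -> Cn k U (fun x => \sum_(i < n) F i x).
Proof.
move=> oU; elim: n F => [|n IH] F H.
  apply: (@Cn_ext _ _ _ _ (fun=> 0)) => //; last exact: Cn_cst.
  by move=> x _; rewrite big_ord0.
apply: (@Cn_ext _ _ _ _ (fun x => (\sum_(i < n) F (widen_ord (leqnSn n) i) x)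
   + F ord_max x)) => //; last by apply: CnD => //; apply: IH.
by move=> x _; rewrite big_ord_recr.
Qed.

Lemma Cn_prod V k (U : set V) n (F : 'I_n -> V -> R) : open U ->
  (forall i, Cn k U (F i)) -> Cn k U (fun x => \prod_(i < n) F i x).
Proof.
move=> oU; elim: n F => [|n IH] F H.
  apply: (@Cn_ext V R k U (fun=> 1)) => //; last exact: Cn_cst.
  by move=> x _; rewrite big_ord0.
apply: (@Cn_ext V R k U (fun x => (\prod_(i < n) F (widen_ord (leqnSn n) i) x)
   *: (F ord_max x : R))) => //; last by apply: CnZ => //; apply: IH.
by move=> x _; rewrite big_ord_recr.
Qed.

Lemma derive_chain (U V W : normedModType R) (f : U -> V) (g : V -> W) x v :
  differentiable f x -> differentiable g (f x) ->
  'D_v (fun y => g (f y)) x = 'D_('D_v f x) g (f x).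
Proof.
move=> df dg; rewrite deriveE; last exact: (differentiable_comp df dg).
by rewrite (diff_comp df dg)/= -!deriveE.
Qed.

Lemma deriveZv V W (f : V -> W) x a v : differentiable f x ->
  'D_(a *: v) f x = a *: 'D_v f x.
Proof. by move=> df; rewrite !deriveE// linearZ. Qed.

Lemma derive_sumv V W (f : V -> W) x n (v : 'I_n -> V) : differentiable f x ->
  'D_(\sum_i v i) f x = \sum_i 'D_(v i) f x.
Proof.
by move=> df; rewrite deriveE// linear_sum; apply: eq_bigr => i _; rewrite deriveE.
Qed.

Lemma derive_rV n W (f : 'rV[R]_n -> W) x (v : 'rV[R]_n) : differentiable f x ->
  'D_v f x = \sum_i v 0 i *: 'D_(delta_mx 0 i) f x.
Proof.
move=> df; rewrite {1}(row_sum_delta v) derive_sumv//.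
by apply: eq_bigr => i _; rewrite deriveZv.
Qed.

Lemma derive_R W (f : R -> W) x (v : R) : differentiable f x ->
  'D_v f x = v *: 'D_1 f x.
Proof. by move=> df; rewrite -deriveZv//; congr ('D_ _ f x); rewrite [RHS]mulr1. Qed.

Lemma derive_coord V m n (f : V -> 'M[R]_(m, n)) x v i j : differentiable f x ->
  'D_v (fun y => f y i j) x = ('D_v f x) i j.
Proof.
move=> df; rewrite derive_mx; last exact: diff_derivable.
by rewrite mxE.
Qed.

Lemma diff_coord V m n (f : V -> 'M[R]_(m, n)) x i j : differentiable f x ->
  differentiable (fun y => f y i j) x.
Proof.
move=> df; apply: (@differentiable_comp _ _ _ _ f (fun M => M i j)) df _.
exact: differentiable_coord.
Qed.

Lemma Cn_coord V m n k (U : set V) (f : V -> 'M[R]_(m, n)) i j : open U ->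
  Cn k U f -> Cn k U (fun x => f x i j).
Proof.
move=> oU; elim: k f => [|k IH] f.
  move=> cf x Ux; apply: (@continuous_comp _ _ _ f (fun M => M i j)) (cf x Ux) _.
  exact: coord_continuous.
move=> [df Df]; split=> [x Ux|v]; first exact/diff_coord/df.
apply: Cn_ext (IH _ (Df v)) => // x Ux.
by rewrite derive_coord//; exact: df.
Qed.

Lemma Cn_row V n k (U : set V) (f : V -> 'rV[R]_n) : open U ->
  (forall i, Cn k U (fun x => f x 0 i)) -> Cn k U f.
Proof.
move=> oU H; apply: (@Cn_ext _ _ _ _
  (fun x => \sum_i f x 0 i *: (delta_mx 0 i : 'rV[R]_n))) => //.
  by move=> x _; rewrite -row_sum_delta.
by apply: Cn_sum => // i; apply: CnZ => //; apply: Cn_cst.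
Qed.

Lemma Cn_comp_rV V W m k (U : set V) (U' : set 'rV[R]_m) (f : V -> 'rV[R]_m)
    (g : 'rV[R]_m -> W) : open U -> (forall x, U x -> U' (f x)) ->
  Cn k U f -> Cn k U' g -> Cn k U (fun x => g (f x)).
Proof.
move=> oU UU; elim: k f g UU => [|k IH] f g UU.
  move=> cf cg x Ux; apply: (@continuous_comp _ _ _ f g) (cf x Ux) _.
  exact/cg/UU.
move=> Hf Hg; have cf := CnW Hf; have cg := CnW Hg.
case: Hf => df Df; case: Hg => dg Dg.
split=> [x Ux|v].
  exact: (@differentiable_comp _ _ _ _ f g x (df x Ux) (dg _ (UU _ Ux))).
apply: (@Cn_ext _ _ _ _ (fun x => \sum_i (('D_v f x) 0 i) *:
   'D_(delta_mx 0 i) g (f x))) => //.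
  move=> x Ux; have dgx := dg _ (UU _ Ux); rewrite (derive_chain _ (df x Ux) dgx).
  by rewrite (derive_rV ('D_v f x)).
apply: Cn_sum => // i; apply: CnZ => //; first exact/Cn_coord/(Df v).
exact: (IH f _ UU cf (Dg _)).
Qed.

Lemma Cn_comp_R V W k (U : set V) (U' : set R) (f : V -> R)
    (g : R -> W) : open U -> (forall x, U x -> U' (f x)) ->
  Cn k U f -> Cn k U' g -> Cn k U (fun x => g (f x)).
Proof.
move=> oU UU; elim: k f g UU => [|k IH] f g UU.
  move=> cf cg x Ux; apply: (@continuous_comp _ _ _ f g) (cf x Ux) _.
  exact/cg/UU.
move=> Hf Hg; have cf := CnW Hf; have cg := CnW Hg.
case: Hf => df Df; case: Hg => dg Dg.
split=> [x Ux|v].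
  exact: (@differentiable_comp _ _ _ _ f g x (df x Ux) (dg _ (UU _ Ux))).
apply: (@Cn_ext _ _ _ _ (fun x => 'D_v f x *: 'D_1 g (f x))) => //.
  move=> x Ux; have dgx := dg _ (UU _ Ux); rewrite (derive_chain _ (df x Ux) dgx).
  by rewrite (derive_R ('D_v f x)).
by apply: CnZ => //; [exact: (Df v)|exact: (IH f _ UU cf (Dg _))].
Qed.

Lemma Cn_id V k (U : set V) : Cn k U (id : V -> V).
Proof.
case: k => [|k]; first by move=> x _.
split=> [x _|v].
  by have := @is_diff_id R V x; case.
have -> : (fun x => 'D_v id x) = (fun=> v) by apply/funext => x; apply: derive_id.
exact: Cn_cst.
Qed.

Lemma CnM V k (U : set V) (f g : V -> R) : open U ->
  Cn k U f -> Cn k U g -> Cn k U (fun x => f x * g x).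
Proof. exact: CnZ. Qed.

Lemma CnN V W k (U : set V) (f : V -> W) : open U ->
  Cn k U f -> Cn k U (fun x => - f x).
Proof.
move=> oU Hf; apply: (@Cn_ext _ _ _ _ (fun x => (-1) *: f x)) => //.
  by move=> x _; rewrite scaleN1r.
by apply: CnZ => //; apply: Cn_cst.
Qed.

Lemma CnB V W k (U : set V) (f g : V -> W) : open U ->
  Cn k U f -> Cn k U g -> Cn k U (fun x => f x - g x).
Proof. by move=> oU Hf Hg; apply: CnD => //; apply: CnN. Qed.

Lemma Cn_deriv k (U : set R) (W : normedModType R) (g g' : R -> W) : open U ->
  (forall x, U x -> is_derive x 1 g (g' x)) -> Cn k U g' -> Cn k.+1 U g.
Proof.
move=> oU H Hg; split=> [x Ux|v].
  by apply/derivable1_diffP; case: (H x Ux).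
apply: (@Cn_ext _ _ _ _ (fun x => v *: g' x)) => //.
  move=> x Ux; rewrite (derive_R v); last by apply/derivable1_diffP; case: (H x Ux).
  by case: (H x Ux) => _ ->.
by apply: CnZ => //; apply: Cn_cst.
Qed.

Lemma Cn_deriv0 (U : set R) (W : normedModType R) (g g' : R -> W) :
  (forall x, U x -> is_derive x 1 g (g' x)) -> Cn 0 U g.
Proof.
move=> H x Ux; apply/differentiable_continuous/derivable1_diffP.
by case: (H x Ux).
Qed.

Lemma Cn_inv k : Cn k [set x : R | x != 0] (fun x => x^-1).
Proof.
have oU : open [set x : R | x != 0] by exact: open_neq.
have D (x : R) : x != 0 -> is_derive x 1 (fun x => x^-1) (- x^-1 * x^-1).
  move=> x0; apply: DeriveDef; first by apply: (@derivableV R _ id).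
  by rewrite (@deriveV R _ id)// derive_id /= [LHS]mulr1 expr2 invfM mulNr.
elim: k => [|k IH]; first exact: Cn_deriv0 D.
apply: Cn_deriv D _ => //; apply: CnM => //; exact: CnN.
Qed.

Lemma Cn_expR k (U : set R) : open U -> Cn k U (@expR R).
Proof.
move=> oU; elim: k => [|k IH]; first exact: (Cn_deriv0 (fun x _ => is_derive_expR x)).
exact: (Cn_deriv oU (fun x _ => is_derive_expR x) IH).
Qed.

Lemma Cn_sincos k (U : set R) : open U -> Cn k U (@sin R) /\ Cn k U (@cos R).
Proof.
move=> oU; elim: k => [|k [IH1 IH2]].
  split; first exact: (Cn_deriv0 (fun x _ => is_derive_sin x)).
  exact: (Cn_deriv0 (fun x _ => is_derive_cos x)).
split; first exact: (Cn_deriv oU (fun x _ => is_derive_sin x) IH2).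
exact: (Cn_deriv oU (fun x _ => is_derive_cos x) (CnN oU IH1)).
Qed.

Lemma Cn_ln k : Cn k [set x : R | 0 < x] (@ln R).
Proof.
have oU : open [set x : R | 0 < x] by exact: open_gt.
have D (x : R) : 0 < x -> is_derive x 1 (@ln R) x^-1 by move=> x0; exact: is_derive1_ln.
case: k => [|k]; first exact: Cn_deriv0 D.
apply: Cn_deriv D _ => //; apply: Cn_sub (Cn_inv k) => x /= x0; lra.
Qed.

Lemma Cn_atan k (U : set R) : open U -> Cn k U (@atan R).
Proof.
move=> oU.
have D (x : R) : U x -> is_derive x 1 (@atan R) (1 + x ^+ 2)^-1.
  by move=> _; apply: is_derive1_atan.
case: k => [|k]; first exact: Cn_deriv0 D.
apply: Cn_deriv D _ => //.
apply: (@Cn_comp_R R R k U [set x : R | x != 0] (fun x => 1 + x ^+ 2) (fun x => x^-1)) => //.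
- by move=> x _ /=; have := sqr_ge0 x; lra.
- exact: (@CnD R R k U (fun=> 1) (fun x => x * x) oU (Cn_cst _ _ _)
    (CnM oU (Cn_id _ _) (Cn_id _ _))).
exact: Cn_inv.
Qed.

End Cn.

Section SmoothWrap.
Variable R : realType.
Implicit Types V W : normedModType R.

Lemma smooth_ext V W (U : set V) (f g : V -> W) : open U ->
  (forall x, U x -> f x = g x) -> smooth U f -> smooth U g.
Proof. by move=> oU fg H k; apply: Cn_ext (H k). Qed.

Lemma smooth_sub V W (U U' : set V) (f : V -> W) :
  U' `<=` U -> smooth U f -> smooth U' f.
Proof. by move=> UU H k; apply: Cn_sub (H k). Qed.

Lemma smooth_diff V W (U : set V) (f : V -> W) x : smooth U f -> U x ->
  differentiable f x.
Proof. by move=> H Ux; have [+ _] := H 1%N; apply. Qed.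

Lemma smooth_cont V W (U : set V) (f : V -> W) x : smooth U f -> U x ->
  {for x, continuous f}.
Proof. by move=> H; have := H 0%N; apply. Qed.

Lemma smooth_deriv V W (U : set V) (f : V -> W) v : smooth U f ->
  smooth U (fun x => 'D_v f x).
Proof. by move=> H k; have [_] := H k.+1; apply. Qed.

Lemma smooth_cst V W (U : set V) (a : W) : smooth U (fun=> a).
Proof. by move=> k; apply: Cn_cst. Qed.

Lemma smooth_id V (U : set V) : smooth U (id : V -> V).
Proof. by move=> k; apply: Cn_id. Qed.

Lemma smoothD V W (U : set V) (f g : V -> W) : open U ->
  smooth U f -> smooth U g -> smooth U (fun x => f x + g x).
Proof. by move=> oU Hf Hg k; apply: CnD. Qed.

Lemma smoothN V W (U : set V) (f : V -> W) : open U ->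
  smooth U f -> smooth U (fun x => - f x).
Proof. by move=> oU Hf k; apply: CnN. Qed.

Lemma smoothB V W (U : set V) (f g : V -> W) : open U ->
  smooth U f -> smooth U g -> smooth U (fun x => f x - g x).
Proof. by move=> oU Hf Hg k; apply: CnB. Qed.

Lemma smoothZ V W (U : set V) (c : V -> R) (f : V -> W) : open U ->
  smooth U c -> smooth U f -> smooth U (fun x => c x *: f x).
Proof. by move=> oU Hf Hg k; apply: CnZ. Qed.

Lemma smoothM V (U : set V) (f g : V -> R) : open U ->
  smooth U f -> smooth U g -> smooth U (fun x => f x * g x).
Proof. by move=> oU Hf Hg k; apply: CnM. Qed.

Lemma smooth_sum V W (U : set V) n (F : 'I_n -> V -> W) : open U ->
  (forall i, smooth U (F i)) -> smooth U (fun x => \sum_(i < n) F i x).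
Proof. by move=> oU H k; apply: Cn_sum => // i; apply: H. Qed.

Lemma smooth_prod V (U : set V) n (F : 'I_n -> V -> R) : open U ->
  (forall i, smooth U (F i)) -> smooth U (fun x => \prod_(i < n) F i x).
Proof. by move=> oU H k; apply: Cn_prod => // i; apply: H. Qed.

Lemma smooth_coord V m n (U : set V) (f : V -> 'M[R]_(m, n)) i j : open U ->
  smooth U f -> smooth U (fun x => f x i j).
Proof. by move=> oU H k; apply: Cn_coord. Qed.

Lemma smooth_row V n (U : set V) (f : V -> 'rV[R]_n) : open U ->
  (forall i, smooth U (fun x => f x 0 i)) -> smooth U f.
Proof. by move=> oU H k; apply: Cn_row => // i; apply: H. Qed.

Lemma smooth_comp_rV V W m (U : set V) (U' : set 'rV[R]_m) (f : V -> 'rV[R]_m)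
    (g : 'rV[R]_m -> W) : open U -> (forall x, U x -> U' (f x)) ->
  smooth U f -> smooth U' g -> smooth U (fun x => g (f x)).
Proof. by move=> oU UU Hf Hg k; apply: Cn_comp_rV UU (Hf k) (Hg k). Qed.

Lemma smooth_comp_R V W (U : set V) (U' : set R) (f : V -> R)
    (g : R -> W) : open U -> (forall x, U x -> U' (f x)) ->
  smooth U f -> smooth U' g -> smooth U (fun x => g (f x)).
Proof. by move=> oU UU Hf Hg k; apply: Cn_comp_R UU (Hf k) (Hg k). Qed.

Lemma smoothV V (U : set V) (f : V -> R) : open U ->
  (forall x, U x -> f x != 0) -> smooth U f -> smooth U (fun x => (f x)^-1).
Proof.
move=> oU U0 H.
exact: (@smooth_comp_R V R U [set x | x != 0] f _ oU U0 H (@Cn_inv R)).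
Qed.

Lemma smooth_det V (U : set V) n (M : V -> 'M[R]_n) : open U ->
  (forall i j, smooth U (fun x => M x i j)) -> smooth U (fun x => \det (M x)).
Proof.
move=> oU H; rewrite /determinant.
pose F (s : {perm 'I_n}) (x : V) := (-1) ^+ s * \prod_i M x i (s i).
have HF s : smooth U (F s).
  apply: smoothM => //; first exact: smooth_cst.
  by apply: smooth_prod.
apply: (@smooth_ext V R U (fun x => \sum_(i < #|{: {perm 'I_n}}|) F (enum_val i) x)) => //.
  by move=> x _; rewrite -(big_enum_val (fun s => F s x)); apply: eq_bigl.
by apply: smooth_sum => // i; exact: HF.
Qed.

Lemma smooth_invmx V (U : set V) n (M : V -> 'M[R]_n) : open U ->
  (forall i j, smooth U (fun x => M x i j)) ->
  (forall x, U x -> \det (M x) != 0) ->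
  forall i j, smooth U (fun x => invmx (M x) i j).
Proof.
move=> oU H U0 i j.
apply: (@smooth_ext V R U (fun x => (\det (M x))^-1 * cofactor (M x) j i)) => //.
  by move=> x Ux; rewrite /invmx unitmxE unitfE U0// !mxE.
apply: smoothM => //.
  by apply: smoothV => //; apply: smooth_det.
apply: smoothM => //; first exact: smooth_cst.
apply: smooth_det => // k l.
by apply: (@smooth_ext V R U (fun x => M x (lift j k) (lift i l))) => // x _; rewrite !mxE.
Qed.

Lemma Ck_Cn n m k (U : set 'rV[R]_n) (f : 'rV[R]_n -> 'rV[R]_m) : open U ->
  Ck k U f <-> Cn k U f.
Proof.
move=> oU; elim: k f => [//|k IH] f; split=> -[df Df]; split=> // i.
  apply: (@Cn_ext _ _ _ _ _ (fun x => \sum_j i 0 j *: 'D_(delta_mx 0 j) f x)) => //.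
    by move=> x Ux; rewrite (derive_rV i)//; exact: df.
  by apply: Cn_sum => // j; apply: CnZ => //; [exact: Cn_cst|exact/IH/Df].
exact/IH/Df.
Qed.

Lemma smooth_onP n m (U : set 'rV[R]_n) (f : 'rV[R]_n -> 'rV[R]_m) : open U ->
  smooth_on U f <-> smooth U f.
Proof. by move=> oU; split=> H k; apply/Ck_Cn. Qed.

Lemma smooth_curveW W (I : set R) (g : R -> W) : open I -> smooth I g ->
  smooth_curve_on I g.
Proof.
move=> oI H k; elim: k g H => [|k IH] g H t It.
  exact/derivable1_diffP/(smooth_diff H).
have H' : smooth I (derive1 g).
  apply: (@smooth_ext R W I (fun x => 'D_1 g x)) => //; last exact: smooth_deriv.
  by move=> x _; rewrite derive1E.
by have := IH _ H' t It; rewrite derive1Sn.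
Qed.

End SmoothWrap.

Section MeanValue.
Variable R : realType.

Lemma is_derive_line (V W : normedModType R) (f : V -> W) a u (s : R) :
  differentiable f (a + s *: u) ->
  is_derive s 1 (fun s => f (a + s *: u)) ('D_u f (a + s *: u)).
Proof.
move=> df; pose l (s : R) := a + s *: u.
have dl : differentiable l s.
  by apply: differentiableD => //; apply: differentiableZl.
have Dl : 'D_1 l s = u.
  have [_ H] := diffZr (@ex_diff _ _ _ _ _ _ _ (is_diff_id s)) (differentiable_cst u s).
  rewrite deriveD; [|exact: derivable_cst|].
    by rewrite derive_cst add0r H derive_id derive_cst scaler0 addr0 scale1r.
  by apply/derivable1_diffP/differentiableZl.
apply: DeriveDef.
  by apply/derivable1_diffP/(@differentiable_comp _ _ _ _ l f).
by rewrite (derive_chain _ dl df) Dl.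
Qed.

Lemma mvt_line (V : normedModType R) (f : V -> R) a u (h : R) : 0 < h ->
  (forall s, 0 <= s <= h -> differentiable f (a + s *: u)) ->
  exists2 s, 0 < s < h & f (a + h *: u) - f a = h * 'D_u f (a + s *: u).
Proof.
move=> h0 df.
have D s : 0 <= s <= h -> is_derive s 1 (fun s => f (a + s *: u)) ('D_u f (a + s *: u)).
  by move=> /df; exact: is_derive_line.
have [||c] := @MVT R (fun s => f (a + s *: u)) (fun s => 'D_u f (a + s *: u)) 0 h h0.
- by move=> s; rewrite in_itv /= => /andP[s0 sh]; apply: D; rewrite !ltW.
- apply: derivable_within_continuous => s; rewrite in_itv /= => /D[].
  by [].
rewrite in_itv /= => ch; rewrite scale0r addr0 subr0 mulrC => E.
by exists c.
Qed.

Lemma dist_halves (e a b c : R) :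
  `|a - c| <= e / 2 -> `|b - c| <= e / 2 -> `|a - b| <= e.
Proof. by move=> ac bc; have := ler_distD c a b; rewrite (distrC c); lra. Qed.

(* The left side is symmetric in u and v, the right side is not. *)
Lemma second_difference (V : normedModType R) (U : set V) (f : V -> R) x u v h : 0 < h ->
  (forall s t, 0 <= s <= h -> 0 <= t <= h -> U (x + s *: u + t *: v)) ->
  (forall y, U y -> differentiable f y) ->
  (forall y, U y -> differentiable (fun z => 'D_u f z) y) ->
  exists s t, [/\ 0 <= s <= h, 0 <= t <= h &
    f (x + h *: u + h *: v) - f (x + h *: u) - (f (x + h *: v) - f x) =
    h * (h * 'D_v (fun y => 'D_u f y) (x + s *: u + t *: v))].
Proof.
move=> h0 mU df du.
have h00 : 0 <= (0 : R) <= h by rewrite lexx ltW.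
have hh : 0 <= h <= h by rewrite lexx ltW.
have hin s : 0 < s < h -> 0 <= s <= h by case/andP=> *; rewrite !ltW.
have dsh s : 0 <= s <= h -> differentiable (fun z => f (z + h *: v)) (x + s *: u) /\
    'D_u (fun z => f (z + h *: v)) (x + s *: u) = 'D_u f (x + s *: u + h *: v).
  move=> sh; have dg := df _ (mU _ _ sh hh).
  have dw : differentiable (fun z => z + h *: v) (x + s *: u) by apply: differentiableD.
  split; first exact: (@differentiable_comp _ _ _ _ (fun z => z + h *: v) f).
  rewrite (derive_chain _ dw dg) deriveD; [|exact: derivable_id|exact: derivable_cst].
  by rewrite derive_id derive_cst addr0.
have df0 s : 0 <= s <= h -> differentiable f (x + s *: u).
  by move=> sh; apply: df; have := mU s 0 sh h00; rewrite scale0r addr0.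
have [|s sh E] := @mvt_line V (fun y => f (y + h *: v) - f y) x u h h0.
  by move=> s sh; apply: differentiableB (df0 _ sh); exact: (proj1 (dsh _ sh)).
have [t th E'] := @mvt_line V (fun y => 'D_u f y) (x + s *: u) v h h0
  (fun t th => du _ (mU _ _ (hin _ sh) th)).
exists s, t; split; [exact: hin|exact: hin|rewrite E -E'; congr (_ * _)].
have [D1 D2] := dsh _ (hin _ sh).
by rewrite deriveB ?D2//; [exact: diff_derivable|exact/diff_derivable/df0/hin].
Qed.

Lemma clairaut_scalar (V : normedModType R) (U : set V) (f : V -> R) x u v :
  open U -> U x -> Cn 2 U f ->
  'D_u (fun y => 'D_v f y) x = 'D_v (fun y => 'D_u f y) x.
Proof.
move=> oU Ux [df Df].
have [du cu] := Df u; have [dv cv] := Df v.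
have [r r0 rU] : exists2 r, 0 < r & ball x r `<=` U.
  by have /nbhs_ballP[r r0 H] := near_open oU Ux; exists r.
apply/eqP; rewrite -subr_eq0; apply/eqP/normr0_eq0/le_anti; rewrite normr_ge0 andbT.
apply/ler_addgt0Pl => e e0; rewrite addr0.
have e2 : 0 < e / 2 by lra.
have /cvgrPdist_lt/(_ _ e2)/nbhs_ballP[r1 /= r10 H1] := cv u x Ux.
have /cvgrPdist_lt/(_ _ e2)/nbhs_ballP[r2 /= r20 H2] := cu v x Ux.
pose m := Num.min r (Num.min r1 r2).
have m0 : 0 < m by rewrite !lt_min r0 r10 r20.
pose K := `|u| + `|v| + 1.
have K0 : 0 < K by rewrite /K; have := normr_ge0 u; have := normr_ge0 v; lra.
pose h := m / K / 2.
have h0 : 0 < h by rewrite !divr_gt0.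
have mball s t : 0 <= s <= h -> 0 <= t <= h -> ball x m (x + s *: u + t *: v).
  move=> /andP[s0 sh] /andP[t0 th].
  rewrite -ball_normE /ball_ /= opprD addrA opprD addrA subrr add0r.
  apply: le_lt_trans (ler_normB _ _) _; rewrite normrN !normrZ !ger0_norm//.
  apply: (@le_lt_trans _ _ (h * (`|u| + `|v|))).
    by rewrite mulrDr lerD// ler_wpM2r.
  have -> : h * (`|u| + `|v|) = m * ((`|u| + `|v|) / K / 2) by rewrite /h; ring.
  rewrite gtr_pMr//.
  have : (`|u| + `|v|) / K < 1 by rewrite ltr_pdivrMr// mul1r /K ltrDl.
  by lra.
have mU s t : 0 <= s <= h -> 0 <= t <= h -> U (x + s *: u + t *: v).
  move=> sh th; apply: rU; apply: le_ball (mball _ _ sh th).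
  by rewrite ge_min lexx.
have mU' s t : 0 <= s <= h -> 0 <= t <= h -> U (x + s *: v + t *: u).
  by move=> sh th; rewrite addrAC; exact: mU.
have [s1 [t1 [s1h t1h E1]]] := second_difference h0 mU df du.
have [s2 [t2 [s2h t2h E2]]] := second_difference h0 mU' df dv.
have EE : 'D_v (fun y => 'D_u f y) (x + s1 *: u + t1 *: v) =
          'D_u (fun y => 'D_v f y) (x + s2 *: v + t2 *: u).
  have h0' : h != 0 by rewrite gt_eqF.
  apply: (mulfI h0'); apply: (mulfI h0').
  have aux (a b c d : R) : a - b - (c - d) = a - c - (b - d) by ring.
  by rewrite -[LHS]E1 -[RHS]E2 [x + h *: v + _]addrAC; exact: aux.
have B1 : ball x r1 (x + s2 *: v + t2 *: u).
  by rewrite addrAC; apply: le_ball (mball _ _ t2h s2h); rewrite !ge_min lexx !orbT.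
have B2 : ball x r2 (x + s1 *: u + t1 *: v).
  by apply: le_ball (mball _ _ s1h t1h); rewrite !ge_min lexx !orbT.
have C1 := ltW (H1 _ B1); have C2 := ltW (H2 _ B2); rewrite /= EE in C2.
exact: dist_halves C1 C2.
Qed.

Lemma clairaut (V : normedModType R) (U : set V) m (f : V -> 'rV[R]_m) x u v :
  open U -> U x -> Cn 2 U f ->
  'D_u (fun y => 'D_v f y) x = 'D_v (fun y => 'D_u f y) x.
Proof.
move=> oU Ux H; apply/rowP => i.
have H' := Cn_coord 0 i oU H; have := clairaut_scalar u v oU Ux H'.
case: (H) => df Df.
have E w y : U y -> 'D_w (fun y => f y 0 i) y = ('D_w f y) 0 i.
  by move=> Uy; rewrite derive_coord//; exact: df.
have E2 w z : 'D_w (fun y => 'D_z (fun y => f y 0 i) y) x = ('D_w (fun y => 'D_z f y) x) 0 i.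
  rewrite -derive_coord; last by have [d _] := Df z; exact: d.
  apply: near_eq_derive; near=> y; apply: E; near: y; exact: near_open.
by rewrite !E2.
Unshelve. all: by end_near. Qed.

End MeanValue.

HB.instance Definition _ (R : realType) m n := Complete.on 'M[R]_(m, n).

Section RowNorm.
Variable R : realType.

Lemma ler_coord_norm n (x : 'rV[R]_n) i : `|x 0 i| <= `|x|.
Proof.
rewrite [leRHS]/Num.Def.normr/= mx_normrE.
exact: (le_bigmax _ (fun ij : 'I_1 * 'I_n => `|x ij.1 ij.2|) (0, i)).
Qed.

Lemma row_norm_le n (x : 'rV[R]_n) M : 0 <= M -> (forall i, `|x 0 i| <= M) ->
  `|x| <= M.
Proof.
move=> M0 H; rewrite [leLHS]/Num.Def.normr/= mx_normrE.
by apply: bigmax_le => // -[i j] _ /=; rewrite (ord1 i).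
Qed.

Lemma smooth_mulmx (V : normedModType R) (U : set V) m n (f : V -> 'rV[R]_m)
    (A : 'M[R]_(m, n)) : open U ->
  smooth U f -> smooth U (fun x => f x *m A).
Proof.
move=> oU H; apply: smooth_row => // i.
apply: (@smooth_ext R V R U (fun x => \sum_j f x 0 j * A j i)) => //.
  by move=> x _; rewrite mxE.
apply: smooth_sum => // j; apply: smoothM => //; first exact: smooth_coord.
exact: smooth_cst.
Qed.

Lemma mulmxr_continuous m n (A : 'M[R]_(m, n)) :
  continuous (mulmxr A : 'rV[R]_m -> 'rV[R]_n).
Proof.
move=> x; have H := smooth_mulmx A (@openT _) (@smooth_id R _ setT).
exact: (smooth_cont H).
Qed.

Lemma diff_mulmx (V : normedModType R) m n (f : V -> 'rV[R]_m)
    (A : 'M[R]_(m, n)) x : differentiable f x ->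
  differentiable (fun x => f x *m A) x /\
  forall v, 'D_v (fun x => f x *m A) x = 'D_v f x *m A.
Proof.
move=> df; have Ac := @mulmxr_continuous _ _ A.
have dA : differentiable (mulmxr A : 'rV[R]_m -> 'rV[R]_n) (f x).
  exact: linear_differentiable.
split; first exact: (@differentiable_comp _ _ _ _ f (mulmxr A)).
move=> v; rewrite (derive_chain (g := mulmxr A) v df dA).
by rewrite deriveE// diff_lin.
Qed.

Lemma mulmx_bound m n (A : 'M[R]_(m, n)) :
  exists2 K, 0 < K & forall v : 'rV[R]_m, `|v *m A| <= K * `|v|.
Proof. exact: (linear_lipschitz (@mulmxr_continuous _ _ A)). Qed.

Lemma convex_lt (s a b r : R) : 0 <= s -> s <= 1 -> a < r -> b < r ->
  (1 - s) * a + s * b < r.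
Proof.
move=> s0 s1 ar br; have [->|s10] := eqVneq s 1.
  by rewrite subrr mul0r add0r mul1r.
have s1' : 0 < 1 - s by rewrite subr_gt0 lt_neqAle s10.
have := ler_wpM2l s0 (ltW br); have := ar; rewrite -(ltr_pM2l s1').
by lra.
Qed.

Lemma lipschitz_cont (V W : normedModType R) (f : V -> W) (U : set V) y K :
  open U -> U y -> 0 < K ->
  (forall z, U z -> `|f y - f z| <= K * `|y - z|) -> {for y, continuous f}.
Proof.
move=> oU Uy K0 H; rewrite /prop_for /continuous_at; apply/cvgrPdist_le => e e0.
near=> z; have Uz : U z by near: z; exact: (near_open oU Uy).
apply: le_trans (H _ Uz) _; rewrite mulrC -ler_pdivlMr//.
near: z; apply/nbhs_ballP; exists (e / K); first exact: divr_gt0.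
by move=> z; rewrite -ball_normE => /ltW.
Unshelve. all: by end_near. Qed.

Lemma half_bound (a g m M : R) : a <= g + m -> m <= M -> g <= 1 / 2 * a ->
  a <= 2 * M.
Proof. by move=> *; lra. Qed.

Lemma half_le0 (a : R) : a <= 1 / 2 * a -> a <= 0.
Proof. by move=> *; lra. Qed.

Lemma half_radius (r a b g m M : R) : a <= r / 2 -> M <= r / 4 -> b <= g + m ->
  m <= M -> g <= 1 / 2 * a -> b <= r / 2.
Proof. by move=> *; lra. Qed.

Lemma ball_segment n (x0 x y : 'rV[R]_n) r (s : R) :
  ball x0 r x -> ball x0 r y -> 0 <= s <= 1 -> ball x0 r (x + s *: (y - x)).
Proof.
rewrite -ball_normE /ball_ /= => xr yr /andP[s0 s1].
have -> : x0 - (x + s *: (y - x)) = (1 - s) *: (x0 - x) + s *: (x0 - y).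
  by apply/rowP => i; rewrite !mxE; ring.
apply: le_lt_trans (ler_normD _ _) _; rewrite !normrZ !ger0_norm ?subr_ge0//.
exact: convex_lt.
Qed.

Lemma lipschitz_partials n (x0 x y : 'rV[R]_n) r (g : 'rV[R]_n -> R) c :
  (forall z, ball x0 r z -> differentiable g z) ->
  (forall z j, ball x0 r z -> `|'D_(delta_mx 0 j) g z| <= c) ->
  ball x0 r x -> ball x0 r y -> `|g y - g x| <= n%:R * c * `|y - x|.
Proof.
move=> dg bg Bx By.
have B s : 0 <= s <= 1 -> ball x0 r (x + s *: (y - x)).
  by move=> s01; apply: ball_segment.
have [|s s01] := @mvt_line R _ g x (y - x) 1 ltr01.
  by move=> s s01; apply/dg/B.
rewrite scale1r (addrC x) subrK mul1r => ->.
have Bs : ball x0 r (x + s *: (y - x)).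
  by apply: B; case/andP: s01 => *; rewrite !ltW.
rewrite derive_rV; last exact: dg.
apply: le_trans (ler_norm_sum _ _ _) _.
apply: (@le_trans _ _ (\sum_(i < n) `|y - x| * c)).
  apply: ler_sum => i _; rewrite normrM; apply: ler_pM => //.
    exact: ler_coord_norm.
  exact: bg.
by rewrite sumr_const card_ord -[(_ * c) *+ n]mulr_natl [`|_| * c]mulrC mulrA.
Qed.

End RowNorm.

(** * The inverse function theorem *)

Section InverseFunction.
Variables (R : realType) (n : nat).
Local Notation E := 'rV[R]_n.

Record local_diffeo (U V : set E) (F G : E -> E) : Prop := LocalDiffeo {
  ld_openU : open U;
  ld_openV : open V;
  ld_map : forall x, U x -> V (F x);
  ld_inv : forall y, V y -> U (G y);
  ld_K : forall x, U x -> G (F x) = x;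
  ld_invK : forall y, V y -> F (G y) = y;
  ld_smooth : smooth U F;
  ld_smooth_inv : smooth V G }.

Lemma jacobianE (F : E -> E) x i j : differentiable F x ->
  jacobian F x i j = ('D_(delta_mx 0 i) F x) 0 j.
Proof. by move=> dF; rewrite deriveEjacobian// -rowE [RHS]mxE. Qed.

Variables (U : set E) (F : E -> E) (x0 : E).
Hypotheses (oU : open U) (Ux0 : U x0) (sF : smooth U F).
Hypothesis J0 : jacobian F x0 \in unitmx.
Let A := invmx (jacobian F x0).
Let G x := x - F x *m A.

Let sG : smooth U G.
Proof.
apply: smoothB => //; first exact: smooth_id.
exact: smooth_mulmx.
Qed.

Let DG x v : U x -> 'D_v G x = v - 'D_v F x *m A.
Proof.
move=> Ux; have dF := smooth_diff sF Ux; have [dA DA] := diff_mulmx A dF.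
rewrite deriveB; [|exact: derivable_id|exact: diff_derivable].
by rewrite derive_id DA.
Qed.

Let DG0 v : 'D_v G x0 = 0.
Proof.
rewrite (DG _ Ux0) deriveEjacobian; last exact: smooth_diff sF Ux0.
by rewrite mulmxK// subrr.
Qed.

Let c : R := (2 * (n%:R + 1))^-1.
Let c_gt0 : 0 < c. Proof. by rewrite invr_gt0 mulr_gt0. Qed.
Let nc : n%:R * c <= 1 / 2.
Proof. by rewrite /c ler_pdivrMr ?mulr_gt0//; lra. Qed.

Let radius : exists r, [/\ 0 < r, ball x0 r `<=` U &
  forall x j, ball x0 r x -> `|'D_(delta_mx 0 j) G x| <= c].
Proof.
have H : \forall x \near x0, U x /\ forall j, `|'D_(delta_mx 0 j) G x| <= c.
  near=> x; split; first by near: x; exact: (near_open oU Ux0).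
  near: x; apply: filter_forall => j.
  have /cvgrPdist_le/(_ _ c_gt0) :=
    smooth_cont (smooth_deriv (delta_mx 0 j) sG) Ux0.
  by rewrite DG0; apply: filterS => x; rewrite sub0r normrN.
have /nbhs_ballP[r r0 rH] := H.
by exists r; split => // [x /rH[]//|x j /rH[_]].
Unshelve. all: by end_near. Qed.

Lemma inverse_function : exists U' G' d,
  [/\ 0 < d, U' `<=` U, U' x0 & local_diffeo U' (ball (F x0) d) F G'].
Proof.
have [r [r0 rU Gc]] := radius.
have lipG x y : ball x0 r x -> ball x0 r y -> `|G y - G x| <= 1 / 2 * `|y - x|.
  move=> Bx By; apply: row_norm_le => [|i]; first by rewrite mulr_ge0//; lra.
  have -> : (G y - G x) 0 i = G y 0 i - G x 0 i.
    by rewrite [LHS]mxE [(- G x) 0 i]mxE.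
  apply: le_trans (@lipschitz_partials R n x0 x y r (fun z => G z 0 i) c _ _ Bx By) _.
  - by move=> z /rU Uz; apply/diff_coord/(smooth_diff sG).
  - move=> z j Bz; rewrite derive_coord; last exact/(smooth_diff sG)/rU.
    by apply: le_trans (ler_coord_norm _ _) _; apply: Gc.
  - by apply: ler_wpM2r nc.
have [K K0 HK] := mulmx_bound A.
have lower x y : ball x0 r x -> ball x0 r y -> `|y - x| <= 2 * K * `|F y - F x|.
  move=> Bx By; have := lipG x y Bx By.
  have := HK (F y - F x).
  have : `|y - x| <= `|G y - G x| + `|(F y - F x) *m A|.
    apply: le_trans (ler_normD _ _); rewrite le_eqVlt; apply/orP; left.
    by apply/eqP; congr (`|_|); rewrite /G mulmxBl; apply/rowP => i; rewrite !mxE; ring.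
  by rewrite -[2 * K * _]mulrA; exact: half_bound.
have unitJ x : ball x0 r x -> jacobian F x \in unitmx.
  move=> Bx; rewrite -row_free_unit; apply: inj_row_free => v v0.
  have Ux := rU _ Bx.
  have E1 : 'D_v G x = v.
    rewrite DG// deriveEjacobian; last exact: smooth_diff sF Ux.
    by rewrite v0 mul0mx subr0.
  have : `|v| <= 1 / 2 * `|v|.
    rewrite -{1}E1; apply: row_norm_le => [|i]; first by rewrite mulr_ge0//; lra.
    have dG := smooth_diff sG Ux.
    rewrite derive_rV// summxE; apply: le_trans (ler_norm_sum _ _ _) _.
    apply: (@le_trans _ _ (\sum_(i < n) `|v| * c)).
      apply: ler_sum => j _; rewrite mxE normrM; apply: ler_pM => //.
        exact: ler_coord_norm.
      by apply: le_trans (ler_coord_norm _ _) _; apply: Gc.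
    rewrite sumr_const card_ord -[(_ * c) *+ n]mulr_natl [`|_| * c]mulrC mulrA.
    by apply: ler_wpM2r nc.
  by move=> /half_le0 H; apply/eqP; rewrite -normr_le0.
pose d := r / (4 * K).
have d0 : 0 < d by rewrite divr_gt0// mulr_gt0.
have r2 : 0 < r / 2 by rewrite divr_gt0.
have cball x : closed_ball_ Num.Def.normr x0 (r / 2) x -> ball x0 r x.
  by rewrite /closed_ball_ /= -ball_normE /ball_ /= => H; apply: le_lt_trans H _; lra.
have Bx0 : ball x0 r x0 by exact: ballxx.
have ex y : ball (F x0) d y -> exists x,
    closed_ball_ Num.Def.normr x0 (r / 2) x /\ F x = y.
  move=> By; pose T x := G x + y *m A.
  have TC x : closed_ball_ Num.Def.normr x0 (r / 2) x ->
      closed_ball_ Num.Def.normr x0 (r / 2) (T x).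
    move=> Cx; rewrite /closed_ball_ /=.
    have := lipG _ _ (cball _ Cx) Bx0; have := HK (F x0 - y).
    have : `|x0 - T x| <= `|G x0 - G x| + `|(F x0 - y) *m A|.
      apply: le_trans (ler_normD _ _); rewrite le_eqVlt; apply/orP; left.
      by apply/eqP; congr (`|_|); rewrite /T /G mulmxBl; apply/rowP => i; rewrite !mxE; ring.
    have : K * `|F x0 - y| <= r / 4.
      move: By; rewrite -ball_normE /ball_ /= /d => /ltW By.
      rewrite mulrC -ler_pdivlMr//; apply: le_trans By _.
      by rewrite invfM mulrA.
    move: Cx; rewrite /closed_ball_ /=.
    exact: half_radius.
  pose T' := mkfun_fun TC.
  have cT : is_contraction T'.
    exists (PosNum (ltac:(lra) : 0 < 1 / 2 :> R))%:num%:nng; split.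
      by rewrite /=; lra.
    move=> [u v] /= [Cu Cv].
    have := lipG _ _ (cball _ Cv) (cball _ Cu).
    suff -> : T' u - T' v = G u - G v by [].
    by rewrite -[T' u]/(G u + y *m A) -[T' v]/(G v + y *m A) opprD addrACA subrr addr0.
  have [||x Cx fx] := @banach_fixed_point R _ _ T' cT.
  - exact: closed_closed_ball_.
  - by exists x0; rewrite /closed_ball_ /= subrr normr0 ltW.
  exists x; split=> //; move: fx; rewrite /= /mkfun /T /G => fx.
  have : (F x - y) *m A = 0.
    rewrite mulmxBl; apply/eqP; rewrite subr_eq0; apply/eqP.
    by move: fx; move: (F x *m A) (y *m A) => p q /rowP fx; apply/rowP => i;
      have := fx i; rewrite !mxE; lra.
  move/(congr1 (fun w => w *m jacobian F x0)).
  by rewrite mulmxKV// mul0mx => /eqP; rewrite subr_eq0 => /eqP.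
pose H y := xget x0 [set x | closed_ball_ Num.Def.normr x0 (r / 2) x /\ F x = y].
have HP y : ball (F x0) d y -> ball x0 r (H y) /\ F (H y) = y.
  by move=> /ex /(xgetPex x0) [/cball ? ?].
pose U' := [set x | ball x0 r x /\ ball (F x0) d (F x)].
have U'x0 : U' x0 by split; exact: ballxx.
have HF x : U' x -> H (F x) = x.
  move=> [Bx Vx]; have [BH FH] := HP _ Vx.
  have := lower _ _ Bx BH; rewrite FH subrr normr0 mulr0 normr_le0 subr_eq0.
  by move/eqP.
have oU' : open U'.
  rewrite openE => x [Bx Vx]; rewrite /interior.
  near=> y; split; near: y; first exact: (near_open (ball_open x0 r) Bx).
  exact: (smooth_cont sF (rU _ Bx) (near_open (ball_open (F x0) d) Vx)).
have oV : open (ball (F x0) d) by exact: ball_open.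
have lipH y z : ball (F x0) d y -> ball (F x0) d z ->
    `|H z - H y| <= 2 * K * `|z - y|.
  by move=> /HP[By Fy] /HP[Bz Fz]; have := lower _ _ By Bz; rewrite Fy Fz.
have K2 : 0 < 2 * K by rewrite mulr_gt0.
have cH y : ball (F x0) d y -> {for y, continuous H}.
  by move=> Vy; apply: (lipschitz_cont oV Vy K2) => z Vz; exact: lipH.
have dH y : ball (F x0) d y -> differentiable H y /\
    forall v, 'D_v H y = v *m invmx (jacobian F (H y)).
  move=> Vy; have [By Fy] := HP _ Vy.
  set Jy := jacobian F (H y); have uJ : Jy \in unitmx by exact: unitJ.
  have dF := smooth_diff sF (rU _ By).
  have [L L0 HL] := mulmx_bound (invmx Jy).
  suff [D1 D2] : differentiable H y /\ 'd H y = mulmxr (invmx Jy) :> (E -> E).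
    by split=> // v; rewrite deriveE// D2.
  apply: diff_epsP; first exact: mulmxr_continuous.
  move=> e e0; pose e' := e / (L * (2 * K)).
  have e'0 : 0 < e' by rewrite divr_gt0// mulr_gt0.
  have /nbhs_ballP[r1 /= r10 Hr1] := diff_eps dF e'0.
  near=> h.
  have Vh : ball (F x0) d (h + y).
    near: h; have : \forall z \near y, ball (F x0) d z by exact: (near_open oV Vy).
    by rewrite (near_shift 0)/=; apply: filterS => h /=; rewrite subr0.
  have hk := lipH _ _ Vy Vh; rewrite addrK in hk.
  set k := H (h + y) - H y in hk *.
  have kr1 : ball (0 : E) r1 k.
    rewrite -ball_normE /ball_ /= sub0r normrN; apply: le_lt_trans hk _.
    rewrite mulrC -ltr_pdivlMr//; near: h.
    apply/nbhs_ballP; exists (r1 / (2 * K)); first exact: divr_gt0.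
    by move=> z; rewrite -ball_normE /ball_ /= sub0r normrN.
  have := Hr1 _ kr1; rewrite /k subrK Fy (proj2 (HP _ Vh)) addrK -/k.
  rewrite -deriveE// deriveEjacobian// -/Jy => Hk.
  have -> : k - mulmxr (invmx Jy) h = - ((h - k *m Jy) *m invmx Jy).
    by rewrite /= mulmxBl mulmxK// opprB.
  rewrite normrN; apply: le_trans (HL _) _.
  apply: (@le_trans _ _ (L * (e' * (2 * K * `|h|)))).
    rewrite ler_pM2l//; apply: le_trans Hk _.
    by rewrite ler_pM2l.
  rewrite /e' le_eqVlt; apply/orP; left; apply/eqP.
  by field; rewrite !gt_eqF.
exists U', H, d; split => //; first by move=> x [/rU].
split => //.
- by move=> x [].
- by move=> y Vy; have [By Fy] := HP _ Vy; split => //=; rewrite Fy.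
- by move=> y /HP[].
- by apply: smooth_sub sF => x [/rU].
elim=> [|k IH]; first by move=> y Vy; exact: cH.
split=> [y Vy|v]; first by have [] := dH _ Vy.
apply: (@Cn_ext R E E k _ (fun y => v *m invmx (jacobian F (H y)))) => //.
  by move=> y Vy; have [_ ->] := dH _ Vy.
have oB : open (ball x0 r) by exact: ball_open.
apply: (@Cn_comp_rV R E E n k _ (ball x0 r) H (fun x => v *m invmx (jacobian F x))) => //.
  by move=> y /HP[].
suff : smooth (ball x0 r) (fun x => v *m invmx (jacobian F x)) by exact.
apply: smooth_row => // i.
apply: (@smooth_ext R E R _ (fun x => \sum_j v 0 j * invmx (jacobian F x) j i)) => //.
  by move=> x _; rewrite mxE.
apply: smooth_sum => // j; apply: smoothM => //; first exact: smooth_cst.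
apply: smooth_invmx => // [a b|x Bx]; last first.
  by rewrite -unitfE -unitmxE; exact: unitJ.
apply: (@smooth_ext R E R _ (fun x => ('D_(delta_mx 0 a) F x) 0 b)) => //.
  by move=> x Bx; rewrite jacobianE//; exact/(smooth_diff sF)/rU.
by apply: smooth_coord => //; apply/smooth_deriv/(smooth_sub rU).
Unshelve. all: by end_near. Qed.

End InverseFunction.

Section Integral.
Variable R : realType.

Lemma within_continuous_pt (A : set R) (g : R -> R) :
  (forall t, A t -> {for t, continuous g}) -> {within A, continuous g}.
Proof. by move=> H; apply: continuous_in_subspaceT => x /set_mem; exact: H. Qed.

Lemma antiderivative (a u : R) (g : R -> R) :
  (forall t, a <= t <= u -> {for t, continuous g}) ->
  exists G : R -> R, forall t, a < t < u -> is_derive t 1 G (g t).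
Proof.
move=> cg; exists (fun x => \int[@lebesgue_measure R]_(t in `[a, x]) g t) => t.
move=> /andP[at_ tu].
have [||D1 D2] := @continuous_FTC1_closed R g a t u tu _ at_.
- apply: continuous_compact_integrable; first exact: segment_compact.
  by apply: within_continuous_pt => x /=; rewrite in_itv; exact: cg.
- by apply: cg; rewrite !ltW.
by apply: DeriveDef; [exact: D1|rewrite -D2 derive1E].
Qed.

Lemma integral_segment (F g : R -> R) (a b : R) : a <= b ->
  (forall t, a <= t <= b -> is_derive t 1 F (g t)) ->
  (forall t, a <= t <= b -> {for t, continuous g}) ->
  \int[@lebesgue_measure R]_(x in `[a, b]) g x = F b - F a.
Proof.
rewrite le_eqVlt => /predU1P[<- _ _|ab dF cg].
  by rewrite subrr set_itv1 /Rintegral integral_set1.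
have cF t : a <= t <= b -> {for t, continuous F}.
  by move=> /dF[D _]; exact/differentiable_continuous/derivable1_diffP.
rewrite /Rintegral (@continuous_FTC2 _ g F)//.
- by apply: within_continuous_pt => x /=; rewrite in_itv; exact: cg.
- split.
  + by move=> t; rewrite in_itv /= => /andP[? ?]; have [] := dF t _; rewrite ?ltW.
  + by apply: cvg_at_right_filter; apply: cF; rewrite lexx ltW.
  + by apply: cvg_at_left_filter; apply: cF; rewrite lexx ltW.
- move=> t; rewrite in_itv /= => /andP[? ?]; rewrite derive1E.
  by have [] := dF t _; rewrite ?ltW.
Qed.

Lemma oriented_integralE (I : set R) (F g : R -> R) a b :
  is_interval I -> I a -> I b ->
  (forall t, I t -> is_derive t 1 F (g t)) ->
  (forall t, I t -> {for t, continuous g}) ->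
  oriented_integral a b g = F b - F a.
Proof.
move=> Ii Ia Ib dF cg; rewrite /oriented_integral; case: ifPn => [ab|].
  by apply: integral_segment => // t abt; [apply: dF|apply: cg]; exact: (Ii a b).
rewrite -ltNge => ba.
have dF' t : b <= t <= a -> is_derive t 1 F (g t) by move=> bta; apply/dF/(Ii b a).
have cg' t : b <= t <= a -> {for t, continuous g} by move=> bta; apply/cg/(Ii b a).
by rewrite (integral_segment (ltW ba) dF' cg') opprB.
Qed.

End Integral.

(** * Normal projections and second fundamental forms *)

Section Pdot.
Variables (R : realType) (s n : nat).
Implicit Types x y z : 'rV[R]_n.

Definition psign (i : 'I_n) : R := if (i < s)%N then -1 else 1.

Lemma pdotE x y : pdot s x y = \sum_i psign i * (x 0 i * y 0 i).
Proof.
apply: eq_bigr => i _; rewrite /psign; case: ifP => _; first by rewrite mulN1r.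
by rewrite mul1r.
Qed.

Lemma psign2 i : psign i * psign i = 1.
Proof. by rewrite /psign; case: ifP => _; rewrite ?mulrNN mulr1. Qed.

Lemma pdotC x y : pdot s x y = pdot s y x.
Proof. by rewrite !pdotE; apply: eq_bigr => i _; rewrite (mulrC (x 0 i)). Qed.

Lemma pdotDl x y z : pdot s (x + y) z = pdot s x z + pdot s y z.
Proof.
by rewrite !pdotE -big_split; apply: eq_bigr => i _; rewrite /= !mxE; ring.
Qed.

Lemma pdotZl a x y : pdot s (a *: x) y = a * pdot s x y.
Proof. by rewrite !pdotE mulr_sumr; apply: eq_bigr => i _; rewrite !mxE; ring. Qed.

Lemma pdotDr x y z : pdot s x (y + z) = pdot s x y + pdot s x z.
Proof. by rewrite pdotC pdotDl !(pdotC _ x). Qed.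

Lemma pdotZr a x y : pdot s x (a *: y) = a * pdot s x y.
Proof. by rewrite pdotC pdotZl pdotC. Qed.

Lemma pdot0l y : pdot s 0 y = 0.
Proof. by rewrite -(scale0r 0) pdotZl mul0r. Qed.

Lemma pdot0r y : pdot s y 0 = 0.
Proof. by rewrite pdotC pdot0l. Qed.

Lemma pdotNl x y : pdot s (- x) y = - pdot s x y.
Proof. by rewrite -scaleN1r pdotZl mulN1r. Qed.

Lemma pdotNr x y : pdot s x (- y) = - pdot s x y.
Proof. by rewrite pdotC pdotNl pdotC. Qed.

Lemma pdotBl x y z : pdot s (x - y) z = pdot s x z - pdot s y z.
Proof. by rewrite pdotDl pdotNl. Qed.

Lemma pdotBr x y z : pdot s x (y - z) = pdot s x y - pdot s x z.
Proof. by rewrite pdotDr pdotNr. Qed.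

Lemma pdot_suml m (F : 'I_m -> 'rV[R]_n) y :
  pdot s (\sum_i F i) y = \sum_i pdot s (F i) y.
Proof.
elim/big_rec2: _ => [|i a b _ <-]; first by rewrite pdot0l.
by rewrite pdotDl.
Qed.

Lemma pdot_sumr m (F : 'I_m -> 'rV[R]_n) y :
  pdot s y (\sum_i F i) = \sum_i pdot s y (F i).
Proof. by rewrite pdotC pdot_suml; apply: eq_bigr => i _; rewrite pdotC. Qed.

Lemma pdot_nondeg x : (forall y, pdot s x y = 0) -> x = 0.
Proof.
move=> H; apply/rowP => i; rewrite mxE; have := H (delta_mx 0 i).
rewrite pdotE (bigD1 i)//= big1 => [|j ji]; last first.
  by rewrite mxE (negPf ji) andbF mulr0 mulr0.
rewrite mxE !eqxx mulr1 addr0 => E.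
by rewrite -[x 0 i]mul1r -(psign2 i) -mulrA E mulr0.
Qed.

Section Calculus.
Variable V : normedModType R.
Implicit Types f g : V -> 'rV[R]_n.

Lemma diff_pdot f g (x : V) : differentiable f x -> differentiable g x ->
  differentiable (fun y : V => pdot s (f y) (g y)) x /\
  forall v, 'D_v (fun y : V => pdot s (f y) (g y)) x =
    pdot s ('D_v f x) (g x) + pdot s (f x) ('D_v g x).
Proof.
move=> df dg.
have -> : (fun y : V => pdot s (f y) (g y)) =
    \sum_(i < n) (fun y : V => psign i *: (f y 0 i *: (g y 0 i : R))).
  by apply/funext => y; rewrite pdotE fct_sumE.
have H i := diffZr (diff_coord 0 i df) (diff_coord 0 i dg).
have H' i : differentiable (fun y : V => psign i *: (f y 0 i *: (g y 0 i : R))) x.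
  by apply: differentiableZ; have [] := H i.
split; first exact: differentiable_sum.
move=> v; rewrite derive_sum; last by move=> i; exact/diff_derivable.
rewrite !pdotE -big_split; apply: eq_bigr => i _ /=; have [D1 D2] := H i.
rewrite deriveZ; last exact: diff_derivable.
by rewrite D2 !derive_coord// -mulrDr.
Qed.

Lemma smooth_pdot (U : set V) f g : open U -> smooth U f -> smooth U g ->
  smooth U (fun y : V => pdot s (f y) (g y)).
Proof.
move=> oU sf sg.
apply: (@smooth_ext R V R U (fun y : V => \sum_i psign i * (f y 0 i * g y 0 i))) => //.
  by move=> y _; rewrite pdotE.
apply: smooth_sum => // i; apply: smoothM => //; first exact: smooth_cst.
by apply: smoothM => //; apply: smooth_coord.
Qed.

Lemma derive_pdot_cst (U : set V) f g (c : R) (x v : V) : open U -> U x ->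
  (forall y : V, U y -> pdot s (f y) (g y) = c) ->
  differentiable f x -> differentiable g x ->
  pdot s ('D_v f x) (g x) + pdot s (f x) ('D_v g x) = 0.
Proof.
move=> oU Ux H df dg; have [_ <-] := diff_pdot df dg.
rewrite (@near_eq_derive _ _ _ _ (fun=> c)); first exact: derive_cst.
by apply: filterS (near_open oU Ux) => y; exact: H.
Qed.

End Calculus.
End Pdot.

Lemma sum2 (V : nmodType) (F : 'I_2 -> V) : \sum_i F i = F 0 + F 1.
Proof. by rewrite big_ord_recl big_ord1; congr (_ + F _); apply/val_inj. Qed.

Lemma I2P (P : 'I_2 -> Prop) : P 0 -> P 1 -> forall i, P i.
Proof.
move=> P0 P1 i; have [->|] := eqVneq i 0 => //.
by case: i => -[|[|//]] // ? _; rewrite (_ : Ordinal _ = 1)//; apply/val_inj.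
Qed.

Section NormalPart.
Variables (R : realType) (s n : nat).
Local Notation E := 'rV[R]_n.
Implicit Types (p w z : E) (T : 'I_2 -> E).

Definition gram T : 'M[R]_2 := \matrix_(i, j) pdot s (T i) (T j).

Definition nproj p T w : E := w - pdot s w p *: p -
  \sum_(i < 2) \sum_(j < 2) (invmx (gram T) i j * pdot s w (T j)) *: T i.

Record sphere_frame p T : Prop := SphereFrame {
  frame_pp : pdot s p p = 1;
  frame_pT : forall i, pdot s p (T i) = 0;
  frame_det : \det (gram T) != 0 }.

Lemma nproj_lin p T a u v : nproj p T (a *: u + v) = a *: nproj p T u + nproj p T v.
Proof.
rewrite /nproj !sum2; apply/rowP => k; rewrite !mxE !pdotDl !pdotZl; ring.
Qed.

Lemma nprojD p T u v : nproj p T (u + v) = nproj p T u + nproj p T v.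
Proof. by have := nproj_lin p T 1 u v; rewrite !scale1r. Qed.

Lemma nproj0 p T : nproj p T 0 = 0.
Proof. by have := nproj_lin p T (-1) 0 0; rewrite !scaleN1r oppr0 addr0 addNr. Qed.

Lemma nprojZ p T a u : nproj p T (a *: u) = a *: nproj p T u.
Proof. by have := nproj_lin p T a u 0; rewrite nproj0 !addr0. Qed.

Lemma nproj_sum p T m (F : 'I_m -> E) :
  nproj p T (\sum_i F i) = \sum_i nproj p T (F i).
Proof.
elim/big_rec2: _ => [|i a b _ <-]; first exact: nproj0.
by rewrite nprojD.
Qed.

Lemma gram_unit p T : sphere_frame p T -> gram T \in unitmx.
Proof. by case=> _ _; rewrite unitmxE unitfE. Qed.

Lemma nproj_p p T : sphere_frame p T -> nproj p T p = 0.
Proof.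
move=> [pp pT _]; rewrite /nproj pp scale1r subrr sub0r.
by rewrite big1 ?oppr0// => i _; rewrite big1// => j _; rewrite pT mulr0 scale0r.
Qed.

Lemma nproj_T p T k : sphere_frame p T -> nproj p T (T k) = 0.
Proof.
move=> F; have [pp pT _] := F; rewrite /nproj pdotC pT scale0r subr0.
apply/eqP; rewrite subr_eq0; apply/eqP.
have E i : \sum_j invmx (gram T) i j * pdot s (T k) (T j) = (i == k)%:R.
  have := congr1 (fun M : 'M[R]_2 => M i k) (mulVmx (gram_unit F)).
  by rewrite !mxE => <-; apply: eq_bigr => j _; rewrite mxE pdotC.
transitivity (\sum_i (i == k)%:R *: T i); last first.
  by apply: eq_bigr => i _; rewrite -E scaler_suml.
rewrite (bigD1 k)//= big1 => [|i ik]; first by rewrite eqxx scale1r addr0.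
by rewrite (negPf ik) scale0r.
Qed.

Lemma nproj_orth p T z : pdot s z p = 0 -> (forall i, pdot s z (T i) = 0) ->
  nproj p T z = z.
Proof.
move=> zp zT; rewrite /nproj zp scale0r subr0 big1 ?subr0// => i _.
by rewrite big1// => j _; rewrite zT mulr0 scale0r.
Qed.

Lemma nproj_pdot p T w : sphere_frame p T ->
  pdot s (nproj p T w) p = 0 /\ forall i, pdot s (nproj p T w) (T i) = 0.
Proof.
move=> F; have [pp pT _] := F; split=> [|k].
  rewrite !pdotBl pdotZl pp mulr1 subrr sub0r pdot_suml big1 ?oppr0// => i _.
  by rewrite pdot_suml big1// => j _; rewrite pdotZl (pdotC _ (T i)) pT mulr0.
rewrite !pdotBl pdotZl pT mulr0 subr0.
apply/eqP; rewrite subr_eq0; apply/eqP.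
have E j : \sum_i pdot s (T k) (T i) * invmx (gram T) i j = (k == j)%:R.
  have := congr1 (fun M : 'M[R]_2 => M k j) (mulmxV (gram_unit F)).
  by rewrite !mxE => <-; apply: eq_bigr => i _; rewrite mxE.
rewrite pdot_suml; under eq_bigr do rewrite pdot_suml.
rewrite exchange_big /=.
transitivity (\sum_j (k == j)%:R * pdot s w (T j)).
  rewrite (bigD1 k)//= big1 => [|j jk]; first by rewrite eqxx mul1r addr0.
  by rewrite eq_sym (negPf jk) mul0r.
apply: eq_bigr => j _; rewrite -E mulr_suml; apply: eq_bigr => i _.
by rewrite pdotZl (pdotC _ (T i)); ring.
Qed.

Lemma nproj_span p T z a c : sphere_frame p T ->
  nproj p T (z + a *: p + \sum_i c i *: T i) = nproj p T z.
Proof.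
move=> F; rewrite !nprojD nprojZ nproj_p// scaler0 addr0 nproj_sum big1 ?addr0// => i _.
by rewrite nprojZ nproj_T// scaler0.
Qed.

Lemma nproj_eq0 p T w : nproj p T w = 0 ->
  w = pdot s w p *: p +
    \sum_(i < 2) (\sum_(j < 2) invmx (gram T) i j * pdot s w (T j)) *: T i.
Proof.
rewrite /nproj => /eqP; rewrite -addrA -opprD subr_eq0 => /eqP E1.
rewrite {1}E1.
by congr (_ + _); apply: eq_bigr => i _; rewrite scaler_suml.
Qed.

Lemma gram_change T T' (J : 'M[R]_2) : (forall i, T' i = \sum_a J i a *: T a) ->
  gram T' = J *m gram T *m J^T.
Proof.
move=> TT'; apply/matrixP => i j; rewrite !mxE !TT' !sum2 !mxE !sum2 !mxE.
by rewrite !pdotDl !pdotDr !pdotZl !pdotZr; ring.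
Qed.

Lemma change_unit T T' (J : 'M[R]_2) : (forall i, T' i = \sum_a J i a *: T a) ->
  \det (gram T') != 0 -> J \in unitmx /\ \det (gram T) != 0.
Proof.
move=> /gram_change ->; rewrite !det_mulmx !mulf_eq0 !negb_or unitmxE unitfE.
by move=> /andP[/andP[-> ->]].
Qed.

Lemma frame_change p T T' (J : 'M[R]_2) : sphere_frame p T ->
  J \in unitmx -> (forall i, T' i = \sum_a J i a *: T a) -> sphere_frame p T'.
Proof.
move=> [pp pT dT] uJ TT'; split=> // [i|].
  by rewrite TT' pdot_sumr big1// => a _; rewrite pdotZr pT mulr0.
rewrite (gram_change TT') !det_mulmx det_tr !mulf_neq0//;
  by rewrite -unitfE -unitmxE.
Qed.

Lemma change_inv T T' (J : 'M[R]_2) : J \in unitmx ->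
  (forall i, T' i = \sum_a J i a *: T a) ->
  forall a, T a = \sum_i invmx J a i *: T' i.
Proof.
move=> uJ TT' a; under eq_bigr do rewrite TT' scaler_sumr.
rewrite exchange_big /=.
transitivity (\sum_b (a == b)%:R *: T b).
  rewrite (bigD1 a)//= big1 => [|b ba]; first by rewrite eqxx scale1r addr0.
  by rewrite eq_sym (negPf ba) scale0r.
apply: eq_bigr => b _; have := congr1 (fun M : 'M[R]_2 => M a b) (mulVmx uJ).
rewrite !mxE => <-; rewrite scaler_suml; apply: eq_bigr => i _.
by rewrite scalerA.
Qed.

Lemma nproj_change p T T' (J : 'M[R]_2) w : sphere_frame p T ->
  J \in unitmx -> (forall i, T' i = \sum_a J i a *: T a) ->
  nproj p T' w = nproj p T w.
Proof.
move=> F uJ TT'; have F' := frame_change F uJ TT'.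
have [zp zT] := nproj_pdot w F; set z := nproj p T w in zp zT *.
have zT' i : pdot s z (T' i) = 0.
  by rewrite TT' pdot_sumr big1// => a _; rewrite pdotZr zT mulr0.
have N0 : nproj p T (w - z) = 0.
  by rewrite -scaleN1r nprojD nprojZ (nproj_orth zp zT) scaleN1r subrr.
have NT a : nproj p T' (T a) = 0.
  rewrite (change_inv uJ TT' a) nproj_sum big1// => i _.
  by rewrite nprojZ nproj_T// scaler0.
have N1 : nproj p T' (w - z) = 0.
  rewrite (nproj_eq0 N0) nprojD nprojZ nproj_p// scaler0 add0r nproj_sum big1// => i _.
  by rewrite nprojZ NT scaler0.
by rewrite -(subrK z w) nprojD N1 add0r nproj_orth.
Qed.

End NormalPart.

Section ChainRule.
Variable R : realType.

Lemma derive_comp_rV (V W : normedModType R) n (X : 'rV[R]_n -> W) (f : V -> 'rV[R]_n) y v :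
  differentiable f y -> differentiable X (f y) ->
  'D_v (fun z => X (f z)) y =
  \sum_b ('D_v f y) 0 b *: 'D_(delta_mx 0 b) X (f y).
Proof. by move=> df dX; rewrite (derive_chain v df dX) (derive_rV _ dX). Qed.

Lemma derive_fsum (V W : normedModType R) n (F : 'I_n -> V -> W) y v :
  (forall i, differentiable (F i) y) ->
  'D_v (fun z => \sum_i F i z) y = \sum_i 'D_v (F i) y.
Proof.
move=> dF; have -> : (fun z => \sum_i F i z) = \sum_i F i.
  by apply/funext => z; rewrite fct_sumE.
by rewrite derive_sum// => i; exact: diff_derivable.
Qed.

Lemma diff_fsum (V W : normedModType R) n (F : 'I_n -> V -> W) y :
  (forall i, differentiable (F i) y) -> differentiable (fun z => \sum_i F i z) y.
Proof.
move=> dF; have -> : (fun z => \sum_i F i z) = \sum_i F i.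
  by apply/funext => z; rewrite fct_sumE.
exact: differentiable_sum.
Qed.

Lemma hessian_comp (V W : normedModType R) n (U : set 'rV[R]_n) (U' : set V)
    (X : 'rV[R]_n -> W) (f : V -> 'rV[R]_n) y v w :
  open U' -> U' y -> (forall z, U' z -> U (f z)) -> Cn 2 U X -> Cn 2 U' f ->
  'D_v (fun z => 'D_w (fun z => X (f z)) z) y =
  \sum_a \sum_b (('D_v f y) 0 a * ('D_w f y) 0 b) *:
     'D_(delta_mx 0 a) (fun z => 'D_(delta_mx 0 b) X z) (f y) +
  'D_('D_v (fun z => 'D_w f z) y) X (f y).
Proof.
move=> oU' U'y U'U [dX DX] [df Df].
have dfy := df _ U'y; have Ufy := U'U _ U'y.
rewrite (@near_eq_derive _ _ _ _
  (fun z => \sum_b ('D_w f z) 0 b *: 'D_(delta_mx 0 b) X (f z))); last first.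
  apply: filterS (near_open oU' U'y) => z U'z.
  by apply: derive_comp_rV; [exact: df|exact/dX/U'U].
have d2f : differentiable (fun z => 'D_w f z) y by have [d _] := Df w; exact: d.
have d2X b : differentiable (fun z => 'D_(delta_mx 0 b) X z) (f y).
  by have [d _] := DX (delta_mx 0 b); exact: d.
have dc b : differentiable (fun z => 'D_(delta_mx 0 b) X (f z)) y.
  exact: (@differentiable_comp _ _ _ _ f (fun z => 'D_(delta_mx 0 b) X z)).
have H b := diffZr (diff_coord 0 b d2f) (dc b).
rewrite derive_fsum => [|b]; last by have [] := H b.
rewrite (derive_rV ('D_v _ y) (dX _ Ufy)) exchange_big addrC -big_split.
apply: eq_bigr => b _ /=; have [_ ->] := H b.
rewrite derive_coord//; congr (_ + _).
rewrite (@derive_comp_rV _ _ _ (fun z => 'D_(delta_mx 0 b) X z))//.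
rewrite scaler_sumr; apply: eq_bigr => a _.
by rewrite scalerA mulrC.
Qed.

End ChainRule.

Lemma cramer2 (R : realType) n (p q c d : R) (u v : 'rV[R]_n) :
  p * d - q * c != 0 -> p *: u + q *: v = 0 -> c *: u + d *: v = 0 ->
  u = 0 /\ v = 0.
Proof.
move=> D0 E1 E2; split; apply: (scalerI D0); rewrite scaler0.
  transitivity (d *: (p *: u + q *: v) - q *: (c *: u + d *: v)).
    by apply/rowP => k; rewrite !mxE; ring.
  by rewrite E1 E2 !scaler0 subr0.
transitivity (p *: (c *: u + d *: v) - c *: (p *: u + q *: v)).
  by apply/rowP => k; rewrite !mxE; ring.
by rewrite E1 E2 !scaler0 subr0.
Qed.

Lemma colinear2 (R : realType) (m b : 'rV[R]_2) : m != 0 ->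
  m 0 0 * b 0 1 - m 0 1 * b 0 0 = 0 -> exists c, b = c *: m.
Proof.
move=> m0 D0; have [m00|m00] := eqVneq (m 0 0) 0.
  have m10 : m 0 1 != 0.
    by apply: contraNneq m0 => m10; apply/eqP/rowP; apply: I2P; rewrite mxE.
  exists (b 0 1 / m 0 1); apply/rowP; apply: I2P; rewrite mxE; last by rewrite divfK.
  rewrite m00 mulr0; move/eqP: D0; rewrite m00 mul0r sub0r.
  by rewrite oppr_eq0 mulf_eq0 (negPf m10) => /eqP.
exists (b 0 0 / m 0 0); apply/rowP; apply: I2P; rewrite mxE; first by rewrite divfK.
move/eqP: D0; rewrite subr_eq0 => /eqP D0.
by rewrite mulrAC [b 0 0 * _]mulrC -D0 mulrAC divff// mul1r.
Qed.

Section SurfaceInSphere.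
Variables (R : realType) (s n : nat).
Implicit Types (X : 'rV[R]_2 -> 'rV[R]_n.+1) (U V : set 'rV[R]_2).

Definition frame X x : 'I_2 -> 'rV[R]_n.+1 := fun i => partial i X x.

Lemma sff_coefE X x i j : sphere_frame s (X x) (frame X x) ->
  sff_coef s X x i j = nproj s (X x) (frame X x) (partial i (partial j X) x).
Proof.
move=> [pp pT _]; rewrite /sff_coef /sphere_connection /tangent_proj /nproj.
congr (_ - _); apply: eq_bigr => k _; apply: eq_bigr => l _.
by rewrite pdotBl pdotZl pT mulr0 subr0.
Qed.

Lemma frame_of_immersion U X x : open U -> U x ->
  (forall y, U y -> pseudosphere s n (X y)) -> differentiable X x ->
  \det (metric s X x) != 0 -> sphere_frame s (X x) (frame X x).
Proof.
move=> oU Ux XS dX dm; split=> // [|i]; first exact: XS.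
have := derive_pdot_cst (delta_mx 0 i) oU Ux XS dX dX.
rewrite pdotC -mulr2n => /eqP; rewrite mulrn_eq0 /= => /eqP.
by [].
Qed.

Lemma null_sff X x (a : 'rV[R]_2) : relative_null_space s X x a <->
  forall j, \sum_i a 0 i *: sff_coef s X x i j = 0.
Proof.
split=> [H j|H b]; rewrite /second_fundamental_form.
  transitivity (second_fundamental_form s X x a (delta_mx 0 j)); last exact: H.
  apply: eq_bigr => i _; rewrite (bigD1 j)//= big1 => [|k kj].
    by rewrite !mxE !eqxx mulr1 addr0.
  by rewrite !mxE (negPf kj) andbF mulr0 scale0r.
rewrite exchange_big big1//= => j _.
transitivity (b 0 j *: \sum_i a 0 i *: sff_coef s X x i j).
  by rewrite scaler_sumr; apply: eq_bigr => i _; rewrite scalerA mulrC.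
by rewrite H scaler0.
Qed.

Lemma nullity_vector X x : positive_nullity_at s X x -> exists2 a : 'rV[R]_2,
  a != 0 & forall j, \sum_i a 0 i *: sff_coef s X x i j = 0.
Proof.
move=> [V HV dV]; exists (vpick V).
  by rewrite vpick0; apply: contra_not_neq dV => ->; rewrite dimv0.
by apply/null_sff/HV; exact: memv_pick.
Qed.

Lemma vector_nullity X x (a : 'rV[R]_2) : mean_curvature s X x != 0 ->
  a != 0 -> (forall j, \sum_i a 0 i *: sff_coef s X x i j = 0) ->
  positive_nullity_at s X x.
Proof.
move=> H0 a0 Ha; exists <[a]>%VS; last by rewrite dim_vline a0.
move=> c; split=> [/vlineP[k ->]|/null_sff Hc].
  apply/null_sff => j.
  transitivity (k *: \sum_i a 0 i *: sff_coef s X x i j); last by rewrite Ha scaler0.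
  by rewrite scaler_sumr; apply: eq_bigr => i _; rewrite mxE scalerA.
have D0 : a 0 0 * c 0 1 - a 0 1 * c 0 0 = 0.
  apply/eqP/negPn/negP => D0; move/eqP: H0; apply.
  have L0 i j : sff_coef s X x i j = 0.
    have := Ha j; have := Hc j; rewrite !sum2 => E1 E2.
    by have [? ?] := cramer2 D0 E2 E1; move: i; apply: I2P.
  rewrite /mean_curvature big1 ?scaler0// => i _; rewrite big1// => j _.
  by rewrite L0 scaler0.
have [k ->] := colinear2 a0 D0.
by apply/vlineP; exists k.
Qed.

Definition jac (f : 'rV[R]_2 -> 'rV[R]_2) y : 'M[R]_2 :=
  \matrix_(i, a) (partial i f y) 0 a.

Lemma frame_comp X f y : differentiable f y -> differentiable X (f y) ->
  forall i, frame (X \o f) y i = \sum_a jac f y i a *: frame X (f y) a.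
Proof.
move=> df dX i; rewrite /frame /partial (derive_comp_rV _ df dX).
by apply: eq_bigr => a _; rewrite mxE.
Qed.

Lemma sff_comp U V X f y i j : open V -> V y -> (forall z, V z -> U (f z)) ->
  Cn 2 U X -> Cn 2 V f -> sphere_frame s (X (f y)) (frame X (f y)) ->
  jac f y \in unitmx ->
  sff_coef s (X \o f) y i j =
  \sum_a \sum_b (jac f y i a * jac f y j b) *: sff_coef s X (f y) a b.
Proof.
move=> oV Vy VU cX cf F uJ.
have dX : differentiable X (f y) by case: cX => d _; exact/d/VU.
have df : differentiable f y by case: cf => d _; exact: d.
have FE := frame_comp df dX.
rewrite sff_coefE; last exact: frame_change FE.
rewrite (nproj_change _ F uJ FE) /partial (hessian_comp _ _ oV Vy VU cX cf).
rewrite (derive_rV _ dX); set S := \sum_a _.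
transitivity (nproj s (X (f y)) (frame X (f y)) S).
  rewrite -[in RHS](nproj_span S 0 (fun a => ('D_(delta_mx 0 i)
    (fun z => 'D_(delta_mx 0 j) f z) y) 0 a) F).
  by rewrite scale0r addr0.
rewrite /S.
rewrite nproj_sum; apply: eq_bigr => a _; rewrite nproj_sum; apply: eq_bigr => b _.
by rewrite nprojZ sff_coefE// !mxE.
Qed.

End SurfaceInSphere.

Lemma diff_id (R : realType) (V : normedModType R) (x : V) : differentiable id x.
Proof. by case: (is_diff_id x). Qed.

(** * Isometries of the pseudosphere *)

Section Isometry.
Variables (R : realType) (s n : nat).
Local Notation E := 'rV[R]_n.+1.

Definition cone : set E := [set x | 0 < pdot s x x].

Lemma continuous_pdot : continuous (fun x : E => pdot s x x).
Proof.
move=> x; have H := smooth_pdot s (@openT E) (@smooth_id R E setT) (@smooth_id R E setT).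
exact: (smooth_cont H).
Qed.

Lemma open_cone : open cone.
Proof.
apply: (@open_comp _ _ (fun x : E => pdot s x x) [set y | 0 < y]).
  by move=> x _; exact: continuous_pdot.
exact: open_gt.
Qed.

Definition radius (x : E) : R := expR (ln (pdot s x x) / 2).

Lemma radius_gt0 x : 0 < radius x. Proof. exact: expR_gt0. Qed.

Lemma radius2 x : cone x -> radius x * radius x = pdot s x x.
Proof. by move=> cx; rewrite -expRD -splitr lnK. Qed.

Lemma smooth_radius : smooth cone radius.
Proof.
have oC := open_cone.
have sp := smooth_pdot s oC (@smooth_id R E cone) (@smooth_id R E cone).
have sl : smooth cone (fun x => ln (pdot s x x)).
  exact: (@smooth_comp_R R E R cone [set x | 0 < x] _ _ oC (fun x => id) sp (@Cn_ln R)).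
have sl2 : smooth cone (fun x => ln (pdot s x x) / 2).
  by apply: smoothM => //; exact: smooth_cst.
apply: (@smooth_comp_R R E R cone setT _ _ oC _ sl2) => //.
by move=> k; apply: Cn_expR; exact: openT.
Qed.

Definition normalize x := (radius x)^-1 *: x.

Lemma smooth_normalize : smooth cone normalize.
Proof.
apply: smoothZ; [exact: open_cone| |exact: smooth_id].
apply: smoothV; [exact: open_cone| |exact: smooth_radius].
by move=> x _; rewrite gt_eqF ?radius_gt0.
Qed.

Lemma radius_neq0 x : radius x != 0. Proof. by rewrite gt_eqF ?radius_gt0. Qed.

Lemma normalize_sphere x : cone x -> pseudosphere s n (normalize x).
Proof.
move=> cx; rewrite /pseudosphere /= pdotZl pdotZr -(radius2 cx).
by rewrite mulrA -invfM mulVf// mulf_neq0// radius_neq0.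
Qed.

Lemma derive_radius x u : cone x ->
  'D_u radius x = (radius x)^-1 * pdot s x u.
Proof.
move=> cx; have dr := smooth_diff smooth_radius cx.
have [_ D] := diff_pdot s (diff_id x) (diff_id x).
have [_ D2] := diffZr dr dr.
have : 'D_u (fun x => radius x *: (radius x : R)) x = 'D_u (fun x => pdot s x x) x.
  apply: near_eq_derive; apply: filterS (near_open open_cone cx) => y cy.
  exact: radius2.
rewrite D2 D derive_id -[_ *: _]/(_ * _) -[radius x *: _]/(_ * _) (pdotC s u) => H.
have r0 := radius_neq0 x.
apply: (mulfI r0); rewrite mulVKf//; lra.
Qed.

Lemma derive_normalize x u : cone x ->
  radius x *: 'D_u normalize x = u - ('D_u radius x) *: normalize x.
Proof.
move=> cx; have dr := smooth_diff smooth_radius cx.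
have dn := smooth_diff smooth_normalize cx.
have [_ D2] := diffZr dr dn.
have : 'D_u (fun x => radius x *: normalize x) x = u.
  rewrite -[RHS](derive_id x u); apply: near_eq_derive; near=> y.
  by rewrite /normalize scalerA divff ?scale1r//; exact: radius_neq0.
rewrite D2; move: ('D_u radius x *: _) (radius x *: _) => a b <-.
by rewrite addrAC subrr add0r.
Unshelve. all: by end_near. Qed.

Variables (T : E -> E) (isoT : sphere_isometry s T).

Definition homogenize x := radius x *: T (normalize x).

Lemma homogenize_sphere x : pseudosphere s n x -> homogenize x = T x.
Proof.
move=> Sx; have r1 : radius x = 1 by rewrite /radius Sx ln1 mul0r expR0.
by rewrite /homogenize /normalize r1 invr1 !scale1r.
Qed.

Lemma sphere_cone x : pseudosphere s n x -> cone x.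
Proof. by move=> Sx; rewrite /cone /= Sx. Qed.

Lemma smooth_T_normalize : smooth cone (fun x => T (normalize x)).
Proof.
case: isoT => -[U [oU SU sT]] _ _ _.
apply: (smooth_comp_rV open_cone _ smooth_normalize); last exact/smooth_onP/sT.
by move=> x cx; apply/SU/normalize_sphere.
Qed.

Lemma smooth_homogenize : smooth cone homogenize.
Proof.
exact: (smoothZ open_cone smooth_radius smooth_T_normalize).
Qed.

Lemma derive_homogenize x u : cone x ->
  'D_u homogenize x = 'D_u radius x *: T (normalize x) +
     'D_(u - 'D_u radius x *: normalize x) T (normalize x) /\
  pdot s ('D_(u - 'D_u radius x *: normalize x) T (normalize x)) (T (normalize x)) = 0.
Proof.
move=> cx; have Sx := normalize_sphere cx.
have dn := smooth_diff smooth_normalize cx.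
have dT : differentiable T (normalize x).
  by case: isoT => -[U [oU SU /(smooth_onP _ oU) sT]] _ _ _; apply/(smooth_diff sT)/SU.
have dTn := smooth_diff smooth_T_normalize cx.
have [_ D2] := diffZr (smooth_diff smooth_radius cx) dTn.
have Dn := derive_normalize u cx.
have E1 : 'D_(u - 'D_u radius x *: normalize x) T (normalize x) =
    radius x *: 'D_u (fun x => T (normalize x)) x.
  rewrite -Dn (deriveZv _ _ dT); congr (_ *: _).
  exact: esym (derive_chain u dn dT).
split; first by rewrite E1 -D2.
rewrite E1 pdotZl.
have TT y : cone y -> pdot s (T (normalize y)) (T (normalize y)) = 1.
  by move=> cy; case: isoT => _ TS _ _; apply/TS/normalize_sphere.
have := derive_pdot_cst u open_cone cx TT dTn dTn.
rewrite [X in _ + X]pdotC -mulr2n => /eqP; rewrite mulrn_eq0 => /eqP ->.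
by rewrite mulr0.
Qed.

Lemma pdot_split (q A B p u v : E) a b : pdot s q q = 1 ->
  pdot s A q = 0 -> pdot s B q = 0 ->
  pdot s A B = pdot s (u - a *: p) (v - b *: p) ->
  pdot s p p = 1 -> pdot s p u = a -> pdot s p v = b ->
  pdot s (a *: q + A) (b *: q + B) = pdot s u v.
Proof.
move=> qq Aq Bq AB pp pu pv.
rewrite !pdotDl !pdotDr !pdotZl !pdotZr qq Aq (pdotC s q) Bq AB.
by rewrite !pdotBl !pdotBr !pdotZl !pdotZr pp (pdotC s u p) pu pv; ring.
Qed.

Lemma homogenize_pdot x u v : cone x ->
  pdot s ('D_u homogenize x) ('D_v homogenize x) = pdot s u v.
Proof.
move=> cx; have [-> Ou] := derive_homogenize u cx; have [-> Ov] := derive_homogenize v cx.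
have Sx := normalize_sphere cx.
have Eu w : pdot s (normalize x) w = 'D_w radius x.
  by rewrite derive_radius// /normalize pdotZl.
have tang w : pdot s (normalize x) (w - 'D_w radius x *: normalize x) = 0.
  by rewrite pdotBr pdotZr Eu Sx mulr1 subrr.
case: isoT => _ TS _ iT.
apply: (pdot_split _ Ou Ov _ Sx (Eu u) (Eu v)); first exact: TS.
exact: (iT _ _ _ Sx (tang u) (tang v)).
Qed.

Lemma homogenize_euler x : cone x -> 'D_x homogenize x = homogenize x.
Proof.
move=> cx; have [-> _] := derive_homogenize x cx.
have -> : 'D_x radius x = radius x.
  by rewrite derive_radius// -(radius2 cx) mulKf// radius_neq0.
rewrite {3}/normalize scalerA divff ?radius_neq0// scale1r subrr.
by rewrite derive0 addr0.
Qed.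

End Isometry.

Lemma eq_opp0 (R : realType) (r : R) : r = - r -> r = 0.
Proof. by move=> H; lra. Qed.

Section Koszul.
Variables (R : realType) (s n : nat).
Local Notation E := 'rV[R]_n.
Variables (U : set E) (h : E -> E) (oU : open U) (sh : smooth U h).
Hypothesis hU : forall x u v, U x -> pdot s ('D_u h x) ('D_v h x) = pdot s u v.

Lemma isometric_inj x u : U x -> 'D_u h x = 0 -> u = 0.
Proof.
move=> Ux H; apply: (@pdot_nondeg R s) => v.
by rewrite -(hU u v Ux) H pdot0l.
Qed.

(* The Koszul argument: <D_u D_v h, D_w h> is symmetric in (u, v) and
   skew in (v, w), hence zero; and the vectors D_w h span. *)
Lemma isometric_flat x u v : U x -> 'D_u (fun y => 'D_v h y) x = 0.
Proof.
move=> Ux.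
pose C a b c := pdot s ('D_a (fun y => 'D_b h y) x) ('D_c h x).
have sym a b c : C a b c = C b a c.
  have s2 : Cn 2 U h by exact: sh.
  have H := clairaut a b oU Ux s2.
  rewrite /C.
  rewrite H.
  reflexivity.
have skew a b c : C a b c = - C a c b.
  have := derive_pdot_cst a oU Ux (fun y Uy => hU b c Uy)
    (smooth_diff (smooth_deriv b sh) Ux) (smooth_diff (smooth_deriv c sh) Ux).
  by rewrite [X in _ + X]pdotC => /eqP; rewrite addr_eq0 => /eqP.
have C0 a b c : C a b c = 0.
  have H : C a b c = - C a b c.
    by rewrite {1}skew sym skew opprK sym skew sym.
  exact: eq_opp0 H.
have dh := smooth_diff sh Ux.
have uJ : jacobian h x \in unitmx.
  rewrite -row_free_unit; apply: inj_row_free => w w0.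
  by apply: (isometric_inj Ux); rewrite deriveEjacobian.
apply: (@pdot_nondeg R s) => z.
have -> : z = 'D_(z *m invmx (jacobian h x)) h x.
  by rewrite deriveEjacobian// mulmxKV.
exact: C0.
Qed.

End Koszul.

Section Germ.
Variables (R : realType) (s n : nat).
Implicit Types (X Y : 'rV[R]_2 -> 'rV[R]_n.+1) (U : set 'rV[R]_2).

Lemma partial_germ U X Y x i : open U -> (forall z, U z -> X z = Y z) -> U x ->
  partial i X x = partial i Y x.
Proof.
move=> oU XY Ux; apply: near_eq_derive.
exact: filterS (near_open oU Ux).
Qed.

Lemma partial2_germ U X Y x i j : open U -> (forall z, U z -> X z = Y z) -> U x ->
  partial i (partial j X) x = partial i (partial j Y) x.
Proof.
move=> oU XY Ux; apply: (@partial_germ U) => // z Uz.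
exact: (@partial_germ U).
Qed.

Lemma frame_germ U X Y x : open U -> (forall z, U z -> X z = Y z) -> U x ->
  frame X x = frame Y x.
Proof. by move=> oU XY Ux; apply/funext => i; exact: (partial_germ i oU XY Ux). Qed.

Lemma sff_germ U X Y x i j : open U -> (forall z, U z -> X z = Y z) -> U x ->
  sphere_frame s (X x) (frame X x) ->
  sff_coef s X x i j = sff_coef s Y x i j.
Proof.
move=> oU XY Ux FX; have E1 := XY _ Ux; have E2 := frame_germ oU XY Ux.
have FY : sphere_frame s (Y x) (frame Y x).
  by move: FX; rewrite E1 E2.
have E3 := partial2_germ i j oU XY Ux.
have K p p' T T' w w' : p = p' -> T = T' -> w = w' ->
    @nproj R s n.+1 p T w = nproj s p' T' w' by move=> -> -> ->.
have EX := sff_coefE i j FX.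
have EY := sff_coefE i j FY.
exact: (etrans EX (etrans (K _ _ _ _ _ _ E1 E2 E3) (esym EY))).
Qed.

End Germ.

Lemma contract_bilinear (R : realType) n (a : 'I_2 -> R) (J : 'M[R]_2) j
    (L : 'I_2 -> 'I_2 -> 'rV[R]_n) :
  \sum_i a i *: (\sum_p \sum_q (J i p * J j q) *: L p q) =
  \sum_p \sum_q ((\sum_i a i * J i p) * J j q) *: L p q.
Proof. by rewrite !sum2; apply/rowP => k; rewrite !mxE; ring. Qed.

(** * Ruled surfaces and the four families *)

Section Ruled.
Variable R : realType.

Lemma smooth_proj2 (i : 'I_2) : smooth setT (fun x : 'rV[R]_2 => x 0 i).
Proof. by apply: smooth_coord => //; [exact: openT|exact: smooth_id]. Qed.

Lemma derive_proj2 (i : 'I_2) (x v : 'rV[R]_2) : 'D_v (fun x : 'rV[R]_2 => x 0 i) x = v 0 i.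
Proof. by rewrite (derive_coord _ _ _ (diff_id x)) derive_id. Qed.

Lemma open_strip (I : set R) : open I -> open [set x : 'rV[R]_2 | I (x 0 1)].
Proof.
move=> oI; apply: (@open_comp _ _ (fun x : 'rV[R]_2 => x 0 1) I) => // x _.
exact: coord_continuous.
Qed.

Lemma smooth_strip (W : normedModType R) (I : set R) (g : R -> R) (P : R -> W) :
  open I -> smooth setT g -> smooth I P ->
  smooth [set x : 'rV[R]_2 | I (x 0 1)] (fun x => g (x 0 0) *: P (x 0 1)).
Proof.
move=> oI sg sP; have oD := open_strip oI.
have s0 i := smooth_sub (subsetT [set x : 'rV[R]_2 | I (x 0 1)]) (smooth_proj2 i).
apply: smoothZ => //.
  exact: (@smooth_comp_R R 'rV[R]_2 R _ setT _ _ oD _ (s0 0) sg).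
exact: (@smooth_comp_R R 'rV[R]_2 W _ I _ _ oD _ (s0 1) sP).
Qed.

Lemma derive_strip (W : normedModType R) (I : set R) (g : R -> R) (P : R -> W) (x v : 'rV[R]_2) :
  open I -> smooth setT g -> smooth I P -> I (x 0 1) ->
  'D_v (fun x : 'rV[R]_2 => g (x 0 0) *: P (x 0 1)) x =
  (v 0 0 * 'D_1 g (x 0 0)) *: P (x 0 1) + (g (x 0 0) * v 0 1) *: 'D_1 P (x 0 1).
Proof.
move=> oI sg sP Ix.
have dg : differentiable g (x 0 0) by exact: (smooth_diff sg).
have dP : differentiable P (x 0 1) by exact: (smooth_diff sP).
have dx i : differentiable (fun x : 'rV[R]_2 => x 0 i) x.
  by apply: (smooth_diff (smooth_proj2 i)).
have d1 := @differentiable_comp _ _ _ _ (fun x : 'rV[R]_2 => x 0 0) g x (dx 0) dg.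
have d2 := @differentiable_comp _ _ _ _ (fun x : 'rV[R]_2 => x 0 1) P x (dx 1) dP.
have [_ ->] := diffZr d1 d2.
rewrite (@derive_chain _ _ _ _ (fun x : 'rV[R]_2 => x 0 0) g x v (dx 0) dg).
rewrite (@derive_chain _ _ _ _ (fun x : 'rV[R]_2 => x 0 1) P x v (dx 1) dP).
by rewrite !derive_proj2 (derive_R (v 0 0) dg) (derive_R (v 0 1) dP) scalerA.
Qed.

Variables (s n : nat).
Local Notation E := 'rV[R]_n.+1.

Record ruled (eps : R) (C S : R -> R) (I : set R) (P Q : R -> E) (k : R -> R) : Prop :=
  Ruled {
    ruled_open : open I;
    ruled_C : smooth setT C; ruled_S : smooth setT S;
    ruled_C' : forall t, 'D_1 C t = - eps * S t;
    ruled_S' : forall t, 'D_1 S t = C t;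
    ruled_CS : forall t, C t * C t + eps * (S t * S t) = 1;
    ruled_P : smooth I P; ruled_Q : smooth I Q;
    ruled_Q' : forall t, I t -> 'D_1 Q t = k t *: 'D_1 P t;
    ruled_PP : forall t, I t -> pdot s (P t) (P t) = 1;
    ruled_QQ : forall t, I t -> pdot s (Q t) (Q t) = eps;
    ruled_PQ : forall t, I t -> pdot s (P t) (Q t) = 0 }.

Definition ruled_map (C S : R -> R) (P Q : R -> E) (x : 'rV[R]_2) : E :=
  C (x 0 0) *: P (x 0 1) + S (x 0 0) *: Q (x 0 1).

Section Properties.
Variables (eps : R) (C S : R -> R) (I : set R) (P Q : R -> E) (k : R -> R).
Hypothesis H : ruled eps C S I P Q k.
Let D := [set x : 'rV[R]_2 | I (x 0 1)].
Let F := ruled_map C S P Q.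

Lemma ruled_smooth : smooth D F.
Proof.
case: H => oI sC sS _ _ _ sP sQ _ _ _ _.
by apply: smoothD; [exact: open_strip|exact: smooth_strip|exact: smooth_strip].
Qed.

Lemma ruled_sphere x : D x -> pseudosphere s n (F x).
Proof.
case: H => _ _ _ _ _ CS _ _ _ PP QQ PQ Ix.
rewrite /pseudosphere /= /F /ruled_map !pdotDl !pdotDr !pdotZl !pdotZr.
rewrite PP// QQ// (pdotC s (Q _)) PQ// -[RHS](CS (x 0 0)); ring.
Qed.

Lemma ruled_partial (C1 S1 : R -> R) (P1 Q1 : R -> E) x v :
  smooth setT C1 -> smooth setT S1 -> smooth I P1 -> smooth I Q1 -> D x ->
  'D_v (ruled_map C1 S1 P1 Q1) x =
  v 0 0 *: ('D_1 C1 (x 0 0) *: P1 (x 0 1) + 'D_1 S1 (x 0 0) *: Q1 (x 0 1)) +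
  v 0 1 *: (C1 (x 0 0) *: 'D_1 P1 (x 0 1) + S1 (x 0 0) *: 'D_1 Q1 (x 0 1)).
Proof.
move=> sC sS sP sQ Dx; case: H => oI _ _ _ _ _ _ _ _ _ _ _.
rewrite deriveD; last 2 first.
- exact/diff_derivable/(smooth_diff (smooth_strip oI sC sP)).
- exact/diff_derivable/(smooth_diff (smooth_strip oI sS sQ)).
rewrite (derive_strip _ oI sC sP Dx) (derive_strip _ oI sS sQ Dx).
move: (P1 _) (Q1 _) ('D_1 P1 _) ('D_1 Q1 _) => a b c d.
by apply/rowP => i; rewrite !mxE; ring.
Qed.

Lemma ruled_d0 x : D x -> partial 0 F x =
  (- eps * S (x 0 0)) *: P (x 0 1) + C (x 0 0) *: Q (x 0 1).
Proof.
move=> Dx; case: H => oI sC sS C' S' _ sP sQ _ _ _ _.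
rewrite /partial (ruled_partial _ sC sS sP sQ Dx) !mxE !eqxx /= scale1r scale0r addr0.
by rewrite C' S'.
Qed.

Lemma ruled_d1 x : D x -> partial 1 F x =
  C (x 0 0) *: 'D_1 P (x 0 1) + S (x 0 0) *: 'D_1 Q (x 0 1).
Proof.
move=> Dx; case: H => oI sC sS C' S' _ sP sQ _ _ _ _.
by rewrite /partial (ruled_partial _ sC sS sP sQ Dx) !mxE !eqxx /= scale1r scale0r add0r.
Qed.

Lemma ruled_d00 x : D x -> partial 0 (partial 0 F) x = - eps *: F x.
Proof.
move=> Dx; case: H => oI sC sS C' S' _ sP sQ _ _ _ _.
have sS' : smooth setT (fun t => - eps * S t).
  by apply: smoothM => //; [exact: openT|exact: smooth_cst].
rewrite /partial; rewrite (@near_eq_derive _ _ _ _ (ruled_map (fun t => - eps * S t) C P Q)).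
  rewrite (ruled_partial _ sS' sC sP sQ Dx) !mxE !eqxx /= scale1r scale0r addr0.
  rewrite C' deriveM; [|exact: derivable_cst|exact/diff_derivable/(smooth_diff sS)].
  rewrite S' derive_cst scaler0 addr0 /F /ruled_map scalerDr !scalerA.
  by congr (_ *: _ + _ *: _).
by apply: filterS (near_open (open_strip oI) Dx) => z Dz; exact: ruled_d0.
Qed.

Lemma ruled_d01 x : D x -> partial 1 F x != 0 ->
  exists l, partial 0 (partial 1 F) x = l *: partial 1 F x.
Proof.
move=> Dx; case: H => oI sC sS C' S' _ sP sQ Q' _ _ _.
have sP' : smooth I (fun t => 'D_1 P t) by exact: smooth_deriv.
have sQ' : smooth I (fun t => 'D_1 Q t) by exact: smooth_deriv.
have -> : partial 0 (partial 1 F) x =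
    (- eps * S (x 0 0)) *: 'D_1 P (x 0 1) + C (x 0 0) *: 'D_1 Q (x 0 1).
  rewrite {1}/partial; rewrite (@near_eq_derive _ _ _ _ (ruled_map C S
     (fun t => 'D_1 P t) (fun t => 'D_1 Q t))).
    rewrite (ruled_partial _ sC sS sP' sQ' Dx) !mxE !eqxx /= scale1r scale0r addr0.
    by rewrite C' S'.
  by apply: filterS (near_open (open_strip oI) Dx) => z Dz; exact: ruled_d1.
rewrite ruled_d1// Q'// !scalerA -!scalerDl.
set c := _ + S _ * _ => c0; have {c0} : c != 0.
  by apply: contraNneq c0 => ->; rewrite scale0r.
by move=> c0; eexists (_ / c); rewrite scalerA divfK.
Qed.

Variables (T : E -> E) (isoT : sphere_isometry s T).
Variables (X : 'rV[R]_2 -> E) (U : set 'rV[R]_2) (Psi : 'rV[R]_2 -> 'rV[R]_2).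
Hypotheses (oU : open U) (sPsi : smooth U Psi) (UD : forall z, U z -> D (Psi z)).
Hypothesis XE : forall z, U z -> X z = T (F (Psi z)).

Lemma ruled_nullity x : U x -> \det (metric s X x) != 0 ->
  mean_curvature s X x != 0 -> positive_nullity_at s X x.
Proof.
move=> Ux detX HX; case: (isoT) => _ TS _ _.
pose h := homogenize s T; have sh : smooth (@cone R s n) h by exact: smooth_homogenize.
have oD : open D by apply: open_strip; case: H.
have FC z : D z -> @cone R s n (F z) by move=> Dz; exact/sphere_cone/ruled_sphere.
pose Z z := h (F z).
have sZ : smooth D Z by exact: (smooth_comp_rV oD FC ruled_smooth sh).
have XZ z : U z -> X z = Z (Psi z).
  by move=> Uz; rewrite XE// /Z /h homogenize_sphere//; exact/ruled_sphere/UD.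
have ZS z : D z -> pseudosphere s n (Z z).
  by move=> Dz; rewrite /Z /h homogenize_sphere; [exact/TS/ruled_sphere|exact: ruled_sphere].
have DP := UD Ux.
have dPsi := smooth_diff sPsi Ux; have dZ := smooth_diff sZ DP.
have fX : frame X x = frame (Z \o Psi) x := frame_germ oU XZ Ux.
have FE := frame_comp dPsi dZ.
have [uJ detZ] : jac Psi x \in unitmx /\ \det (metric s Z (Psi x)) != 0.
  by apply: (change_unit FE); rewrite -fX.
have frZ : sphere_frame s (Z (Psi x)) (frame Z (Psi x)).
  exact: (frame_of_immersion oD DP ZS dZ detZ).
have frX : sphere_frame s (X x) (frame X x).
  have frZP := frame_change frZ uJ FE.
  have K p p' Y Y' : p = p' -> Y = Y' -> @sphere_frame R s n.+1 p Y ->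
    sphere_frame s p' Y' by move=> -> ->.
  exact: K (esym (XZ _ Ux)) (esym fX) frZP.
have FD := FC _ DP.
have flat := isometric_flat (@open_cone R s n) sh (fun y u v cy => homogenize_pdot isoT u v cy) _ _ FD.
have Z2 i j : partial i (partial j Z) (Psi x) =
    'D_(partial i (partial j F) (Psi x)) h (F (Psi x)).
  rewrite /partial (hessian_comp _ _ oD DP FC (sh 2%N) (ruled_smooth 2%N)).
  rewrite big1 ?add0r// => a _; rewrite big1// => b _.
  by rewrite flat scaler0.
have dh := smooth_diff sh FD.
have Z1 j : partial j Z (Psi x) = 'D_(partial j F (Psi x)) h (F (Psi x)).
  exact: (derive_chain _ (smooth_diff ruled_smooth DP) dh).
have L0 b : sff_coef s Z (Psi x) 0 b = 0.
  rewrite sff_coefE// Z2; move: b; apply: I2P.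
    rewrite ruled_d00// deriveZv// homogenize_euler// nprojZ.
    by rewrite (nproj_p frZ) scaler0.
  have F1 : partial 1 F (Psi x) != 0.
    apply/eqP => F0; have Z10 : frame Z (Psi x) 1 = 0 by rewrite /frame Z1 F0 derive0.
    move/eqP: detZ; apply; rewrite (expand_det_row _ 1) big1// => j _.
    by rewrite mxE -/(frame Z (Psi x) 1) Z10 pdot0l mul0r.
  have [l ->] := ruled_d01 DP F1.
  rewrite deriveZv// -Z1 nprojZ.
  by rewrite (nproj_T 1 frZ) scaler0.
pose a : 'rV[R]_2 := row 0 (invmx (jac Psi x)).
have aJ b : \sum_i a 0 i * jac Psi x i b = (0 == b)%:R.
  have := congr1 (fun M : 'M[R]_2 => M 0 b) (mulVmx uJ).
  rewrite !mxE => <-; by apply: eq_bigr => i _; rewrite mxE.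
apply: (@vector_nullity _ _ _ _ _ a) => //.
  apply/eqP => a0; have := aJ 0; rewrite a0 big1 ?eqxx => [/eqP|i _].
    by rewrite eq_sym oner_eq0.
  by rewrite mxE mul0r.
move=> j.
transitivity (\sum_p \sum_q ((\sum_i a 0 i * jac Psi x i p) * jac Psi x j q) *:
   sff_coef s Z (Psi x) p q).
  have Lij i : sff_coef s X x i j = \sum_p \sum_q
      (jac Psi x i p * jac Psi x j q) *: sff_coef s Z (Psi x) p q.
    exact: (etrans (sff_germ i j oU XZ Ux frX)
      (sff_comp i j oU Ux UD (sZ 2%N) (sPsi 2%N) frZ uJ)).
  by rewrite -contract_bilinear; apply: eq_bigr => i _; rewrite Lij.
rewrite big1// => p _; rewrite big1// => q _; rewrite aJ.
have [<-|] := eqVneq 0 p; first by rewrite L0 scaler0.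
by rewrite mul0r scale0r.
Qed.

End Properties.
End Ruled.

Section Hyperbolic.
Variable R : realType.

Lemma is_derive_expRN (t : R) : is_derive t 1 (fun x : R => expR (- x)) (- expR (- t)).
Proof.
have dn : differentiable (fun x : R => - x) t.
  exact: (@differentiableN _ _ _ id t (diff_id t)).
have de : differentiable (@expR R) (- t) by exact/derivable1_diffP.
apply: DeriveDef.
  by apply/derivable1_diffP/(@differentiable_comp _ _ _ _ (fun x : R => - x) expR).
rewrite (@derive_chain _ _ _ _ (fun x : R => - x) expR t 1 dn de).
rewrite (@deriveN _ _ _ id t 1 (diff_derivable (diff_id t))) derive_id (derive_R _ de).
by rewrite scaleN1r; congr (- _); case: (is_derive_expR (- t)).
Qed.

Lemma is_derive_cosh (t : R) : is_derive t 1 (@cosh R) (sinh t).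
Proof.
have [d1 D1] := is_derive_expR t; have [d2 D2] := is_derive_expRN t.
have H : (@cosh R) = 2^-1 \*: (@expR R + (fun x => expR (- x))).
  by apply/funext => x; rewrite /cosh mulrC.
rewrite H; apply: DeriveDef; first exact/derivableZ/derivableD.
rewrite deriveZ; last exact: derivableD.
by rewrite (deriveD d1 d2) D1 D2 /sinh mulrC.
Qed.

Lemma is_derive_sinh (t : R) : is_derive t 1 (@sinh R) (cosh t).
Proof.
have [d1 D1] := is_derive_expR t; have [d2 D2] := is_derive_expRN t.
have H : (@sinh R) = 2^-1 \*: (@expR R - (fun x => expR (- x))).
  by apply/funext => x; rewrite /sinh mulrC.
rewrite H; apply: DeriveDef; first exact/derivableZ/derivableB.
rewrite deriveZ; last exact: derivableB.
by rewrite (deriveB d1 d2) D1 D2 /cosh opprK mulrC.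
Qed.

Lemma cosh2_sinh2 (t : R) : cosh t * cosh t - sinh t * sinh t = 1.
Proof.
have : expR t * expR (- t) = 1 by rewrite -expRD subrr expR0.
rewrite /cosh /sinh; move: (expR t) (expR (- t)) => a b ab.
by rewrite -[RHS]ab; field.
Qed.

Lemma smooth_cosh_sinh : smooth setT (@cosh R) /\ smooth setT (@sinh R).
Proof.
suff H k : Cn k setT (@cosh R) /\ Cn k setT (@sinh R) by split=> k; have [] := H k.
elim: k => [|k [IH1 IH2]]; split.
- exact: (Cn_deriv0 (fun x _ => is_derive_cosh x)).
- exact: (Cn_deriv0 (fun x _ => is_derive_sinh x)).
- exact: (Cn_deriv (@openT _) (fun x _ => is_derive_cosh x) IH2).
- exact: (Cn_deriv (@openT _) (fun x _ => is_derive_sinh x) IH1).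
Qed.

Lemma smooth_cos : smooth setT (@cos R).
Proof. by move=> k; have [] := @Cn_sincos R k setT (@openT _). Qed.

Lemma smooth_sin : smooth setT (@sin R).
Proof. by move=> k; have [] := @Cn_sincos R k setT (@openT _). Qed.

End Hyperbolic.

Section Curves.
Variable R : realType.

Lemma smooth_of_curve (W : normedModType R) (I : set R) (g : R -> W) : open I ->
  smooth_curve_on I g -> smooth I g.
Proof.
move=> oI H k; elim: k g H => [|k IH] g H.
  by move=> t It; apply/differentiable_continuous/derivable1_diffP/(H 0%N).
apply: (@Cn_deriv R k I W g (derive1 g)) => // [t It|].
  by apply: DeriveDef; [exact: (H 0%N)|rewrite derive1E].
by apply: IH => m t It; have := H m.+1 t It; rewrite derive1Sn.
Qed.

Lemma oriented_integral_derive (I : set R) (t0 : R) (g : R -> R) t :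
  open_interval I -> I t0 -> (forall x, I x -> {for x, continuous g}) -> I t ->
  is_derive t 1 (fun t => oriented_integral t0 t g) (g t).
Proof.
move=> [oI iI] It0 cg It.
have ends x : I x -> exists2 d, 0 < d & I (x - d) /\ I (x + d).
  move=> Ix; have /nbhs_ballP[r /= r0 rI] := near_open oI Ix.
  have r2 : 0 < r / 2 by rewrite divr_gt0.
  have rr : r / 2 < r by rewrite gtr_pMr// invf_lt1// ltr1n.
  exists (r / 2) => //; split; apply: rI; rewrite /ball /=.
    by rewrite opprB addrC subrK gtr0_norm.
  by rewrite opprD addrA subrr sub0r normrN gtr0_norm.
have [d1 d10 [Ia1 Ib1]] := ends _ It0; have [d2 d20 [Ia2 Ib2]] := ends _ It.
have [a [Ia at0 a_t]] : exists a, [/\ I a, a < t0 & a < t].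
  have [le|le] := leP (t0 - d1) (t - d2).
    by exists (t0 - d1); split=> //; lra.
  by exists (t - d2); split=> //; lra.
have [u [Iu t0u tu]] : exists u, [/\ I u, t0 < u & t < u].
  have [le|le] := leP (t0 + d1) (t + d2).
    by exists (t + d2); split=> //; lra.
  by exists (t0 + d1); split=> //; lra.
have [G GP] : exists G : R -> R, forall x, a < x < u -> is_derive x 1 G (g x).
  by apply: antiderivative => x axu; apply/cg/(iI a u).
pose J : set R := [set x | a < x < u].
have JI x : J x -> I x by move=> /andP[? ?]; apply: (iI a u) => //; rewrite !ltW.
have iJ : is_interval J.
  move=> x y /= /andP[ax _] /andP[_ yu] z /andP[xz zy].
  by rewrite /J /= (lt_le_trans ax xz) (le_lt_trans zy yu).
have oJ : open J.
  have -> : J = `]a, u[%classic by apply/seteqP; split=> x /=; rewrite in_itv.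
  exact: interval_open.
have Jt0 : J t0 by rewrite /J /= at0.
have Jt : J t by rewrite /J /= a_t.
apply: (@near_eq_is_derive _ _ _ (fun x => G x - G t0)).
  apply: filterS (near_open oJ Jt) => x Jx.
  apply/esym/(oriented_integralE iJ Jt0 Jx GP) => y Jy; exact/cg/JI.
have [D1 D2] := GP _ Jt.
apply: DeriveDef; first exact: derivableB.
by rewrite deriveB// derive_cst subr0.
Qed.

End Curves.

Section Flank.
Variable R : realType.

Lemma I5P (Pr : 'I_5 -> Prop) : Pr 0 -> Pr 1 -> Pr 2%:R -> Pr 3%:R -> Pr 4%:R ->
  forall i, Pr i.
Proof.
move=> P0 P1 P2 P3 P4 -[[|[|[|[|[|//]]]]] lt]; [move: P0|move: P1|move: P2|move: P3|move: P4];
  by congr Pr; apply/val_inj.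
Qed.

Lemma I3P (Pr : 'I_3 -> Prop) : Pr 0 -> Pr 1 -> Pr 2%:R -> forall i, Pr i.
Proof.
move=> P0 P1 P2 -[[|[|[|//]]] lt]; [move: P0|move: P1|move: P2];
  by congr Pr; apply/val_inj.
Qed.

Lemma pdot_row5 (a b c d e a' b' c' d' e' : R) :
  pdot 2 (row5 a b c d e) (row5 a' b' c' d' e') =
  - (a * a') - b * b' + c * c' + d * d' + e * e'.
Proof. by rewrite /pdot !big_ord_recl big_ord0 /= !mxE /=; ring. Qed.

Lemma pdot3E (v w : 'rV[R]_3) : pdot 1 v w =
  - (v 0 0 * w 0 0) + v 0 1 * w 0 1 + v 0 2%:R * w 0 2%:R.
Proof.
rewrite /pdot !big_ord_recl big_ord0 /= addr0 addrA.
by congr (_ + _ * _ + _ * _); congr (_ 0 _); apply/val_inj.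
Qed.

Lemma pdot_flank (y z : R) (v w : 'rV[R]_3) :
  pdot 2 (flank y v) (flank z w) = pdot 1 v w.
Proof. by rewrite /flank pdot_row5 pdot3E; ring. Qed.

Lemma smooth_row5 (V : normedModType R) (U : set V) (a b c d e : V -> R) : open U ->
  smooth U a -> smooth U b -> smooth U c -> smooth U d -> smooth U e ->
  smooth U (fun x => row5 (a x) (b x) (c x) (d x) (e x)).
Proof.
move=> oU sa sb sc sd se; apply: smooth_row => // i.
pose g := nth a [:: a; b; c; d; e] i.
apply: (@smooth_ext R V R U g) => //; last by move: i @g; apply: I5P.
by move=> x _; rewrite mxE /g; move: i @g; apply: I5P.
Qed.

Definition flank_mx : 'M[R]_(3, 5) := \matrix_(i, j) (j == i.+1 :> nat)%:R.

Lemma flankE (y : R) v : flank y v = y *: row5 1 0 0 0 1 + v *m flank_mx.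
Proof.
apply/rowP; apply: I5P; rewrite !mxE !big_ord_recl big_ord0 !mxE /=;
  rewrite ?mulr1 ?mulr0 ?addr0 ?add0r //; congr (v 0 _); exact/val_inj.
Qed.

Lemma smooth_flank (V : normedModType R) (U : set V) (y : V -> R) (v : V -> 'rV[R]_3) :
  open U -> smooth U y -> smooth U v -> smooth U (fun x => flank (y x) (v x)).
Proof.
move=> oU sy sv.
apply: (@smooth_ext R V _ U (fun x => y x *: row5 1 0 0 0 1 + v x *m flank_mx)) => //.
  by move=> x _; rewrite flankE.
apply: smoothD => //; last exact: smooth_mulmx.
by apply: smoothZ => //; exact: smooth_cst.
Qed.

Lemma derive_flank (V : normedModType R) (y : V -> R) (v : V -> 'rV[R]_3) x u :
  differentiable y x -> differentiable v x ->
  'D_u (fun x => flank (y x) (v x)) x = flank ('D_u y x) ('D_u v x).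
Proof.
move=> dy dv; rewrite flankE.
have [D1 D1'] := diffZr dy (@differentiable_cst _ _ _ (row5 1 0 0 0 1 : 'rV[R]_5) x).
have [D2 D2'] := diff_mulmx flank_mx dv.
have -> : (fun x => flank (y x) (v x)) =
    (fun x => y x *: row5 1 0 0 0 1) + (fun x => v x *m flank_mx).
  by apply/funext => z; rewrite flankE.
rewrite deriveD; [|exact: diff_derivable|exact: diff_derivable].
by rewrite D2' D1' derive_cst scaler0 addr0.
Qed.

Lemma flankZ (a y : R) v : flank (a * y) (a *: v) = a *: flank y v.
Proof. by rewrite !flankE scalerDr scalerA scalemxAl. Qed.

End Flank.

Lemma smooth_derive1 (R : realType) (W : normedModType R) (I : set R) (g : R -> W) :
  open I -> smooth I g -> smooth I (derive1 g).
Proof.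
move=> oI sg; have -> : derive1 g = (fun t => 'D_1 g t).
  by apply/funext => t; rewrite derive1E.
exact: smooth_deriv.
Qed.

Section Families.
Variable R : realType.

Definition is_ruled (D : set 'rV[R]_2) (F : 'rV[R]_2 -> 'rV[R]_5) : Prop :=
  exists eps C S I P Q k, [/\ @ruled R 2 4 eps C S I P Q k,
    D = [set x : 'rV[R]_2 | I (x 0 1)] & F = ruled_map C S P Q].

Lemma derive_cos (t : R) : 'D_1 (@cos R) t = - 1 * sin t.
Proof. by rewrite mulN1r; case: (is_derive_cos t). Qed.

Lemma derive_sin (t : R) : 'D_1 (@sin R) t = cos t.
Proof. by case: (is_derive_sin t). Qed.

Lemma derive_cosh (t : R) : 'D_1 (@cosh R) t = - - 1 * sinh t.
Proof. by rewrite opprK mul1r; case: (is_derive_cosh t). Qed.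

Lemma derive_sinh (t : R) : 'D_1 (@sinh R) t = cosh t.
Proof. by case: (is_derive_sinh t). Qed.

Lemma cos_sin_eq (t : R) : cos t * cos t + 1 * (sin t * sin t) = 1.
Proof. by rewrite mul1r -!expr2 cos2Dsin2. Qed.

Lemma cosh_sinh_eq (t : R) : cosh t * cosh t + -1 * (sinh t * sinh t) = 1.
Proof. by rewrite mulN1r cosh2_sinh2. Qed.

Lemma family_i_ruled D (F : 'rV[R]_2 -> 'rV[R]_5) : family_i D F -> is_ruled D F.
Proof.
move=> [I [b [[oI _] sb -> ->]]].
have [sc ss] := smooth_cosh_sinh R.
have sm (g : R -> R) : smooth setT g -> smooth I g by apply: smooth_sub.
exists 1, (@cos R), (@sin R), I, (fun t => row5 (b t) (sinh t) 0 (cosh t) (b t)),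
  (fun=> row5 0 0 1 0 0), (fun=> 0); split=> //.
  split=> //.
  - exact: smooth_cos.
  - exact: smooth_sin.
  - exact: derive_cos.
  - exact: derive_sin.
  - exact: cos_sin_eq.
  - have sb' := smooth_of_curve oI sb.
    apply: smooth_row5 => //; [exact: sm|exact: smooth_cst|exact: sm].
  - exact: smooth_cst.
  - by move=> t _; rewrite derive_cst scale0r.
  - by move=> t _; rewrite pdot_row5 -[RHS](cosh2_sinh2 t); ring.
  - by move=> t _; rewrite pdot_row5; ring.
  - by move=> t _; rewrite pdot_row5; ring.
apply/funext => x; rewrite /ruled_map; apply/rowP; apply: I5P; rewrite !mxE /=; ring.
Qed.

Lemma family_iii_ruled D (F : 'rV[R]_2 -> 'rV[R]_5) : family_iii D F -> is_ruled D F.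
Proof.
move=> [I [b [[oI _] sb -> ->]]].
have [sc ss] := smooth_cosh_sinh R.
have sm (g : R -> R) : smooth setT g -> smooth I g by apply: smooth_sub.
exists (-1), (@cosh R), (@sinh R), I, (fun t => row5 (b t) 0 (cos t) (sin t) (b t)),
  (fun=> row5 0 1 0 0 0), (fun=> 0); split=> //.
  split=> //.
  - exact: derive_cosh.
  - exact: derive_sinh.
  - exact: cosh_sinh_eq.
  - have sb' := smooth_of_curve oI sb.
    apply: smooth_row5 => //; [exact: smooth_cst|apply: sm; exact: smooth_cos|].
    by apply: sm; exact: smooth_sin.
  - exact: smooth_cst.
  - by move=> t _; rewrite derive_cst scale0r.
  - by move=> t _; rewrite pdot_row5 -[RHS](cos_sin_eq t); ring.
  - by move=> t _; rewrite pdot_row5; ring.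
  - by move=> t _; rewrite pdot_row5; ring.
apply/funext => x; rewrite /ruled_map; apply/rowP; apply: I5P; rewrite !mxE /=; ring.
Qed.

(* kappa is smooth because kappa = - c <alpha'', N>. *)
Lemma spherical_curve_ruled (c : R) (I : set R) (t0 : R) (b kappa : R -> R)
    (alpha N : R -> 'rV[R]_3) : c * c = 1 ->
  open_interval I -> I t0 -> smooth_curve_on I b ->
  spherical_curve c I alpha N kappa ->
  let y := fun t => oriented_integral t0 t (fun xi => kappa xi * derive1 b xi) in
  let P := fun t => flank (b t) (alpha t) in
  let Q := fun t => flank (y t) (N t) in
  [/\ smooth I P, smooth I Q & forall t, I t ->
    [/\ 'D_1 Q t = kappa t *: 'D_1 P t, pdot 2 (P t) (P t) = 1,
      pdot 2 (Q t) (Q t) = - c & pdot 2 (P t) (Q t) = 0]].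
Proof.
move=> cc oiI It0 sb [sa [sN H]] y P Q; have oI := oiI.1.
have {}sb := smooth_of_curve oI sb; have {}sa := smooth_of_curve oI sa.
have {}sN := smooth_of_curve oI sN.
have s1b := smooth_derive1 oI sb.
have s2a := smooth_derive1 oI (smooth_derive1 oI sa).
have sk : smooth I kappa.
  apply: (@smooth_ext R R R I (fun t => - c * pdot 1 (derive1 (derive1 alpha) t) (N t))) => //.
    move=> t /H[_ _ [Na _ NN] H2 _].
    have -> : derive1 (derive1 alpha) t = kappa t *: N t - c *: alpha t by exact: H2.
    rewrite pdotBl !pdotZl NN (pdotC 1 (alpha t)) Na mulr0 subr0 mulrCA mulrNN cc.
    by rewrite mulr1.
  by apply: smoothM => //; [exact: smooth_cst|exact: smooth_pdot].
have skb : smooth I (fun xi => kappa xi * derive1 b xi) by exact: smoothM.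
have dy t : I t -> is_derive t 1 y (kappa t * derive1 b t).
  move=> It; apply: (oriented_integral_derive oiI It0 _ It) => x Ix.
  exact: (smooth_cont skb Ix).
have sy : smooth I y.
  case=> [|k]; first exact: (Cn_deriv0 dy).
  exact: (Cn_deriv oI dy (skb k)).
split=> [| |t It]; [exact: smooth_flank|exact: smooth_flank|].
have [Sa _ [Na _ NN] _ N'] := H t It.
split.
- have dyt := smooth_diff sy It; have dNt := smooth_diff sN It.
  have -> : 'D_1 Q t = flank ('D_1 y t) ('D_1 N t) by exact: derive_flank.
  have -> : 'D_1 P t = flank ('D_1 b t) ('D_1 alpha t).
    by apply: derive_flank; [exact: (smooth_diff sb)|exact: (smooth_diff sa)].
  have -> : 'D_1 y t = kappa t * 'D_1 b t by case: (dy t It) => _ ->; rewrite derive1E.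
  by rewrite -!derive1E N' derive1E flankZ.
- by rewrite pdot_flank.
- by rewrite pdot_flank.
- by rewrite pdot_flank pdotC.
Qed.

Lemma family_ii_ruled D (F : 'rV[R]_2 -> 'rV[R]_5) : family_ii D F -> is_ruled D F.
Proof.
move=> [I [t0 [b [kappa [al [N [[oI It0 sb] sc _ -> ->]]]]]]].
have cc : -1 * -1 = 1 :> R by rewrite mulrNN mulr1.
have [sP sQ H] := spherical_curve_ruled cc oI It0 sb sc.
set P := (fun t => flank (b t) (al t)) in sP H.
set Q := (fun t => flank _ (N t)) in sQ H.
exists 1, (@cos R), (@sin R), I, P, Q, kappa; split; [|reflexivity|reflexivity].
split.
- exact: oI.1.
- exact: smooth_cos.
- exact: smooth_sin.
- exact: derive_cos.
- exact: derive_sin.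
- exact: cos_sin_eq.
- exact: sP.
- exact: sQ.
- by move=> t /H[].
- by move=> t /H[].
- by move=> t /H[_ _ -> _]; rewrite opprK.
- by move=> t /H[].
Qed.

Lemma family_iv_ruled D (F : 'rV[R]_2 -> 'rV[R]_5) : family_iv D F -> is_ruled D F.
Proof.
move=> [I [t0 [eps [b [kappa [al [N [[oI It0 sb e1] sc _ -> ->]]]]]]]].
have cc : 1 * 1 = 1 :> R by rewrite mulr1.
have ee : eps * eps = 1 by case: e1 => ->; rewrite ?mulrNN mulr1.
have [sP sQ H] := spherical_curve_ruled cc oI It0 sb sc.
have [sch ssh] := smooth_cosh_sinh R.
set P := (fun t => flank (b t) (al t)) in sP H.
set Q := (fun t => flank _ (N t)) in sQ H.
exists (-1), (@cosh R), (@sinh R), I, P, (fun t => eps *: Q t), (fun t => eps * kappa t).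
split; [|reflexivity|]; last first.
  by apply/funext => x; rewrite /ruled_map /= scalerA mulrC.
have oI' := oI.1.
split.
- exact: oI'.
- exact: sch.
- exact: ssh.
- exact: derive_cosh.
- exact: derive_sinh.
- exact: cosh_sinh_eq.
- exact: sP.
- apply: smoothZ; [exact: oI'|exact: smooth_cst|exact: sQ].
- move=> t It; have [Q' _ _ _] := H t It.
  have [_ ->] := diffZr (@differentiable_cst _ _ _ eps t) (smooth_diff sQ It).
  by rewrite derive_cst scale0r add0r Q' scalerA.
- by move=> t /H[].
- by move=> t /H[_ _ QQ _]; rewrite pdotZl pdotZr QQ mulrA ee mul1r.
- by move=> t /H[_ _ _ PQ]; rewrite pdotZr PQ mulr0.
Qed.

End Families.

Section Charts.
Variables (R : realType) (M : surface R).

Lemma open_chart_preimage (d : chart R M) (A : set M) : open A ->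
  open (cimg d `&` cinv d @^-1` A).
Proof.
move=> oA; rewrite openE => x [dx Ax]; rewrite /interior.
near=> y; split; near: y; first by exact: (near_open (@cimg_open _ _ d) dx).
by apply: (cinv_continuous dx); exact: open_nbhs_nbhs.
Unshelve. all: by end_near. Qed.

Lemma congruent_nullity (f : M -> 'rV[R]_5) D (F : 'rV[R]_2 -> 'rV[R]_5) (d : chart R M) x :
  pseudo_riemannian_immersion 2 f -> quasi_minimal 2 f -> is_ruled D F ->
  atlas d -> cimg d x -> congruent_near 2 f (cinv d x) D F ->
  positive_nullity_at 2 (f \o cinv d) x.
Proof.
move=> [fS fI] fQ [eps [C [S [I [P [Q [k [Hr -> ->]]]]]]]] ad dx.
move=> [c [T [sc cp cD isoT fE]]].
have [_ dt] := fI d ad; have [_ sdc] := sc d ad.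
pose U := cimg d `&` cinv d @^-1` cdom c.
have oU : open U by apply: open_chart_preimage; exact: cdom_open.
have sPsi : smooth U (cmap c \o cinv d) by exact/smooth_onP.
have Ux : U x by [].
have Uc z : U z -> cimg c ((cmap c \o cinv d) z).
  by move=> [_ Uz]; exact: cmap_img.
apply: (ruled_nullity Hr isoT oU sPsi _ _ Ux).
- by move=> z /Uc /cD.
- by move=> z Uz; rewrite -(fE _ (Uc z Uz)) /= (cmapK Uz.2).
- exact: dt.
- by have [] := fQ d x ad dx.
Qed.

End Charts.

Section SmoothNormal.
Variables (R : realType) (s n : nat) (V : normedModType R) (U : set V).
Hypothesis oU : open U.

Lemma smooth_nproj (p w : V -> 'rV[R]_n) (T : V -> 'I_2 -> 'rV[R]_n) :
  smooth U p -> (forall i, smooth U (fun x => T x i)) -> smooth U w ->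
  (forall x, U x -> \det (gram s (T x)) != 0) ->
  smooth U (fun x => nproj s (p x) (T x) (w x)).
Proof.
move=> sp sT sw dT; apply: smoothB => //.
  apply: smoothB => //; apply: smoothZ => //; exact: smooth_pdot.
apply: smooth_sum => // i; apply: smooth_sum => // j.
apply: smoothZ => //; apply: smoothM => //; last exact: smooth_pdot.
apply: smooth_invmx => // k l.
apply: (@smooth_ext R V R U (fun x => pdot s (T x k) (T x l))) => //.
  by move=> x _; rewrite mxE.
exact: smooth_pdot.
Qed.

Lemma open_preimage (W : topologicalType) (h : V -> W) (A : set W) :
  (forall x, U x -> {for x, continuous h}) -> open A -> open (U `&` h @^-1` A).
Proof.
move=> ch oA; rewrite openE => x [Ux Ax]; rewrite /interior.
near=> y; split; near: y; first exact: near_open.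
by apply: (ch _ Ux); exact: open_nbhs_nbhs.
Unshelve. all: by end_near. Qed.

End SmoothNormal.

Section NullDirection.
Variables (R : realType) (n : nat).
Implicit Types (L : 'I_2 -> 'I_2 -> 'rV[R]_n) (a m : 'rV[R]_2) (g : 'M[R]_2).

Definition qform g a : R := \sum_i \sum_j a 0 i * a 0 j * g i j.

Lemma qformZ g c a : qform g (c *: a) = c * c * qform g a.
Proof. by rewrite /qform !sum2 !mxE; ring. Qed.

Lemma qform0 g : qform g 0 = 0.
Proof. by rewrite -(scale0r 0) qformZ !mul0r. Qed.

Lemma invmx2 g i j : \det g != 0 ->
  invmx g i j = (\det g)^-1 * (if i == j then g (1 - i) (1 - j) else - g i j).
Proof.
move=> d0; rewrite /invmx unitmxE unitfE d0 !mxE; congr (_ * _).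
rewrite /cofactor; move: i j; apply: I2P; apply: I2P; rewrite /= det_mx11 !mxE /=;
  rewrite ?expr0 ?expr1 ?mul1r ?mulN1r ?expr2 ?mulrNN ?mulr1 ?mul1r; do ?congr (- _);
  congr (g _ _); exact/val_inj.
Qed.

Lemma det2 g : \det g = g 0 0 * g 1 1 - g 0 1 * g 1 0.
Proof.
rewrite (expand_det_row _ 0) sum2 /cofactor !det_mx11 !mxE /=.
rewrite expr0 expr1 mul1r mulN1r mulrN; congr (_ * g _ _ - _ * g _ _); exact/val_inj.
Qed.

(* With w = (- a 0 1, a 0 0), the hypotheses say that L = w w^T Lambda for one
   vector Lambda, and the g-trace of L is g(a, a) Lambda / det g. *)
Lemma trace_null L a m g : \det g != 0 -> g 0 1 = g 1 0 -> L 0 1 = L 1 0 ->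
  a != 0 -> (forall j, \sum_i a 0 i *: L i j = 0) ->
  qform g a *: (\sum_p \sum_q (m 0 p * m 0 q) *: L p q) =
  ((a 0 0 * m 0 1 - a 0 1 * m 0 0) ^+ 2 * \det g) *:
    (\sum_i \sum_j invmx g i j *: L i j).
Proof.
move=> d0 gs Ls a0 Ha.
have E0 := Ha 0; have E1 := Ha 1; rewrite !sum2 in E0 E1.
have tr : \det g *: (\sum_i \sum_j invmx g i j *: L i j) =
    g 1 1 *: L 0 0 - (g 0 1 + g 1 0) *: L 1 0 + g 0 0 *: L 1 1.
  rewrite !sum2 !invmx2//= Ls.
  have -> : (1 - 0 : 'I_2) = 1 by exact/val_inj.
  have -> : (1 - 1 : 'I_2) = 0 by exact/val_inj.
  move: (L 0 0) (L 1 0) (L 1 1) => x y z.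
  by apply/rowP => k; rewrite !mxE; field.
rewrite -scalerA tr /qform !sum2 Ls -gs.
rewrite Ls in E1.
move: E0 E1; move: (L 0 0) (L 1 0) (L 1 1) (g 0 0) (g 0 1) (g 1 1) => x y z g0 g1 g2.
have [a00|a00] := eqVneq (a 0 0) 0.
  have a10 : a 0 1 != 0.
    by apply: contraNneq a0 => a10; apply/eqP/rowP; apply: I2P; rewrite mxE.
  rewrite a00 !scale0r !add0r => /eqP; rewrite scaler_eq0 (negPf a10) /= => /eqP ->.
  move=> /eqP; rewrite scaler_eq0 (negPf a10) /= => /eqP ->.
  by apply/rowP => k; rewrite !mxE; ring.
move=> E0 E1.
have Ey : y = - (a 0 1 / a 0 0) *: z.
  apply: (scalerI a00); rewrite scalerA mulrN mulrC divfK// scaleNr.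
  by apply/eqP; rewrite -addr_eq0; apply/eqP.
have Ex : x = - (a 0 1 / a 0 0) *: y.
  apply: (scalerI a00); rewrite scalerA mulrN mulrC divfK// scaleNr.
  by apply/eqP; rewrite -addr_eq0; apply/eqP.
rewrite Ex Ey; apply/rowP => k; rewrite !mxE; move: (z 0 k) => zk.
by field.
Qed.

End NullDirection.

Lemma rot_orth (R : realType) (m0 m1 w0 w1 b0 b1 : R) : b0 = w1 -> b1 = - w0 ->
  m0 * w0 + m1 * w1 = 0 -> m0 * b1 - m1 * b0 = 0.
Proof. by move=> -> -> E; rewrite -[RHS]oppr0 -E; ring. Qed.

(** * The geodesic null field *)

Section NullField.
Variables (R : realType) (s n : nat).
Local Notation E := 'rV[R]_n.+1.
Variables (X : 'rV[R]_2 -> E) (U : set 'rV[R]_2).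
Hypotheses (oU : open U) (sX : smooth U X).
Hypothesis XS : forall x, U x -> pseudosphere s n (X x).
Hypothesis detX : forall x, U x -> \det (metric s X x) != 0.
Hypothesis HX : forall x, U x -> mean_curvature s X x != 0.

Lemma immersion_frame x : U x -> sphere_frame s (X x) (frame X x).
Proof.
move=> Ux; apply: (frame_of_immersion oU Ux XS (smooth_diff sX Ux)); exact: detX.
Qed.

Lemma smooth_frame i : smooth U (fun x => frame X x i).
Proof. exact: smooth_deriv. Qed.

Lemma smooth_frame_nproj (w : 'rV[R]_2 -> E) : smooth U w ->
  smooth U (fun x => nproj s (X x) (frame X x) (w x)).
Proof. by move=> sw; apply: smooth_nproj => //; exact: smooth_frame. Qed.

Lemma smooth_sff i j : smooth U (fun x => sff_coef s X x i j).
Proof.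
have sw : smooth U (fun x => partial i (partial j X) x).
  exact/smooth_deriv/smooth_deriv.
apply: smooth_ext (smooth_frame_nproj sw) => // x Ux.
exact: esym (sff_coefE i j (immersion_frame Ux)).
Qed.

Lemma sff_sym x i j : U x -> sff_coef s X x i j = sff_coef s X x j i.
Proof.
move=> Ux; have F := immersion_frame Ux.
have C : partial i (partial j X) x = partial j (partial i X) x.
  exact: (clairaut _ _ oU Ux (sX 2%N)).
by rewrite (sff_coefE i j F) (sff_coefE j i F) C.
Qed.

Definition is_null x (a : 'rV[R]_2) := forall j, \sum_i a 0 i *: sff_coef s X x i j = 0.

Lemma null_colinear x (a b : 'rV[R]_2) : U x -> is_null x a -> is_null x b ->
  a 0 0 * b 0 1 - a 0 1 * b 0 0 = 0.
Proof.
move=> Ux Ha Hb; apply/eqP/negPn/negP => D0; have := HX Ux; rewrite /mean_curvature.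
rewrite big1 ?scaler0 ?eqxx// => i _; rewrite big1// => j _.
have := Ha j; have := Hb j; rewrite !sum2 => E2 E1.
have [L0 L1] := cramer2 D0 E1 E2.
suff -> : sff_coef s X x i j = 0 by rewrite scaler0.
by move: i; apply: I2P.
Qed.

Lemma surface_metric_sym x : metric s X x 0 1 = metric s X x 1 0.
Proof. by rewrite [LHS]mxE [RHS]mxE pdotC. Qed.

Lemma null_trace x (a m : 'rV[R]_2) : U x -> a != 0 -> is_null x a ->
  qform (metric s X x) a *: (\sum_p \sum_q (m 0 p * m 0 q) *: sff_coef s X x p q) =
  ((a 0 0 * m 0 1 - a 0 1 * m 0 0) ^+ 2 * \det (metric s X x) * 2) *:
    mean_curvature s X x.
Proof.
move=> Ux a0 Ha; have sy := sff_sym 0 1 Ux.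
have H := trace_null m (detX Ux) (surface_metric_sym x) sy a0 Ha.
rewrite /mean_curvature scalerA mulfK//.
Qed.

Lemma null_nonlight x (a : 'rV[R]_2) : U x -> a != 0 -> is_null x a ->
  qform (metric s X x) a != 0.
Proof.
move=> Ux a0 Ha; apply/eqP => q0.
pose m : 'rV[R]_2 := \row_i (if i == 0 then - a 0 1 else a 0 0).
have := null_trace m Ux a0 Ha; rewrite q0 scale0r => /esym/eqP.
have c0 : a 0 0 * m 0 1 - a 0 1 * m 0 0 != 0.
  rewrite !mxE /=.
  have -> : a 0 0 * a 0 0 - a 0 1 * - a 0 1 = a 0 0 ^+ 2 + a 0 1 ^+ 2 by ring.
  rewrite paddr_eq0 ?sqr_ge0// !sqrf_eq0; apply: contra a0 => /andP[/eqP e0 /eqP e1].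
  by apply/eqP/rowP; apply: I2P; rewrite mxE.
apply/negP; rewrite scaler_eq0 negb_or (HX Ux) andbT.
by rewrite !mulf_neq0// ?pnatr_eq0// (detX Ux).
Qed.

Definition field_vec (a : 'rV[R]_2 -> 'rV[R]_2) x : E := \sum_i a x 0 i *: frame X x i.

Lemma field_vec_pdot a x :
  pdot s (field_vec a x) (field_vec a x) = qform (metric s X x) (a x).
Proof.
rewrite /field_vec pdot_suml; apply: eq_bigr => i _.
rewrite pdot_sumr; apply: eq_bigr => j _.
by rewrite pdotZl pdotZr mxE mulrA.
Qed.

Lemma smooth_field_vec (U1 : set 'rV[R]_2) a : open U1 -> U1 `<=` U ->
  smooth U1 a -> smooth U1 (field_vec a).
Proof.
move=> oU1 UU sa; apply: smooth_sum => // i; apply: smoothZ => //.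
  exact: smooth_coord.
exact: smooth_sub UU (smooth_frame i).
Qed.

Lemma null_field x0 : U x0 -> (forall x, U x -> positive_nullity_at s X x) ->
  exists U1 a eps, [/\ open U1, U1 `<=` U, U1 x0, smooth U1 a & (eps = 1 \/ eps = -1) /\
    forall x, U1 x -> is_null x (a x) /\ pdot s (field_vec a x) (field_vec a x) = eps].
Proof.
move=> Ux0 NX.
have [i [j [k Lk]]] : exists i j k, sff_coef s X x0 i j 0 k != 0.
  apply: contrapT => H; have := HX Ux0; rewrite /mean_curvature.
  rewrite big1 ?scaler0 ?eqxx// => i _; rewrite big1// => j _.
  suff -> : sff_coef s X x0 i j = 0 by rewrite scaler0.
  apply/rowP => k; rewrite [RHS]mxE; apply/eqP/negPn/negP => Lk.
  by apply: H; exists i, j, k.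
pose w l x : R := sff_coef s X x l j 0 k.
have sw l : smooth U (w l) by apply: smooth_coord => //; exact: smooth_sff.
pose b x : 'rV[R]_2 := \row_l (if l == 0 then w 1 x else - w 0 x).
have sb : smooth U b.
  apply: smooth_row => //; apply: I2P.
    by apply: smooth_ext (sw 1) => // x _; rewrite mxE.
  apply: (smooth_ext oU _ (smoothN oU (sw 0))) => x _; by rewrite mxE.
have bE0 x : b x 0 0 = w 1 x by rewrite mxE.
have bE1 x : b x 0 1 = - w 0 x by rewrite mxE.
have b_null x : U x -> b x != 0 -> is_null x (b x).
  move=> Ux bx0; have [m m0 Hm] := nullity_vector (NX _ Ux).
  have E1 : m 0 0 * w 0 x + m 0 1 * w 1 x = 0.
    have := congr1 (fun v : E => v 0 k) (Hm j).
    rewrite sum2 [in RHS]mxE => <-.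
    by rewrite [RHS]mxE [X in _ = X + _]mxE [X in _ = _ + X]mxE.
  have D0 : m 0 0 * b x 0 1 - m 0 1 * b x 0 0 = 0.
    exact: (rot_orth (bE0 x) (bE1 x) E1).
  have [c bE] : exists c, b x = c *: m.
    exact: colinear2 D0.
  move=> l; rewrite bE; transitivity (c *: \sum_i m 0 i *: sff_coef s X x i l).
    by rewrite scaler_sumr; apply: eq_bigr => p _; rewrite [(c *: m) 0 p]mxE scalerA.
  by rewrite Hm scaler0.
have b0 : b x0 != 0.
  apply: contraNneq Lk => b0.
  have w1 : w 1 x0 = 0 by rewrite -bE0 b0 mxE.
  have w0 : w 0 x0 = 0 by apply/eqP; rewrite -oppr_eq0 -bE1 b0 mxE.
  by apply/eqP; move: i; apply: I2P; [exact: w0|exact: w1].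
pose q x := pdot s (field_vec b x) (field_vec b x).
have sv : smooth U (field_vec b) by apply: smooth_field_vec.
have sq : smooth U q by apply: smooth_pdot.
have q0 : q x0 != 0.
  by rewrite /q field_vec_pdot; apply: null_nonlight => //; exact: b_null.
pose eps : R := if 0 < q x0 then 1 else -1.
have e1 : eps = 1 \/ eps = -1 by rewrite /eps; case: ifP; [left|right].
have ee : eps * eps = 1 by case: e1 => ->; rewrite ?mulrNN mulr1.
pose U1 := U `&` (fun x => eps * q x) @^-1` [set y | 0 < y].
have seq : smooth U (fun x => eps * q x) by apply: smoothM => //; exact: smooth_cst.
have oU1 : open U1.
  apply: (open_preimage oU) => [x Ux|]; first exact: (smooth_cont seq Ux).
  exact: (@open_gt R 0).
have UU : U1 `<=` U by move=> x [].
pose r x := expR (- (ln (eps * q x) / 2)).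
have sr : smooth U1 r.
  have sl : smooth U1 (fun x => ln (eps * q x)).
    exact: (@smooth_comp_R R _ R U1 [set y | 0 < y] _ _ oU1 (fun x H => H.2)
       (smooth_sub UU seq) (@Cn_ln R)).
  have sl2 : smooth U1 (fun x => - (ln (eps * q x) / 2)).
    by apply: smoothN => //; apply: smoothM => //; exact: smooth_cst.
  apply: (@smooth_comp_R R _ R U1 setT _ _ oU1 _ sl2) => //.
  by move=> m; apply: Cn_expR; exact: openT.
have r0 x : r x != 0 by rewrite gt_eqF// expR_gt0.
have rq x : U1 x -> r x * r x * q x = eps.
  move=> [_ /= qx]; rewrite /r -expRD -opprD -splitr expRN lnK//.
  have qE : q x = eps * (eps * q x) by rewrite mulrA ee mul1r.
  by rewrite [X in _ * X]qE mulrCA mulVf ?mulr1// gt_eqF.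
exists U1, (fun x => r x *: b x), eps; split => //.
- split=> //=; rewrite lt_neqAle eq_sym mulf_neq0//=; last first.
    by case: e1 => ->; rewrite ?oppr_eq0 oner_eq0.
  rewrite /eps; case: ifP => [/ltW|/negbT]; first by rewrite mul1r.
  by rewrite -leNgt mulN1r oppr_ge0.
- by apply: smoothZ => //; exact: smooth_sub sb.
split=> // x U1x; split.
  move=> l; transitivity (r x *: \sum_i b x 0 i *: sff_coef s X x i l).
    by rewrite scaler_sumr; apply: eq_bigr => p _; rewrite [(_ *: b x) 0 p]mxE scalerA.
  have bx0 : b x != 0.
    apply/eqP => bx0; case: U1x => _ /=; rewrite /q field_vec_pdot bx0.
    by rewrite qform0 mulr0 ltxx.
  have -> : \sum_i b x 0 i *: sff_coef s X x i l = 0 by exact: b_null (UU _ U1x) bx0 l.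
  by rewrite scaler0.
by rewrite -(rq x U1x) /q !field_vec_pdot qformZ.
Qed.

End NullField.

Section Geodesic.
Variables (R : realType) (s n : nat).
Local Notation E := 'rV[R]_n.+1.
Variables (X : 'rV[R]_2 -> E) (U : set 'rV[R]_2).
Hypotheses (oU : open U) (sX : smooth U X).
Hypothesis XS : forall x, U x -> pseudosphere s n (X x).
Hypothesis detX : forall x, U x -> \det (metric s X x) != 0.
Hypothesis HX : forall x, U x -> mean_curvature s X x != 0.
Variables (a : 'rV[R]_2 -> 'rV[R]_2) (eps : R).
Hypotheses (sa : smooth U a) (e1 : eps = 1 \/ eps = -1).
Hypothesis a_null : forall x, U x -> is_null s X x (a x).
Hypothesis a_unit : forall x, U x ->
  pdot s (field_vec X a x) (field_vec X a x) = eps.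

Let Fr x (Ux : U x) := immersion_frame oU sX XS detX Ux.
Let E1 := field_vec X a.
Let sE : smooth U E1 := smooth_field_vec sX oU (@subset_refl _ U) sa.

Let W j x : E := partial j E1 x.
Let sW j : smooth U (W j). Proof. exact: smooth_deriv. Qed.

Lemma eps_neq0 : eps != 0.
Proof. by case: e1 => ->; rewrite ?oppr_eq0 oner_eq0. Qed.

Lemma eps2 : eps * eps = 1.
Proof. by case: e1 => ->; rewrite ?mulrNN mulr1. Qed.

Lemma null_row x j : U x -> \sum_i a x 0 i *: sff_coef s X x j i = 0.
Proof.
move=> Ux; transitivity (\sum_i a x 0 i *: sff_coef s X x i j).
  by apply: eq_bigr => i _; rewrite (sff_sym oU sX XS detX i j Ux).
exact: a_null Ux j.
Qed.

Lemma field_normal x j : U x -> nproj s (X x) (frame X x) (W j x) = 0.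
Proof.
move=> Ux; have F := Fr Ux.
have da i : differentiable (fun y => a y 0 i) x by apply/diff_coord/(smooth_diff sa).
have dX i : differentiable (fun y => frame X y i) x.
  exact: (smooth_diff (smooth_frame sX i) Ux).
have H i := diffZr (da i) (dX i).
have -> : W j x = \sum_i ('D_(delta_mx 0 j) (fun y => a y 0 i) x *: frame X x i +
    a x 0 i *: partial j (partial i X) x).
  rewrite /W /partial /E1 /field_vec derive_fsum => [|i]; last by have [] := H i.
  by apply: eq_bigr => i _; have [_ ->] := H i.
rewrite nproj_sum; transitivity (\sum_i a x 0 i *: sff_coef s X x j i); last exact: null_row.
apply: eq_bigr => i _.
rewrite nprojD !nprojZ (nproj_T i F) scaler0 add0r; congr (_ *: _).
exact: esym (sff_coefE j i F).
Qed.

Let p j x : R := pdot s (W j x) (X x).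
Let G j k x : R := \sum_l invmx (metric s X x) k l * pdot s (W j x) (frame X x l).

Let WE x j : U x -> W j x = p j x *: X x + \sum_k G j k x *: frame X x k.
Proof. by move=> Ux; exact: nproj_eq0 (field_normal j Ux). Qed.

Let sp j : smooth U (p j). Proof. exact: smooth_pdot. Qed.

Let sG j k : smooth U (G j k).
Proof.
apply: smooth_sum => // l; apply: smoothM => //; last first.
  exact: smooth_pdot (sW j) (smooth_frame sX l).
apply: smooth_invmx => // i m.
apply: (smooth_ext oU _ (smooth_pdot s oU (smooth_frame sX i) (smooth_frame sX m))).
by move=> x _; rewrite mxE.
Qed.

Let NW x i j : U x -> nproj s (X x) (frame X x) (partial i (W j) x) =
  \sum_k G j k x *: sff_coef s X x i k.
Proof.
move=> Ux; have F := Fr Ux.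
have dX := smooth_diff sX Ux; have dp := smooth_diff (sp j) Ux.
have dG (k : 'I_2) := smooth_diff (sG j k) Ux.
have dF (k : 'I_2) := smooth_diff (smooth_frame sX k) Ux.
have [D1 H1] := diffZr dp dX; have H2 (k : 'I_2) := diffZr (dG k) (dF k).
have D2 := diff_fsum (fun k => (H2 k).1).
have -> : partial i (W j) x = ('D_(delta_mx 0 i) (p j) x *: X x + p j x *: frame X x i) +
    \sum_k ('D_(delta_mx 0 i) (G j k) x *: frame X x k +
       G j k x *: partial i (partial k X) x).
  rewrite (partial_germ i oU (fun z Uz => WE j Uz) Ux).
  rewrite /partial deriveD; [|exact: diff_derivable|exact: diff_derivable].
  rewrite H1 (derive_fsum _ (fun k => (H2 k).1)).
  by congr (_ + _); apply: eq_bigr => k _; have [_ ->] := H2 k.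
rewrite nprojD nprojD !nprojZ (nproj_p F) (nproj_T i F) !scaler0 addr0 add0r.
rewrite nproj_sum; apply: eq_bigr => k _.
rewrite nprojD !nprojZ (nproj_T k F) scaler0 add0r; congr (_ *: _).
exact: esym (sff_coefE i k F).
Qed.

(* By the Codazzi equation the tangential part of D_(a x) E1 is again null, hence
   a multiple of E1; being orthogonal to E1, it vanishes. *)
Lemma field_geodesic x : U x -> 'D_(a x) E1 x = - eps *: X x.
Proof.
move=> Ux; have F := Fr Ux; have dE := smooth_diff sE Ux.
have codazzi i j : \sum_k G j k x *: sff_coef s X x i k = \sum_k G i k x *: sff_coef s X x j k.
  have s2 : Cn 2 U E1 by exact: sE.
  have C : partial i (W j) x = partial j (W i) x.
    exact: (clairaut (delta_mx 0 i) (delta_mx 0 j) oU Ux s2).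
  apply: etrans (esym (NW i j Ux)) _; rewrite C; exact: (NW j i Ux).
pose c : 'rV[R]_2 := \row_k \sum_j a x 0 j * G j k x.
have c_null : is_null s X x c.
  move=> i; transitivity (\sum_k (\sum_j a x 0 j * G j k x) *: sff_coef s X x i k).
    by apply: eq_bigr => k _; rewrite mxE (sff_sym oU sX XS detX i k Ux).
  transitivity (\sum_j a x 0 j *: \sum_k G j k x *: sff_coef s X x i k).
    under eq_bigr do rewrite scaler_suml.
    rewrite exchange_big; apply: eq_bigr => j _; rewrite scaler_sumr.
    by apply: eq_bigr => k _; rewrite scalerA.
  under eq_bigr do rewrite codazzi scaler_sumr.
  rewrite exchange_big big1//= => k _.
  transitivity (G i k x *: \sum_j a x 0 j *: sff_coef s X x j k).
    by rewrite scaler_sumr; apply: eq_bigr => j _; rewrite !scalerA mulrC.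
  have -> : \sum_j a x 0 j *: sff_coef s X x j k = 0 by exact: a_null Ux k.
  by rewrite scaler0.
have a0 : a x != 0.
  apply: contra_neq eps_neq0 => a0; rewrite -(a_unit Ux) field_vec_pdot a0.
  exact: qform0.
have [l cE] := colinear2 a0 (null_colinear HX Ux (a_null Ux) c_null).
pose P := \sum_j a x 0 j * p j x.
have DE : 'D_(a x) E1 x = P *: X x + l *: E1 x.
  rewrite (derive_rV _ dE) /P scaler_suml /E1 /field_vec.
  transitivity (\sum_j (a x 0 j *: (p j x *: X x) +
      a x 0 j *: \sum_k G j k x *: frame X x k)).
    by apply: eq_bigr => j _; rewrite -scalerDr -WE.
  rewrite big_split; congr (_ + _); first by apply: eq_bigr => j _; rewrite scalerA.
  transitivity (\sum_k c 0 k *: frame X x k).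
    under eq_bigr do rewrite scaler_sumr.
    rewrite exchange_big; apply: eq_bigr => k _; rewrite mxE scaler_suml.
    by apply: eq_bigr => j _; rewrite scalerA.
  by rewrite scaler_sumr; apply: eq_bigr => k _; rewrite cE mxE scalerA.
have XE : pdot s (X x) (E1 x) = 0.
  by rewrite /E1 /field_vec pdot_sumr big1// => k _; rewrite pdotZr (frame_pT F) mulr0.
have l0 : l = 0.
  have := derive_pdot_cst (a x) oU Ux (fun y Uy => a_unit Uy) dE dE.
  rewrite DE pdotDl pdotDr !pdotZl !pdotZr XE (pdotC s _ (X x)) XE a_unit// !mulr0 !add0r.
  move=> /eqP; rewrite -mulr2n mulrn_eq0 mulf_eq0 (negPf eps_neq0) orbF => /eqP; exact.
have DX : 'D_(a x) X x = E1 x by rewrite (derive_rV _ (smooth_diff sX Ux)).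
have EX y : U y -> pdot s (E1 y) (X y) = 0.
  move=> Uy; rewrite /E1 /field_vec pdot_suml big1// => k _.
  by rewrite pdotZl pdotC (frame_pT (Fr Uy)) mulr0.
have := derive_pdot_cst (a x) oU Ux EX dE (smooth_diff sX Ux).
rewrite DX DE l0 scale0r addr0 pdotZl (XS Ux) mulr1 a_unit// => /eqP.
by rewrite addr_eq0 => /eqP ->.
Qed.

Lemma field_derive x : U x -> 'D_(a x) X x = E1 x.
Proof. by move=> Ux; rewrite (derive_rV _ (smooth_diff sX Ux)). Qed.

End Geodesic.

Section DiffeoJac.
Variable R : realType.
Local Notation E2 := 'rV[R]_2.

Lemma jacE (f : E2 -> E2) y : differentiable f y -> jac f y = jacobian f y.
Proof. by move=> df; apply/matrixP => i j; rewrite mxE jacobianE. Qed.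

Lemma derive_inverse (U V : set E2) (F G : E2 -> E2) x v : local_diffeo U V F G ->
  U x -> 'D_('D_v F x) G (F x) = v.
Proof.
move=> [oU oV UV VU K _ sF sG] Ux.
have dF := smooth_diff sF Ux; have dG := smooth_diff sG (UV _ Ux).
rewrite -(derive_chain v dF dG) -[RHS](derive_id x v); apply: near_eq_derive.
by apply: filterS (near_open oU Ux) => z Uz; exact: K.
Qed.

Lemma local_diffeo_sym (U V : set E2) (F G : E2 -> E2) : local_diffeo U V F G ->
  local_diffeo V U G F.
Proof. by case. Qed.

Lemma jac_unit (U V : set E2) (F G : E2 -> E2) x : local_diffeo U V F G -> U x ->
  jac F x \in unitmx.
Proof.
move=> H Ux; have dF := smooth_diff (ld_smooth H) Ux.
rewrite jacE// -row_free_unit; apply: inj_row_free => v.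
rewrite -deriveEjacobian// => v0.
by rewrite -(derive_inverse v H Ux) v0 derive0.
Qed.

End DiffeoJac.

Section Angle.
Variables (R : realType) (V : normedModType R) (U : set V) (p q : V -> R) (a : V -> V).
Hypotheses (oU : open U) (sp : smooth U p) (sq : smooth U q).

Lemma angle_function (eps : R) x0 : eps = 1 \/ eps = -1 -> U x0 ->
  p x0 = 0 -> q x0 = 1 ->
  (forall x, U x -> 'D_(a x) p x = q x) ->
  (forall x, U x -> 'D_(a x) q x = - eps * p x) ->
  exists U1 (f : V -> R), [/\ open U1, U1 `<=` U, U1 x0, smooth U1 f &
    forall x, U1 x -> 'D_(a x) f x = 1].
Proof.
move=> e1 Ux0 p0 q1 Dp Dq; case: e1 => e1.
  pose U1 := U `&` q @^-1` [set y | y != 0].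
  have oU1 : open U1.
    apply: (open_preimage oU) => [x Ux|]; first exact: (smooth_cont sq Ux).
    exact: (@open_neq R 0).
  have UU : U1 `<=` U by move=> x [].
  have sqV : smooth U1 (fun x => (q x)^-1).
    by apply: smoothV => //; [move=> x []|exact: smooth_sub sq].
  have spq : smooth U1 (fun x => p x * (q x)^-1).
    by apply: smoothM => //; exact: smooth_sub sp.
  exists U1, (fun x => atan (p x * (q x)^-1)); split => //.
  - by split=> //=; rewrite q1 oner_eq0.
  - apply: (@smooth_comp_R R _ R U1 setT _ _ oU1 _ spq) => //.
    by move=> k; apply: Cn_atan; exact: openT.
  move=> x [Ux qx]; have U1x : U1 x by [].
  have dp := smooth_diff sp Ux; have dq := smooth_diff sq Ux.
  have dqV := smooth_diff sqV U1x; have dpq := smooth_diff spq U1x.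
  have [dat Dat] := is_derive1_atan (p x * (q x)^-1).
  have dat' : differentiable (@atan R) (p x * (q x)^-1) by exact/derivable1_diffP.
  rewrite (@derive_chain _ _ _ _ (fun x => p x * (q x)^-1) (@atan R) x _ dpq dat').
  rewrite (derive_R _ dat') Dat.
  have [_ D2] := diffZr dp dqV.
  have -> : 'D_(a x) (fun x => p x * (q x)^-1) x =
     'D_(a x) p x * (q x)^-1 + p x * 'D_(a x) (fun x => (q x)^-1) x := D2 (a x).
  rewrite (deriveV qx (diff_derivable dq)) Dp// Dq// e1.
  have h : 1 + (p x / q x) ^+ 2 != 0.
    by rewrite gt_eqF// ltr_pwDl// sqr_ge0.
  have h2 : q x ^+ 2 + p x ^+ 2 != 0.
    have -> : q x ^+ 2 + p x ^+ 2 = (1 + (p x / q x) ^+ 2) * q x ^+ 2 by field.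
    by rewrite mulf_neq0// expf_neq0.
  rewrite -[_ *: (1 + _)^-1]/(_ * (1 + _)^-1) -[- q x ^- 2 *: _]/(- q x ^- 2 * _).
  move: qx h h2; rewrite /=; move: (p x) (q x) => P Q Q0 h h2; field.
  by rewrite Q0 h2.
pose U1 := U `&` (fun x => p x + q x) @^-1` [set y | 0 < y].
have spq : smooth U (fun x => p x + q x) by exact: smoothD.
have oU1 : open U1.
  apply: (open_preimage oU) => [x Ux|]; first exact: (smooth_cont spq Ux).
  exact: (@open_gt R 0).
have UU : U1 `<=` U by move=> x [].
exists U1, (fun x => ln (p x + q x)); split => //.
- by split=> //=; rewrite p0 q1 add0r.
- exact: (@smooth_comp_R R _ R U1 [set y | 0 < y] _ _ oU1 (fun x H => H.2)
       (smooth_sub UU spq) (@Cn_ln R)).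
move=> x [Ux /= pqx].
have dp := smooth_diff sp Ux; have dq := smooth_diff sq Ux.
have dpq := smooth_diff spq Ux.
have [dln Dln] := is_derive1_ln pqx.
have dln' : differentiable (@ln R) (p x + q x) by exact/derivable1_diffP.
rewrite (@derive_chain _ _ _ _ (fun x => p x + q x) (@ln R) x _ dpq dln').
rewrite (derive_R _ dln') Dln.
rewrite deriveD; [|exact: diff_derivable|exact: diff_derivable].
rewrite Dp// Dq// e1 opprK mul1r addrC.
by rewrite -[_ *: _]/(_ * _) divff// gt_eqF.
Qed.

End Angle.

Section NullChart.
Variables (R : realType) (s n : nat).
Local Notation E := 'rV[R]_n.+1.
Variables (X : 'rV[R]_2 -> E) (U : set 'rV[R]_2).
Hypotheses (oU : open U) (sX : smooth U X).
Hypothesis XS : forall x, U x -> pseudosphere s n (X x).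
Hypothesis detX : forall x, U x -> \det (metric s X x) != 0.
Hypothesis HX : forall x, U x -> mean_curvature s X x != 0.
Variables (a : 'rV[R]_2 -> 'rV[R]_2) (eps : R).
Hypotheses (sa : smooth U a) (e1 : eps = 1 \/ eps = -1).
Hypothesis a_null : forall x, U x -> is_null s X x (a x).
Hypothesis a_unit : forall x, U x ->
  pdot s (field_vec X a x) (field_vec X a x) = eps.
Let Fr x (Ux : U x) := immersion_frame oU sX XS detX Ux.
Let E1 := field_vec X a.
Let sE : smooth U E1 := smooth_field_vec sX oU (@subset_refl _ U) sa.

Lemma field_orth x : U x -> pdot s (E1 x) (X x) = 0.
Proof.
move=> Ux; rewrite /E1 /field_vec pdot_suml big1// => k _.
by rewrite pdotZl pdotC (frame_pT (Fr Ux)) mulr0.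
Qed.

Lemma null_neq0 x : U x -> a x != 0.
Proof.
move=> Ux; apply: contra_neq (eps_neq0 e1) => a0.
rewrite -(a_unit Ux) field_vec_pdot a0; exact: qform0.
Qed.

Lemma gram_skew (g : 'M[R]_2) (u v : 'rV[R]_2) : g 0 1 = g 1 0 ->
  (g 0 0 * u 0 0 + g 0 1 * u 0 1) * (g 1 0 * v 0 0 + g 1 1 * v 0 1) -
  (g 1 0 * u 0 0 + g 1 1 * u 0 1) * (g 0 0 * v 0 0 + g 0 1 * v 0 1) =
  \det g * (u 0 0 * v 0 1 - u 0 1 * v 0 0).
Proof.
by move=> gs; rewrite det2 gs; ring.
Qed.

Lemma pdot_lin2 c d (x y z : E) :
  pdot s (c *: x + d *: y) z = c * pdot s x z + d * pdot s y z.
Proof. by rewrite pdotDl !pdotZl. Qed.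

Lemma frame_pdot_vec x (u : 'rV[R]_2) i :
  pdot s (frame X x i) (\sum_j u 0 j *: frame X x j) =
  metric s X x i 0 * u 0 0 + metric s X x i 1 * u 0 1.
Proof.
have gE j : metric s X x i j = pdot s (frame X x i) (frame X x j) by rewrite mxE.
rewrite sum2 pdotC pdot_lin2 !gE; congr (_ + _).
  by rewrite pdotC; exact: mulrC.
by rewrite pdotC; exact: mulrC.
Qed.

(* The first coordinate is the arc length along the leaves, the second one
   the Pluecker coordinate of the plane spanned by X and E1 with respect
   to the constant vectors v and w. *)
Lemma null_chart x0 : U x0 -> exists U' d Psi Phi,
  [/\ 0 < d, U' `<=` U, U' x0, Psi x0 = 0 & local_diffeo U' (ball 0 d) Psi Phi] /\
  forall x, U' x -> 'D_(a x) Psi x = delta_mx 0 0.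
Proof.
move=> Ux0; have ee := eps2 e1.
pose v := eps *: E1 x0.
pose p x := pdot s v (X x); pose q x := pdot s v (E1 x).
have sp : smooth U p by apply: smooth_pdot => //; exact: smooth_cst.
have sq : smooth U q by apply: smooth_pdot => //; exact: smooth_cst.
have Dcst (w : E) (f : 'rV[R]_2 -> E) x u : differentiable f x ->
    'D_u (fun x => pdot s w (f x)) x = pdot s w ('D_u f x).
  move=> df; have [_ ->] := diff_pdot s (@differentiable_cst _ _ _ w x) df.
  by rewrite derive_cst pdot0l add0r.
have DaX x : U x -> 'D_(a x) X x = E1 x.
  by move=> Ux; rewrite (derive_rV _ (smooth_diff sX Ux)).
have DaE x : U x -> 'D_(a x) E1 x = - eps *: X x.
  exact: (field_geodesic oU sX XS detX HX sa e1 a_null a_unit).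
have Dp x : U x -> 'D_(a x) p x = q x.
  by move=> Ux; rewrite /p Dcst ?DaX//; exact: (smooth_diff sX).
have Dq x : U x -> 'D_(a x) q x = - eps * p x.
  by move=> Ux; rewrite /q Dcst ?DaE ?pdotZr//; exact: (smooth_diff sE).
have p0 : p x0 = 0 by rewrite /p pdotZl field_orth// mulr0.
have q0 : q x0 = 1 by rewrite /q pdotZl a_unit.
have [U1 [f [oU1 UU U1x0 sf Df]]] := angle_function oU sp sq e1 Ux0 p0 q0 Dp Dq.
pose h i := pdot s (frame X x0 i) (E1 x0).
pose w := - h 1 *: frame X x0 0 + h 0 *: frame X x0 1.
have wX : pdot s w (X x0) = 0.
  have fX i : pdot s (frame X x0 i) (X x0) = 0 by rewrite pdotC (frame_pT (Fr Ux0)).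
  by rewrite /w pdot_lin2 !fX !mulr0 addr0.
have wE : pdot s w (E1 x0) = 0.
  rewrite /w pdot_lin2 -/(h 0) -/(h 1); move: (h 0) (h 1) => h0 h1; ring.
have wD u : pdot s w ('D_u X x0) =
    \det (metric s X x0) * (a x0 0 0 * u 0 1 - a x0 0 1 * u 0 0).
  have hE i : h i = metric s X x0 i 0 * a x0 0 0 + metric s X x0 i 1 * a x0 0 1.
    exact: frame_pdot_vec.
  have -> : 'D_u X x0 = \sum_j u 0 j *: frame X x0 j.
    exact: (derive_rV _ (smooth_diff sX Ux0)).
  rewrite /w pdot_lin2 !frame_pdot_vec -(gram_skew _ _ (surface_metric_sym s X x0)) -!hE.
  by rewrite mulNr addrC.
pose k x := pdot s w (X x); pose l x := pdot s w (E1 x).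
have sk : smooth U k by apply: smooth_pdot => //; exact: smooth_cst.
have sl : smooth U l by apply: smooth_pdot => //; exact: smooth_cst.
pose tau x := q x * k x - p x * l x.
have stau : smooth U tau by apply: smoothB => //; exact: smoothM.
have Dtau x u : U x -> 'D_u tau x =
    ('D_u q x * k x + q x * pdot s w ('D_u X x)) -
    ('D_u p x * l x + p x * pdot s w ('D_u E1 x)).
  move=> Ux; have dX := smooth_diff sX Ux; have dE := smooth_diff sE Ux.
  have [d1 D1] := diffZr (smooth_diff sq Ux) (smooth_diff sk Ux).
  have [d2 D2] := diffZr (smooth_diff sp Ux) (smooth_diff sl Ux).
  rewrite -(Dcst _ _ _ _ dX) -(Dcst _ _ _ _ dE).
  by rewrite -[X in X - _](D1 u) -[X in _ - X](D2 u) -deriveB//; exact: diff_derivable.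
have Dtau0 x : U x -> 'D_(a x) tau x = 0.
  move=> Ux; rewrite Dtau// DaX// DaE// Dp// Dq// pdotZr -/(k x) -/(l x); ring.
pose Psi x : 'rV[R]_2 := \row_i (if i == 0 then f x - f x0 else tau x).
have sf' : smooth U1 (fun x => f x - f x0) by apply: smoothB => //; exact: smooth_cst.
have stau1 := smooth_sub UU stau.
have sPsi : smooth U1 Psi.
  apply: smooth_row => //; apply: I2P.
    by apply: smooth_ext sf' => // x _; rewrite mxE.
  by apply: smooth_ext stau1 => // x _; rewrite mxE.
have DPsi x u : U1 x -> 'D_u Psi x = \row_i (if i == 0 then 'D_u f x else 'D_u tau x).
  move=> U1x; have dPsi := smooth_diff sPsi U1x.
  apply/rowP => i; rewrite -(derive_coord _ _ _ dPsi) [RHS]mxE; move: i; apply: I2P.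
    have -> : (fun y => Psi y 0 0) = (fun y => f y - f x0).
      by apply/funext => y; rewrite mxE.
    rewrite deriveB; [|exact/diff_derivable/(smooth_diff sf)|exact: derivable_cst].
    by rewrite derive_cst subr0.
  by congr ('D_u _ x); apply/funext => y; rewrite mxE.
have J0 : jacobian Psi x0 \in unitmx.
  rewrite -row_free_unit; apply: inj_row_free => u.
  rewrite -deriveEjacobian; last exact: (smooth_diff sPsi).
  rewrite DPsi// => H.
  have /= := congr1 (fun z : 'rV[R]_2 => z 0 0) H; rewrite !mxE /= => Hf.
  have /= := congr1 (fun z : 'rV[R]_2 => z 0 1) H; rewrite !mxE /= Dtau// => Ht.
  have D0 : a x0 0 0 * u 0 1 - a x0 0 1 * u 0 0 = 0.
    move: Ht; rewrite /k /l wX wE p0 q0 !mulr0 mul0r mul1r add0r addr0 subr0 wD.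
    by move/eqP; rewrite mulf_eq0 (negPf (detX Ux0)) /= => /eqP.
  have [c uE] := colinear2 (null_neq0 Ux0) D0.
  move: Hf; rewrite uE deriveZv ?Df//; last exact: (smooth_diff sf).
  by rewrite -[_ *: 1]/(_ * 1) mulr1 => ->; rewrite scale0r.
have [U' [Phi [d [d0 UU1 U'x0 H]]]] := inverse_function oU1 U1x0 sPsi J0.
have Psi0 : Psi x0 = 0.
  by apply/rowP; apply: I2P; rewrite !mxE //= ?subrr// /tau /k /l wX wE !mulr0 subrr.
exists U', d, Psi, Phi; split.
  by split=> //; [move=> x /UU1 /UU|rewrite -[X in ball X]Psi0].
move=> x /UU1 U1x; rewrite DPsi// Df// Dtau0 ?UU//; last exact: UU.
by apply/rowP; apply: I2P; rewrite !mxE.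
Qed.

End NullChart.

Section AdaptedChart.
Variables (R : realType) (s n : nat).
Local Notation E := 'rV[R]_n.+1.
Variables (X : 'rV[R]_2 -> E) (U : set 'rV[R]_2).
Hypotheses (oU : open U) (sX : smooth U X).
Hypothesis XS : forall x, U x -> pseudosphere s n (X x).
Hypothesis detX : forall x, U x -> \det (metric s X x) != 0.
Hypothesis HX : forall x, U x -> lightlike s (mean_curvature s X x).
Hypothesis NX : forall x, U x -> positive_nullity_at s X x.

Lemma lightlikeZ (c : R) (v : E) : c != 0 -> lightlike s v -> lightlike s (c *: v).
Proof.
move=> c0 [v0 vv]; split; first by rewrite scaler_eq0 negb_or c0.
by rewrite pdotZl pdotZr vv !mulr0.
Qed.

Lemma adapted_chart x0 : U x0 -> exists U' d Psi Phi eps,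
  [/\ 0 < d, U' `<=` U, U' x0, Psi x0 = 0 & local_diffeo U' (ball 0 d) Psi Phi] /\
  (eps = 1 \/ eps = -1) /\ forall y, ball (0 : 'rV[R]_2) d y ->
    let Y := X \o Phi in let N := nproj s (Y y) (frame Y y) in
    [/\ sphere_frame s (Y y) (frame Y y),
      pdot s (partial 0 Y y) (partial 0 Y y) = eps,
      partial 0 (partial 0 Y) y = - eps *: Y y,
      N (partial 1 (partial 0 Y) y) = 0 & lightlike s (N (partial 1 (partial 1 Y) y))].
Proof.
move=> Ux0; have HX0 x : U x -> mean_curvature s X x != 0 by move=> /HX[].
have [U1 [a [eps [oU1 UU U1x0 sa [e1 Ha]]]]] := null_field oU sX XS detX HX0 Ux0 NX.
have sX1 := smooth_sub UU sX.
have XS1 x : U1 x -> pseudosphere s n (X x) by move=> /UU/XS.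
have detX1 x : U1 x -> \det (metric s X x) != 0 by move=> /UU/detX.
have HX1 x : U1 x -> mean_curvature s X x != 0 by move=> /UU/HX0.
have a_null x : U1 x -> is_null s X x (a x) by move=> /Ha[].
have a_unit x : U1 x -> pdot s (field_vec X a x) (field_vec X a x) = eps by move=> /Ha[].
have [U' [d [Psi [Phi [[d0 UU1 U'x0 Psi0 HPhi] DPsi]]]]] :=
  null_chart oU1 sX1 XS1 detX1 HX1 sa e1 a_null a_unit U1x0.
exists U', d, Psi, Phi, eps; split; first by split=> // x /UU1/UU.
split=> // y By; rewrite /=.
set B := ball (0 : 'rV[R]_2) d in By HPhi; pose Y := X \o Phi.
rewrite -/Y.
have oB : open B by exact: ball_open.
have sPhi := ld_smooth_inv HPhi.
have BU1 z : B z -> U1 (Phi z) by move=> /(ld_inv HPhi) /UU1.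
have D0Phi z : B z -> 'D_(delta_mx 0 0) Phi z = a (Phi z).
  move=> Bz; have U'z := ld_inv HPhi Bz.
  by have := derive_inverse (a (Phi z)) HPhi U'z; rewrite (DPsi _ U'z) (ld_invK HPhi Bz).
have dPhi z : B z -> differentiable Phi z by exact: smooth_diff.
have dX z : B z -> differentiable X (Phi z) by move=> /BU1; exact: smooth_diff.
have U1y := BU1 _ By.
have FX := immersion_frame oU1 sX1 XS1 detX1 U1y.
have uJ : jac Phi y \in unitmx := jac_unit (local_diffeo_sym HPhi) By.
have FE := frame_comp (dPhi _ By) (dX _ By).
have FY : sphere_frame s (Y y) (frame Y y) := frame_change FX uJ FE.
have Y0 z : B z -> partial 0 Y z = field_vec X a (Phi z).
  move=> Bz; rewrite /partial /Y.
  have H1 := derive_chain (delta_mx 0 0) (dPhi _ Bz) (dX _ Bz).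
  apply: (etrans H1); rewrite (D0Phi _ Bz).
  exact: (field_derive sX1 a (BU1 _ Bz)).
have Y0y := Y0 _ By.
have J0 q : jac Phi y 0 q = a (Phi y) 0 q by rewrite mxE /partial D0Phi.
have sffY i j : sff_coef s Y y i j =
    \sum_p \sum_q (jac Phi y i p * jac Phi y j q) *: sff_coef s X (Phi y) p q.
  exact: (sff_comp i j oB By BU1 (sX1 2%N) (sPhi 2%N) FX uJ).
split => //.
- by rewrite Y0y; exact: a_unit.
- have H1 := partial_germ 0 oB Y0 By; apply: (etrans H1).
  have sE := smooth_field_vec sX1 oU1 (@subset_refl _ U1) sa.
  have H2 := derive_chain (delta_mx 0 0) (dPhi _ By) (smooth_diff sE U1y).
  apply: (etrans H2); rewrite (D0Phi _ By).
  exact: (field_geodesic oU1 sX1 XS1 detX1 HX1 sa e1 a_null a_unit U1y).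
- apply: (etrans (esym (sff_coefE 1 0 FY))); rewrite sffY big1// => p _.
  transitivity (jac Phi y 1 p *: \sum_q a (Phi y) 0 q *: sff_coef s X (Phi y) p q).
    by rewrite scaler_sumr; apply: eq_bigr => q _; rewrite J0 scalerA.
  have -> := null_row oU1 sX1 XS1 detX1 a_null p U1y.
  by rewrite scaler0.
pose m := row 1 (jac Phi y).
have a0 := null_neq0 e1 a_unit U1y.
have L11 : nproj s (Y y) (frame Y y) (partial 1 (partial 1 Y) y) =
    (eps * ((a (Phi y) 0 0 * m 0 1 - a (Phi y) 0 1 * m 0 0) ^+ 2 *
      \det (metric s X (Phi y)) * 2)) *: mean_curvature s X (Phi y).
  rewrite -scalerA -(null_trace oU1 sX1 XS1 detX1 m U1y a0 (a_null _ U1y)).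
  rewrite -field_vec_pdot a_unit// scalerA (eps2 e1) scale1r.
  apply: (etrans (esym (sff_coefE 1 1 FY))); rewrite sffY.
  by apply: eq_bigr => p _; apply: eq_bigr => q _; rewrite !mxE.
rewrite L11; apply: lightlikeZ; last exact/HX/UU.
apply: mulf_neq0; first exact: eps_neq0.
apply: mulf_neq0; last by rewrite pnatr_eq0.
apply: mulf_neq0; last exact: detX1.
rewrite expf_neq0// -!J0 [m 0 1]mxE [m 0 0]mxE.
by move: uJ; rewrite unitmxE unitfE det2.
Qed.

End AdaptedChart.

(** * Curves in the pseudosphere *)

Section Trig.
Variable R : realType.

Record trig (eps : R) (C S : R -> R) : Prop := Trig {
  trig_C : smooth setT C; trig_S : smooth setT S;
  trig_C' : forall t, 'D_1 C t = - eps * S t;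
  trig_S' : forall t, 'D_1 S t = C t;
  trig_CS : forall t, C t * C t + eps * (S t * S t) = 1;
  trig_CD : forall x y, C (x + y) = C x * C y - eps * (S x * S y);
  trig_SD : forall x y, S (x + y) = S x * C y + C x * S y;
  trig_C0 : C 0 = 1; trig_S0 : S 0 = 0;
  trig_pos : 0 < C 2^-1 /\ S 2^-1 != 0 }.

Lemma trig_circular : trig 1 (@cos R) (@sin R).
Proof.
have h1 : 2^-1 < 1 :> R by rewrite invf_lt1// ltr1n.
have h0 : 0 < 2^-1 :> R by rewrite invr_gt0.
have pi2 := lt_le_trans h1 (pihalf_ge1 R).
split.
- exact: smooth_cos.
- exact: smooth_sin.
- exact: derive_cos.
- exact: derive_sin.
- exact: cos_sin_eq.
- by move=> x y; rewrite cosD mul1r.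
- by move=> x y; rewrite sinD.
- exact: cos0.
- exact: sin0.
split.
  by apply: cos_gt0_pihalf; rewrite pi2 andbT (lt_trans _ h0)// oppr_lt0 (lt_trans h0 pi2).
by rewrite gt_eqF// sin_gt0_pihalf// h0.
Qed.

Lemma trig_hyperbolic : trig (-1) (@cosh R) (@sinh R).
Proof.
have [sc ss] := smooth_cosh_sinh R.
have eD (x y : R) : expR (- (x + y)) = expR (- x) * expR (- y) by rewrite opprD expRD.
have h0 : 0 < 2^-1 :> R by rewrite invr_gt0.
have e1 : expR (- 2^-1) < expR 2^-1 :> R by rewrite ltr_expR; lra.
split => //.
- exact: derive_cosh.
- exact: derive_sinh.
- exact: cosh_sinh_eq.
- move=> x y; rewrite /cosh /sinh expRD eD.
  by move: (expR x) (expR y) (expR (- x)) (expR (- y)) => a b c d; field.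
- move=> x y; rewrite /cosh /sinh expRD eD.
  by move: (expR x) (expR y) (expR (- x)) (expR (- y)) => a b c d; field.
- by rewrite /cosh oppr0 expR0; field.
- by rewrite /sinh oppr0 expR0 subrr mul0r.
split; first by rewrite /cosh divr_gt0// addr_gt0// expR_gt0.
by rewrite /sinh mulf_neq0// ?invr_eq0 ?pnatr_eq0// subr_eq0 gt_eqF.
Qed.

End Trig.

Section RuledForm.
Variables (R : realType) (n : nat).
Local Notation E := 'rV[R]_n.

Definition row2 (x y : R) : 'rV[R]_2 := \row_i (if i == 0 then x else y).

Lemma row2_0 x y : row2 x y 0 0 = x. Proof. by rewrite mxE. Qed.
Lemma row2_1 x y : row2 x y 0 1 = y. Proof. by rewrite mxE. Qed.

Lemma ball2P (c y : 'rV[R]_2) d : 0 < d ->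
  ball c d y <-> `|c 0 0 - y 0 0| < d /\ `|c 0 1 - y 0 1| < d.
Proof.
move=> d0; rewrite -ball_normE /ball_ /=; split=> [H|[H0 H1]].
  split; apply: le_lt_trans H; first by have := ler_coord_norm (c - y) 0; rewrite !mxE.
  by have := ler_coord_norm (c - y) 1; rewrite !mxE.
apply: (@le_lt_trans _ _ (Num.max `|c 0 0 - y 0 0| `|c 0 1 - y 0 1|)).
  apply: row_norm_le; first by rewrite le_max normr_ge0.
  by apply: I2P; rewrite !mxE le_max lexx ?orbT.
by rewrite gt_max H0.
Qed.

Lemma smooth_vertical (c : R) (I : set R) : open I -> smooth I (row2 c).
Proof.
move=> oI; apply: smooth_row => //; apply: I2P.
  by apply: (smooth_ext oI _ (smooth_cst I c)) => x _; rewrite mxE.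
by apply: (smooth_ext oI _ (@smooth_id R _ I)) => x _; rewrite mxE.
Qed.

Lemma derive_vertical (c t : R) : 'D_1 (row2 c) t = delta_mx 0 1.
Proof.
have dr : differentiable (row2 c) t := smooth_diff (smooth_vertical c (@openT R)) I.
apply/rowP => i; rewrite -(derive_coord _ _ _ dr); move: i; apply: I2P.
  have -> : (fun y => row2 c y 0 0) = (fun=> c) by apply/funext => y; rewrite mxE.
  by rewrite derive_cst mxE.
have -> : (fun y => row2 c y 0 1) = id by apply/funext => y; rewrite mxE.
by rewrite derive_id mxE.
Qed.

Variables (eps : R) (C S : R -> R) (G : 'rV[R]_2 -> E) (d : R).
Hypotheses (HT : trig eps C S) (d0 : 0 < d).
Let B := ball (0 : 'rV[R]_2) d.
Hypothesis sG : smooth B G.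
Hypothesis DDG : forall y, B y -> partial 0 (partial 0 G) y = - eps *: G y.

Lemma const_along (f : 'rV[R]_2 -> E) y : (forall y, B y -> differentiable f y) ->
  (forall y, B y -> partial 0 f y = 0) -> B y -> f y = f (row2 0 (y 0 1)).
Proof.
move=> df Df By; pose a := row2 0 (y 0 1); pose u := row2 (y 0 0) 0.
have Ba : B a.
  by move/(ball2P 0 y d0): By => [_ H]; apply/(ball2P _ _ d0); rewrite /a row2_0 row2_1 mxE subrr normr0.
have ya : y = a + 1 *: (y - a) by rewrite scale1r addrC subrK.
have uE : y - a = y 0 0 *: delta_mx 0 0.
  by apply/rowP; apply: I2P; rewrite !mxE /= ?subr0 ?subrr ?mulr1 ?mulr0.
apply/rowP => k; have [|s s01] := @mvt_line R _ (fun z => f z 0 k) a (y - a) 1 ltr01.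
  by move=> s s01; apply/diff_coord/df; apply: ball_segment.
have Bs : B (a + s *: (y - a)).
  by apply: ball_segment => //; case/andP: s01 => *; rewrite !ltW.
rewrite -ya mul1r derive_coord; last exact: df.
rewrite uE deriveZv; last by rewrite -uE; exact: df.
have := Df _ Bs; rewrite /partial uE => ->; rewrite scaler0 mxE => /eqP.
by rewrite subr_eq0 => /eqP.
Qed.

Lemma ruled_form y : B y ->
  G y = C (y 0 0) *: G (row2 0 (y 0 1)) + S (y 0 0) *: partial 0 G (row2 0 (y 0 1)).
Proof.
move=> By; have oB : open B by exact: ball_open.
have sC0 (f : R -> R) : smooth setT f -> smooth B (fun y => f (y 0 0)).
  move=> sf; have sp := smooth_sub (subsetT B) (@smooth_proj2 R 0).
  exact: (@smooth_comp_R R _ R B setT _ _ oB _ sp sf).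
have Dc (f : R -> R) z : smooth setT f -> 'D_(delta_mx 0 0) (fun y : 'rV[R]_2 => f (y 0 0)) z = 'D_1 f (z 0 0).
  move=> sf.
  have dp : differentiable (fun y : 'rV[R]_2 => y 0 0) z by exact: (smooth_diff (@smooth_proj2 R 0)).
  have dfz : differentiable f (z 0 0) by exact: (smooth_diff sf).
  rewrite (@derive_chain _ _ _ _ (fun y : 'rV[R]_2 => y 0 0) f z _ dp dfz) derive_proj2.
  by rewrite mxE.
have [sC sS C' S' CS _ _ C0 S0 _] := HT.
have sG0 : smooth B (partial 0 G) by exact: smooth_deriv.
have part (a b : R -> R) : smooth setT a -> smooth setT b -> smooth B (fun y => a (y 0 0) *: G y + b (y 0 0) *: partial 0 G y) /\
   forall z, B z -> partial 0 (fun y => a (y 0 0) *: G y + b (y 0 0) *: partial 0 G y) z =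
    ('D_1 a (z 0 0) - eps * b (z 0 0)) *: G z + (a (z 0 0) + 'D_1 b (z 0 0)) *: partial 0 G z.
  move=> sa sb; have ssa := sC0 _ sa; have ssb := sC0 _ sb.
  split; first by apply: smoothD => //; apply: smoothZ.
  move=> z Bz; have [d1 D1] := diffZr (smooth_diff ssa Bz) (smooth_diff sG Bz).
  have [d2 D2] := diffZr (smooth_diff ssb Bz) (smooth_diff sG0 Bz).
  rewrite /partial deriveD; [|exact: diff_derivable|exact: diff_derivable].
  rewrite D1 D2 (Dc a)// (Dc b)// -/(partial 0 G z).
  have -> : 'D_(delta_mx 0 0) (partial 0 G) z = - eps *: G z by exact: DDG.
  move: (G z) (partial 0 G z) => g h; apply/rowP => k; rewrite !mxE; ring.
have sNS : smooth setT (fun t => - S t) by apply: smoothN => //; exact: openT.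
have sES : smooth setT (fun t => eps * S t).
  by apply: smoothM => //; [exact: openT|exact: smooth_cst].
have [s1 p1] := part C (fun t => - S t) sC sNS.
have [s2 p2] := part (fun t => eps * S t) C sES sC.
have dS t : differentiable S t by exact: (smooth_diff sS).
have DN t : 'D_1 (fun t => - S t) t = - C t.
  by rewrite deriveN ?S'//; exact: diff_derivable.
have DE t : 'D_1 (fun t => eps * S t) t = eps * C t.
  have [_ H] := diffZr (@differentiable_cst _ _ _ eps t) (dS t).
  by apply: (etrans (H 1)); rewrite derive_cst scale0r add0r S'.
have E1 := const_along (fun z Bz => smooth_diff s1 Bz) _ By.
have E2 := const_along (fun z Bz => smooth_diff s2 Bz) _ By.
have {}E1 := E1 _; have {}E2 := E2 _.
have H1 : C (y 0 0) *: G y - S (y 0 0) *: partial 0 G y = G (row2 0 (y 0 1)).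
  have := E1 _; rewrite row2_0 C0 S0 oppr0 scale0r scale1r addr0 scaleNr; apply.
  move=> z Bz; rewrite (p1 z Bz) C' DN mulrN opprK mulNr addNr subrr !scale0r.
  exact: addr0.
have H2 : (eps * S (y 0 0)) *: G y + C (y 0 0) *: partial 0 G y = partial 0 G (row2 0 (y 0 1)).
  have := E2 _; rewrite row2_0 C0 S0 mulr0 scale0r scale1r add0r; apply.
  move=> z Bz; rewrite (p2 z Bz) DE C' subrr mulNr subrr !scale0r.
  exact: addr0.
rewrite -H1 -H2; move: (partial 0 G y) (CS (y 0 0)); move: (G y) (C _) (S _) => g c s h cs.
rewrite -[LHS]scale1r -cs; apply/rowP => k; rewrite !mxE; ring.
Qed.

End RuledForm.

Section MovingFrame.
Variables (R : realType) (s n : nat).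
Local Notation E := 'rV[R]_n.+1.

Definition derives (W : normedModType R) (I : set R) (f f' : R -> W) :=
  smooth I f /\ forall t, I t -> 'D_1 f t = f' t.

Lemma derivesD (W : normedModType R) (I : set R) (f f' g g' : R -> W) : open I ->
  derives I f f' -> derives I g g' -> derives I (fun t => f t + g t) (fun t => f' t + g' t).
Proof.
move=> oI [sf Df] [sg Dg]; split=> [|t It]; first exact: smoothD.
have df := smooth_diff sf It; have dg := smooth_diff sg It.
by rewrite deriveD ?Df ?Dg//; exact: diff_derivable.
Qed.

Lemma derivesZ (W : normedModType R) (I : set R) (c c' : R -> R) (f f' : R -> W) : open I ->
  derives I c c' -> derives I f f' ->
  derives I (fun t => c t *: f t) (fun t => c' t *: f t + c t *: f' t).
Proof.
move=> oI [sc Dc] [sf Df]; split=> [|t It]; first exact: smoothZ.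
have [_ ->] := diffZr (smooth_diff sc It) (smooth_diff sf It).
by rewrite Dc ?Df// addrC.
Qed.

Lemma derives_comp (W : normedModType R) (I K : set R) (h h' : R -> R) (f f' : R -> W) :
  open K -> (forall t, K t -> I (h t)) -> derives K h h' -> derives I f f' ->
  derives K (fun t => f (h t)) (fun t => h' t *: f' (h t)).
Proof.
move=> oK KI [sh Dh] [sf Df]; split=> [|t Kt]; first exact: (smooth_comp_R oK KI sh sf).
have dh := smooth_diff sh Kt; have df := smooth_diff sf (KI _ Kt).
apply: (etrans (derive_chain _ dh df)).
by rewrite (Dh _ Kt) (derive_R _ df) (Df _ (KI _ Kt)).
Qed.

Lemma derives_eq (W : normedModType R) (I : set R) (f f' g : R -> W) :
  (forall t, I t -> f' t = g t) -> derives I f f' -> derives I f g.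
Proof. by move=> E [sf Df]; split=> // t It; rewrite Df// E. Qed.

Lemma derives_sub (W : normedModType R) (I K : set R) (f f' : R -> W) :
  K `<=` I -> derives I f f' -> derives K f f'.
Proof. by move=> KI [sf Df]; split=> [|t /KI /Df//]; exact: smooth_sub sf. Qed.

Lemma antiderivative_smooth (d c : R) (g : R -> R) : 0 < d -> smooth (ball 0 d) g ->
  exists2 f, f 0 = c & derives (ball 0 (d / 2)) f g.
Proof.
move=> d0 sg; have bE (r t : R) : ball 0 r t -> - r < t < r.
  by rewrite -ball_normE /ball_ /= sub0r normrN ltr_norml.
have Eb (r t : R) : - r < t < r -> ball 0 r t.
  by rewrite -ball_normE /ball_ /= sub0r normrN ltr_norml.
have cg t : - (d / 2) <= t <= d / 2 -> {for t, continuous g}.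
  by move=> Ht; apply: (smooth_cont sg); apply: Eb; lra.
have [G DG] := antiderivative cg.
exists (fun t => G t - G 0 + c); first by rewrite subrr add0r.
have oK : open (ball (0 : R) (d / 2)) by exact: ball_open.
have DH t : ball (0 : R) (d / 2) t -> is_derive t 1 (fun t => G t - G 0 + c) (g t).
  move=> /bE /DG H.
  have -> : (fun t => G t - G 0 + c) = G + cst (c - G 0).
    by apply/funext => x /=; rewrite fctE /cst; ring.
  by rewrite -[g t]addr0; apply: is_deriveD.
split=> [[|k]|t /DH[]//].
  exact: (Cn_deriv0 DH).
apply: (Cn_deriv oK DH); apply: Cn_sub (sg k) => t /bE H; apply: Eb; lra.
Qed.

Lemma eq_mod1 (x y e g c d : R) : e = 1 -> g = 1 ->
  x - y = (1 - e) * c + (1 - g) * d -> x = y.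
Proof. by move=> -> ->; rewrite subrr !mul0r addr0 => /eqP; rewrite subr_eq0 => /eqP. Qed.

(* A, B are the base point and direction of the ruling, u the unit vector of
   the tangent plane orthogonal to both, L the normal part of u'. *)
Record moving_frame (eps del : R) (I : set R) (A B u L : R -> E) (w p k : R -> R) : Prop :=
  MovingFrame {
  mf_A : derives I A (fun t => (eps * w t) *: B t + p t *: u t);
  mf_B : derives I B (fun t => - w t *: A t + k t *: u t);
  mf_u : derives I u (fun t => L t - (p t * del) *: A t - (eps * k t * del) *: B t);
  mf_w : smooth I w; mf_p : smooth I p; mf_k : smooth I k;
  mf_unit : forall t, I t ->
    [/\ pdot s (A t) (A t) = 1, pdot s (B t) (B t) = eps & pdot s (u t) (u t) = del];
  mf_orth : forall t, I t ->
    [/\ pdot s (A t) (B t) = 0, pdot s (A t) (u t) = 0 & pdot s (B t) (u t) = 0];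
  mf_L : forall t, I t ->
    [/\ lightlike s (L t), pdot s (L t) (A t) = 0, pdot s (L t) (B t) = 0
      & pdot s (L t) (u t) = 0] }.

Variables (eps del : R) (C S : R -> R).
Hypotheses (eps1 : eps = 1 \/ eps = -1) (HT : trig eps C S).

Lemma mf_twist I A B u L w p k (phi : R -> R) : open I ->
  moving_frame eps del I A B u L w p k -> derives I phi (fun t => - eps * w t) ->
  moving_frame eps del I (fun t => C (phi t) *: A t + S (phi t) *: B t)
    (fun t => (- eps * S (phi t)) *: A t + C (phi t) *: B t) u L (fun=> 0)
    (fun t => C (phi t) * p t + S (phi t) * k t)
    (fun t => - eps * S (phi t) * p t + C (phi t) * k t).
Proof.
move=> oI [dA dB du sn sp sk Un Or HL] dphi; have e2 : eps * eps = 1 := eps2 eps1.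
have [sC sS C' S' CS _ _ _ _ _] := HT.
have dC0 : derives setT C (fun t => - eps * S t) by split=> // t _; exact: C'.
have dS0 : derives setT S C by split=> // t _; exact: S'.
have dC : derives I (fun t => C (phi t)) (fun t => (w t * S (phi t))).
  apply: derives_eq (derives_comp oI (fun t _ => Logic.I) dphi dC0) => t _.
  rewrite scalerAl -[RHS]mul1r -e2 /GRing.scale /=; ring.
have dS : derives I (fun t => S (phi t)) (fun t => - eps * w t * C (phi t)).
  by apply: derives_eq (derives_comp oI (fun t _ => Logic.I) dphi dS0).
have dcst (c : R) : derives I (fun=> c) (fun=> 0).
  by split=> [|t _]; [exact: smooth_cst|rewrite derive_cst].
have deS : derives I (fun t => - eps * S (phi t)) (fun t => w t * C (phi t)).
  apply: derives_eq (derivesZ oI (dcst (- eps)) dS) => t _.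
  rewrite /GRing.scale /= mul0r add0r -[RHS]mul1r -e2; ring.
have sm (a b : R -> R) : smooth I a -> smooth I b ->
    smooth I (fun t => C (phi t) * a t + S (phi t) * b t).
  by move=> sa sb; apply: smoothD => //; apply: smoothM => //; [case: dC|case: dS].
split => //.
- apply: derives_eq (derivesD oI (derivesZ oI dC dA) (derivesZ oI dS dB)) => t It.
  rewrite mulr0 scale0r add0r; apply/rowP => j; rewrite !mxE; ring.
- apply: derives_eq (derivesD oI (derivesZ oI deS dA) (derivesZ oI dC dB)) => t It.
  rewrite oppr0 scale0r add0r; apply/rowP => j; rewrite !mxE.
  apply: (eq_mod1 (c := w t * S (phi t) * B t 0 j) (d := 0) e2 (erefl 1)); ring.
- apply: derives_eq du => t It; apply/rowP => j; rewrite !mxE.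
  apply: (eq_mod1 (c := del * (- eps * S (phi t) * S (phi t) * p t * A t 0 j +
    S (phi t) * C (phi t) * (k t * A t 0 j + p t * B t 0 j) + S (phi t) * S (phi t) * k t * B t 0 j))
    (d := - del * (p t * A t 0 j + eps * k t * B t 0 j)) e2 (CS (phi t))); ring.
- exact: smooth_cst.
- exact: sm.
- by apply: smoothD => //; apply: smoothM => //; [case: deS|case: dC].
- move=> t It; have [q1 q2 q3] := Un _ It;
  have [h1 h2 h3] := Or _ It; split=> //.
    rewrite !(pdotDl, pdotDr, pdotZl, pdotZr) [pdot s (B t) (A t)]pdotC q1 q2 h1.
    apply: (eq_mod1 (c := 0) (d := - 1) e2 (CS (phi t))); ring.
  rewrite !(pdotDl, pdotDr, pdotZl, pdotZr) [pdot s (B t) (A t)]pdotC q1 q2 h1.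
  apply: (eq_mod1 (c := 0) (d := - eps) e2 (CS (phi t))); ring.
- move=> t It; have [q1 q2 q3] := Un _ It;
  have [h1 h2 h3] := Or _ It; split.
  + rewrite !(pdotDl, pdotDr, pdotZl, pdotZr) [pdot s (B t) (A t)]pdotC q1 q2 h1; ring.
  + by rewrite !(pdotDl, pdotDr, pdotZl, pdotZr) h2 h3 !mulr0 addr0.
  + by rewrite !(pdotDl, pdotDr, pdotZl, pdotZr) h2 h3 !mulr0 addr0.
- move=> t It; have [L0 L1 L2 L3] := HL _ It; split=> //.
  + by rewrite !(pdotDl, pdotDr, pdotZl, pdotZr) L1 L2 !mulr0 addr0.
  + by rewrite !(pdotDl, pdotDr, pdotZl, pdotZr) L1 L2 !mulr0 addr0.
Qed.

Lemma mf_comp I K A B u L w p k (h h' : R -> R) : open K -> (forall t, K t -> I (h t)) ->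
  derives K h h' -> smooth K h' -> (forall t, K t -> h' t != 0) ->
  moving_frame eps del I A B u L w p k ->
  moving_frame eps del K (fun t => A (h t)) (fun t => B (h t)) (fun t => u (h t))
    (fun t => h' t *: L (h t)) (fun t => h' t * w (h t)) (fun t => h' t * p (h t))
    (fun t => h' t * k (h t)).
Proof.
move=> oK KI dh sh' h'0 [dA dB du sn sp sk Un Or HL].
have sc (f : R -> R) : smooth I f -> smooth K (fun t => h' t * f (h t)).
  move=> sf; apply: smoothM => //; exact: (smooth_comp_R oK KI (proj1 dh) sf).
split; last 1 first.
- move=> t Kt; have [L0 L1 L2 L3] := HL _ (KI _ Kt).
  rewrite !pdotZl L1 L2 L3 !mulr0; split=> //; exact: lightlikeZ (h'0 _ Kt) L0.
- apply: derives_eq (derives_comp oK KI dh dA) => t Kt.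
  apply/rowP => j; rewrite !mxE; ring.
- apply: derives_eq (derives_comp oK KI dh dB) => t Kt.
  apply/rowP => j; rewrite !mxE; ring.
- apply: derives_eq (derives_comp oK KI dh du) => t Kt.
  apply/rowP => j; rewrite !mxE; ring.
- exact: sc.
- exact: sc.
- exact: sc.
- by move=> t /KI /Un.
- by move=> t /KI /Or.
Qed.

End MovingFrame.

Section InitialFrame.
Variables (R : realType) (s n : nat).
Local Notation E := 'rV[R]_n.+1.

Lemma derives_self (W : normedModType R) (I : set R) (f : R -> W) :
  smooth I f -> derives I f (fun t => 'D_1 f t).
Proof. by []. Qed.

Lemma shrink_ball (d : R) (P : set R) : 0 < d -> (\forall t \near (0 : R), P t) ->
  exists d', [/\ 0 < d', d' <= d & forall t, ball 0 d' t -> P t].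
Proof.
move=> d0 [e /= e0 H]; exists (Num.min d e); split=> [||t].
- by rewrite lt_min d0.
- by rewrite ge_min lexx.
- by rewrite -ball_normE /ball_ /= lt_min => /andP[_ te]; apply: H.
Qed.

Lemma gram_pair (eps aa w : R) (T : 'I_2 -> E) : eps * eps = 1 ->
  pdot s (T 0) (T 0) = eps -> pdot s (T 0) (T 1) = w -> pdot s (T 1) (T 1) = aa ->
  \det (gram s T) = eps * (aa - eps * w * w).
Proof.
move=> e2 H1 H2 H3; rewrite det2 !mxE [pdot s (T 1) (T 0)]pdotC H1 H2 H3 mulrBr !mulrA e2.
by rewrite mul1r.
Qed.

Lemma inv_sqrtE (q : R) : 0 < q ->
  [/\ expR (ln q / 2) * expR (- (ln q / 2)) = 1, 0 < expR (ln q / 2),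
      expR (- (ln q / 2)) != 0 & expR (- (ln q / 2)) * expR (- (ln q / 2)) * q = 1].
Proof.
move=> q0; rewrite -expRD subrr expR0 expR_gt0 expR_eq0; split=> //.
have E1 : q = expR (ln q) by rewrite lnK ?posrE.
rewrite [X in _ * X]E1 -!expRD -[RHS]expR0; congr expR; by field.
Qed.

Lemma smooth_ln_exp (I : set R) (c : R) (q : R -> R) : open I -> smooth I q ->
  (forall t, I t -> 0 < q t) -> smooth I (fun t => expR (c * ln (q t))).
Proof.
move=> oI sq q0; have sl : smooth I (fun t => ln (q t)).
  exact: (@smooth_comp_R R R R I [set x | 0 < x] q _ oI q0 sq (@Cn_ln R)).
have sc : smooth I (fun t => c * ln (q t)) by apply: smoothM => //; exact: smooth_cst.
exact: (@smooth_comp_R R R R I setT _ _ oI (fun _ _ => Logic.I) sc (fun k => Cn_expR k (@openT R))).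
Qed.

Lemma normal_basis (a : E) (T : 'I_2 -> E) (e c : R) z : c != 0 ->
  pdot s z a = 0 -> pdot s z (T 0) = 0 -> pdot s z (T 1 - e *: T 0) = 0 ->
  nproj s a T z = z.
Proof.
move=> c0 za z0; rewrite pdotBr pdotZr z0 mulr0 subr0 => z1.
by apply: nproj_orth => //; exact: I2P.
Qed.

Lemma derive_pdot_curve (I : set R) (f g : R -> E) (c : R) t : open I -> smooth I f ->
  smooth I g -> (forall t, I t -> pdot s (f t) (g t) = c) -> I t ->
  pdot s ('D_1 f t) (g t) + pdot s (f t) ('D_1 g t) = 0.
Proof.
move=> oI sf sg H It.
exact: (derive_pdot_cst _ oI It H (smooth_diff sf It) (smooth_diff sg It)).
Qed.

Variables (eps d : R) (A B : R -> E).
Hypotheses (eps1 : eps = 1 \/ eps = -1) (d0 : 0 < d).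
Let I := ball (0 : R) d.
Let T t : 'I_2 -> E := fun i => if i == 0 then B t else 'D_1 A t.
Hypotheses (sA : smooth I A) (sB : smooth I B).
Hypothesis FT : forall t, I t -> sphere_frame s (A t) (T t).
Hypothesis BB : forall t, I t -> pdot s (B t) (B t) = eps.
Hypothesis NB : forall t, I t -> nproj s (A t) (T t) ('D_1 B t) = 0.
Hypothesis NA : forall t, I t -> lightlike s (nproj s (A t) (T t) ('D_1 (fun r => 'D_1 A r) t)).

Lemma initial_frame : exists del d' u L w p k,
  [/\ 0 < d', d' <= d, del = 1 \/ del = -1,
    moving_frame s eps del (ball 0 d') A B u L w p k & forall t, ball (0 : R) d' t -> p t != 0].
Proof.
have e2 : eps * eps = 1 := eps2 eps1.
have oI : open I by exact: ball_open.
have sA' : smooth I (fun t => 'D_1 A t) by exact: smooth_deriv.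
pose w t := pdot s (B t) ('D_1 A t); have sw : smooth I w by exact: smooth_pdot.
pose P t := 'D_1 A t - (eps * w t) *: B t.
have sew : smooth I (fun t => eps * w t) by apply: smoothM => //; exact: smooth_cst.
have sP : smooth I P by apply: smoothB => //; exact: smoothZ.
pose pp t := pdot s (P t) (P t); have spp : smooth I pp by exact: smooth_pdot.
have PB t : I t -> pdot s (P t) (B t) = 0.
  by move=> It; rewrite pdotBl pdotZl BB// mulrAC e2 mul1r (pdotC s ('D_1 A t)) subrr.
have pp0 t : I t -> pp t != 0.
  move=> It; have := frame_det (FT It).
  rewrite (@gram_pair eps (pdot s ('D_1 A t) ('D_1 A t)) (w t))// ?BB// mulf_eq0 negb_or.
  move=> /andP[_]; suff -> : pp t = pdot s ('D_1 A t) ('D_1 A t) - eps * w t * w t by [].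
  rewrite /pp {2}/P pdotBr pdotZr PB// mulr0 subr0 pdotBl pdotZl.
  by congr (_ - _ * _).
have I0 : I 0 by exact: ballxx.
pose del : R := if 0 < pp 0 then 1 else -1.
have del1 : del = 1 \/ del = -1 by rewrite /del; case: ifP; [left|right].
have dd : del * del = 1 := eps2 del1.
pose q t := del * pp t; have sq : smooth I q by apply: smoothM => //; exact: smooth_cst.
have q00 : 0 < q 0.
  rewrite /q /del; case: ifPn => [|H]; first by rewrite mul1r.
  by rewrite mulN1r oppr_gt0 lt_neqAle pp0//= leNgt.
have [d' [d'0 d'd q0]] : exists d', [/\ 0 < d', d' <= d & forall t, ball 0 d' t -> 0 < q t].
  apply: shrink_ball => //; have cq := smooth_cont sq I0.
  exact: (@cvgr_gt _ _ _ _ _ _ cq _ q00).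
have KI : ball (0 : R) d' `<=` I by exact: le_ball.
have oK : open (ball (0 : R) d') by exact: ball_open.
set K := ball (0 : R) d' in q0 KI oK *.
pose p t := expR (2^-1 * ln (q t)); pose r t := expR (- 2^-1 * ln (q t)).
have sp : smooth K p by apply: smooth_ln_exp => //; exact: smooth_sub sq.
have sr : smooth K r by apply: smooth_ln_exp => //; exact: smooth_sub sq.
have Hr t : K t -> [/\ p t * r t = 1, 0 < p t, r t != 0 & r t * r t * q t = 1].
  move=> Kt; have := inv_sqrtE (q0 _ Kt).
  by rewrite /p /r mulNr [2^-1 * _]mulrC.
have [u uE] : exists u, u = (fun t => r t *: P t) by exists (fun t => r t *: P t).
have su : smooth K u by rewrite uE; apply: smoothZ => //; exact: smooth_sub sP.
have uu t : K t -> pdot s (u t) (u t) = del.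
  move=> Kt; have [_ _ _ H] := Hr _ Kt; rewrite uE pdotZl pdotZr -/(pp t).
  have -> : pp t = del * q t by rewrite mulrA dd mul1r.
  by rewrite -[RHS]mulr1 -H; ring.
pose k t := del * pdot s ('D_1 B t) (u t).
have sB' : smooth K (fun t => 'D_1 B t) by apply: smooth_sub KI _; exact: smooth_deriv.
have sk : smooth K k.
  by apply: smoothM => //; [exact: smooth_cst|exact: smooth_pdot].
have AA t : I t -> pdot s (A t) (A t) = 1 by move=> It; exact: frame_pp (FT It).
have AB t : I t -> pdot s (A t) (B t) = 0 by move=> It; exact: (frame_pT (FT It) 0).
have AA' t : I t -> pdot s (A t) ('D_1 A t) = 0 by move=> It; exact: (frame_pT (FT It) 1).
have Au t : K t -> pdot s (A t) (u t) = 0.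
  by move=> /KI It; rewrite uE pdotZr pdotBr pdotZr AA'// AB// mulr0 subr0 mulr0.
have Bu t : K t -> pdot s (B t) (u t) = 0.
  by move=> /KI It; rewrite uE pdotZr pdotC PB// mulr0.
have A'E t : K t -> 'D_1 A t = (eps * w t) *: B t + p t *: u t.
  move=> Kt; have [pr _ _ _] := Hr _ Kt.
  by rewrite uE scalerA pr scale1r addrC subrK.
have NT t i : I t -> nproj s (A t) (T t) (T t i) = 0 by move=> It; exact: nproj_T (FT It).
have NBt t : I t -> nproj s (A t) (T t) (B t) = 0 by move=> It; exact: (NT t 0 It).
have NAt t : I t -> nproj s (A t) (T t) (A t) = 0 by move=> It; exact: nproj_p (FT It).
have NPt t : I t -> nproj s (A t) (T t) (P t) = 0.
  move=> It; rewrite /P addrC -scaleNr nproj_lin NBt// scaler0 add0r.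
  exact: (NT t 1 It).
have Nut t : K t -> nproj s (A t) (T t) (u t) = 0.
  by move=> /KI It; rewrite uE nprojZ NPt// scaler0.
have normalE t z : K t -> pdot s z (A t) = 0 -> pdot s z (B t) = 0 ->
    pdot s z (u t) = 0 -> nproj s (A t) (T t) z = z.
  move=> Kt zA zB zu; apply: (@normal_basis (A t) (T t) (eps * w t) (r t)) => //.
  - by have [_ _ H _] := Hr _ Kt.
  - have [_ _ H _] := Hr _ Kt; move/eqP: zu; rewrite uE pdotZr mulf_eq0 (negPf H).
    by move/eqP.
have dw : derives K A (fun t => (eps * w t) *: B t + p t *: u t).
  by split=> //; exact: smooth_sub sA.
have B'A t : I t -> pdot s ('D_1 B t) (A t) = - w t.
  move=> It; have BA x : I x -> pdot s (B x) (A x) = 0 by move=> Ix; rewrite pdotC AB.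
  by apply/eqP; rewrite -addr_eq0 -/(w t) (derive_pdot_curve oI sB sA BA It).
have half0 (x : R) : x + x = 0 -> x = 0 by move=> H; lra.
have B'B t : I t -> pdot s ('D_1 B t) (B t) = 0.
  move=> It; apply: half0.
  have := derive_pdot_curve oI sB sB BB It.
  by rewrite [pdot s (B t) _]pdotC.
have B'E t : K t -> 'D_1 B t = - w t *: A t + k t *: u t.
  move=> Kt; have It := KI _ Kt.
  pose z := 'D_1 B t - (- w t *: A t + k t *: u t).
  have z1 : pdot s z (A t) = 0.
    rewrite pdotBl B'A// pdotDl !pdotZl AA// [pdot s (u t) _]pdotC Au//; ring.
  have z2 : pdot s z (B t) = 0.
    rewrite pdotBl B'B// pdotDl !pdotZl AB// [pdot s (u t) _]pdotC Bu//; ring.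
  have z3 : pdot s z (u t) = 0.
    rewrite pdotBl pdotDl !pdotZl Au// uu// mulr0 add0r /k.
    by rewrite mulrAC dd mul1r subrr.
  have := normalE _ _ Kt z1 z2 z3.
  rewrite {1}/z -scaleN1r addrC nproj_lin nprojD !nprojZ NAt// Nut// NB// !scaler0 !addr0 scaler0.
  by move=> /esym /eqP; rewrite subr_eq0 => /eqP.
pose L t := 'D_1 u t + (p t * del) *: A t + (eps * k t * del) *: B t.
have u'u t : K t -> pdot s ('D_1 u t) (u t) = 0.
  move=> Kt; apply: half0.
  have := derive_pdot_curve oK su su uu Kt.
  by rewrite [pdot s (u t) _]pdotC.
have u'A t : K t -> pdot s ('D_1 u t) (A t) = - (p t * del).
  move=> Kt; have uA x : K x -> pdot s (u x) (A x) = 0 by move=> Kx; rewrite pdotC Au.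
  have := derive_pdot_curve oK su (smooth_sub KI sA) uA Kt.
  rewrite A'E// pdotDr !pdotZr uu// [pdot s (u t) (B t)]pdotC Bu// mulr0 add0r => /eqP.
  by rewrite addr_eq0 => /eqP.
have u'B t : K t -> pdot s ('D_1 u t) (B t) = - (k t * del).
  move=> Kt; have uB x : K x -> pdot s (u x) (B x) = 0 by move=> Kx; rewrite pdotC Bu.
  have := derive_pdot_curve oK su (smooth_sub KI sB) uB Kt.
  rewrite B'E// pdotDr !pdotZr uu// [pdot s (u t) (A t)]pdotC Au// mulr0 add0r => /eqP.
  by rewrite addr_eq0 => /eqP.
have LA t : K t -> pdot s (L t) (A t) = 0.
  move=> Kt; have It := KI _ Kt.
  rewrite !pdotDl !pdotZl u'A// AA// [pdot s (B t) _]pdotC AB//; ring.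
have LB t : K t -> pdot s (L t) (B t) = 0.
  move=> Kt; have It := KI _ Kt.
  rewrite !pdotDl !pdotZl u'B// BB// AB// mulr0 addr0.
  apply: (eq_mod1 (c := - k t * del) (d := 0) e2 (erefl 1)); ring.
have Lu t : K t -> pdot s (L t) (u t) = 0.
  by move=> Kt; rewrite !pdotDl !pdotZl u'u// Au// Bu// !mulr0 !addr0.
have LE t : K t -> L t = r t *: nproj s (A t) (T t) ('D_1 (fun r => 'D_1 A r) t).
  move=> Kt; have It := KI _ Kt.
  rewrite -(normalE _ _ Kt (LA _ Kt) (LB _ Kt) (Lu _ Kt)) /L 2!nprojD 2!nprojZ NAt// NBt//.
  rewrite !scaler0 !addr0.
  have dP : derives K P (fun t => 'D_1 (fun r => 'D_1 A r) t +
     - ('D_1 (fun t => eps * w t) t *: B t + (eps * w t) *: 'D_1 B t)).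
    apply: (derives_sub KI); split; first exact: sP.
    move=> x Ix; rewrite /P.
    have dew := diffZr (smooth_diff sew Ix) (smooth_diff sB Ix).
    rewrite deriveB; [|exact/diff_derivable/(smooth_diff sA')|exact/diff_derivable/(proj1 dew)].
    by rewrite (proj2 dew).
  have [_ D] := derivesZ oK (derives_self sr) dP.
  rewrite uE (D _ Kt) nproj_lin NPt// scaler0 add0r nprojZ nprojD -scaleN1r nprojZ.
  by rewrite nproj_lin nprojZ NBt// NB// !scaler0 !addr0 scaler0 addr0.
exists del, d', u, L, w, p, k; split => //; last by move=> t _; rewrite /p gt_eqF// expR_gt0.
split => //.
- by split=> //; exact: smooth_sub sB.
- split=> // t _; rewrite /L -!addrA; move: ('D_1 u t) => x.
  by apply/rowP => j; rewrite !mxE; ring.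
- exact: smooth_sub sw.
- by move=> t Kt; split; [exact/AA/KI|exact/BB/KI|exact: uu].
- by move=> t Kt; split; [exact/AB/KI|exact: Au|exact: Bu].
- move=> t Kt; split; [|exact: LA|exact: LB|exact: Lu].
  by rewrite LE//; apply: lightlikeZ; [have [] := Hr _ Kt|exact/NA/KI].
Qed.

End InitialFrame.

Section Reparametrization.
Variables (R : realType) (s n : nat).
Local Notation E := 'rV[R]_n.+1.

Lemma mf_sub (eps del : R) (I K : set R) (A B u L : R -> E) w p k :
  K `<=` I -> moving_frame s eps del I A B u L w p k ->
  moving_frame s eps del K A B u L w p k.
Proof.
move=> KI [dA dB du sw sp sk Un Or HL]; split.
- exact: derives_sub dA.
- exact: derives_sub dB.
- exact: derives_sub du.
- exact: smooth_sub sw.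
- exact: smooth_sub sp.
- exact: smooth_sub sk.
- by move=> t /KI /Un.
- by move=> t /KI /Or.
- by move=> t /KI /HL.
Qed.

Lemma mf_eq (eps del : R) (I : set R) (A B u L : R -> E) w p w' p' k : open I ->
  (forall t, I t -> w t = w' t) -> (forall t, I t -> p t = p' t) ->
  moving_frame s eps del I A B u L w p k ->
  moving_frame s eps del I A B u L w' p' k.
Proof.
move=> oI Ew Ep [dA dB du sw sp sk Un Or HL]; split=> //.
- by apply: derives_eq dA => t It; rewrite Ew// Ep.
- by apply: derives_eq dB => t It; rewrite Ew.
- by apply: derives_eq du => t It; rewrite Ep.
- exact: smooth_ext sw.
- exact: smooth_ext sp.
Qed.

Lemma ball0P (r t : R) : ball 0 r t <-> `|t| < r.
Proof. by rewrite -ball_normE /ball_ /= sub0r normrN. Qed.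

Lemma injective_of_derive (r : R) (f f' : R -> R) : derives (ball 0 r) f f' ->
  (forall t, ball 0 r t -> f' t != 0) ->
  forall x y, ball 0 r x -> ball 0 r y -> f x = f y -> x = y.
Proof.
move=> [sf Df] f0 x y /ball0P xr /ball0P yr fxy; apply/eqP; rewrite eq_sym -subr_eq0; apply/eqP.
have seg t : 0 <= t <= 1 -> ball 0 r (x + t *: (y - x)).
  move=> /andP[t0 t1]; apply/ball0P.
  have -> : x + t *: (y - x) = (1 - t) * x + t * y by rewrite /GRing.scale /=; ring.
  rewrite (le_lt_trans (ler_normD _ _))// !normrM (ger0_norm t0) ger0_norm ?subr_ge0//.
  have [->|tp] := eqVneq t 0; first by rewrite subr0 mul1r mul0r addr0.
  rewrite (@lt_le_trans _ _ ((1 - t) * r + t * r))//; last by rewrite -mulrDl subrK mul1r.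
  by rewrite ler_ltD ?ler_wpM2l ?subr_ge0// ?ltW// ltr_pM2l// lt_neqAle eq_sym tp.
have [t t01] := @mvt_line R R f x (y - x) 1 ltr01 (fun t Ht => smooth_diff sf (seg t Ht)).
have -> : x + 1 *: (y - x) = y by rewrite scale1r addrC subrK.
rewrite fxy subrr mul1r => /esym.
have St : ball 0 r (x + t *: (y - x)) by apply: seg; case/andP: t01 => *; rewrite !ltW.
rewrite (derive_R _ (smooth_diff sf St)) Df// => /eqP.
by rewrite mulf_eq0 (negPf (f0 _ St)) orbF => /eqP.
Qed.

Lemma derive_proj_comp (W : normedModType R) (f : R -> W) (i : 'I_2) (z v : 'rV[R]_2) :
  differentiable f (z 0 i) ->
  'D_v (fun y : 'rV[R]_2 => f (y 0 i)) z = v 0 i *: 'D_1 f (z 0 i).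
Proof.
move=> df; have dp : differentiable (fun y : 'rV[R]_2 => y 0 i) z.
  exact: (smooth_diff (@smooth_proj2 R i)).
by rewrite (@derive_chain _ _ _ _ (fun y : 'rV[R]_2 => y 0 i) f z _ dp df) derive_proj2 derive_R.
Qed.

Variables (eps del d : R) (C S : R -> R) (A B u L : R -> E) (w p k : R -> R).
Hypotheses (eps1 : eps = 1 \/ eps = -1) (HT : trig eps C S) (d0 : 0 < d).
Hypothesis MF : moving_frame s eps del (ball 0 d) A B u L w p k.
Hypothesis p0 : forall t, ball (0 : R) d t -> p t != 0.

Lemma reparametrization : exists sg r U Psi Phi (al N T xi : R -> E) (kap : R -> R),
  [/\ 0 < r, U `<=` ball 0 d, U 0, Psi 0 = row2 sg 0
    & local_diffeo U (ball (row2 sg 0) r) Psi Phi] /\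
  [/\ moving_frame s eps del (ball 0 r) al N T xi (fun=> 0) (fun=> 1) kap,
    forall t, ball 0 r t -> kap t != 0
    & forall y, ball (row2 sg 0) r y ->
      C (Phi y 0 0) *: A (Phi y 0 1) + S (Phi y 0 0) *: B (Phi y 0 1) =
      C (y 0 0) *: al (y 0 1) + S (y 0 0) *: N (y 0 1)].
Proof.
have [sC sS _ _ _ CD SD C0 S0 [Ch Sh]] := HT.
have e0 : eps != 0 := eps_neq0 eps1.
have I0 : ball (0 : R) d 0 by exact: ballxx.
(* A starting angle for which neither m nor q vanishes at 0. *)
pose sg : R := if k 0 == 0 then 2^-1 else 0.
have sw := mf_w MF; have sp := mf_p MF; have sk := mf_k MF.
have [phi phi0 dphi] : exists2 f, f 0 = sg & derives (ball 0 (d / 2)) f (fun t => - eps * w t).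
  by apply: antiderivative_smooth => //; apply: smoothM sw; [exact: ball_open|exact: smooth_cst].
have d2 : 0 < d / 2 by rewrite divr_gt0.
have d2d : d / 2 <= d by rewrite ler_pdivrMr// ler_peMr ?ler1n ?ltW.
have oK2 : open (ball (0 : R) (d / 2)) by exact: ball_open.
have MF1 := mf_twist eps1 HT oK2 (mf_sub (le_ball d2d) MF) dphi.
have J0 : ball (0 : R) (d / 2) 0 by exact: ballxx.
pose m t := C (phi t) * p t + S (phi t) * k t.
pose q t := - eps * S (phi t) * p t + C (phi t) * k t.
have sm1 : smooth (ball 0 (d / 2)) m := mf_p MF1.
have sq1 : smooth (ball 0 (d / 2)) q := mf_k MF1.
have m0 : m 0 != 0.
  rewrite /m phi0 /sg; case: ifPn => [/eqP->|_].
    by rewrite mulr0 addr0 mulf_neq0 ?p0// gt_eqF.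
  by rewrite C0 S0 mul1r mul0r addr0 p0.
have q0 : q 0 != 0.
  rewrite /q phi0 /sg; case: ifPn => [/eqP->|k0].
    by rewrite mulr0 addr0 !mulf_neq0 ?p0// oppr_eq0.
  by rewrite C0 S0 mul1r mulr0 mul0r add0r.
have [r1 [r10 r1d mq]] : exists r, [/\ 0 < r, r <= d / 2 &
    forall t, ball 0 r t -> m t != 0 /\ q t != 0].
  apply: shrink_ball => //.
  have cm := smooth_cont sm1 J0; have cq := smooth_cont sq1 J0.
  by near=> t; split; near: t; [exact: (@cvgr_neq0 _ _ _ _ _ m _ cm m0)|exact: (@cvgr_neq0 _ _ _ _ _ q _ cq q0)].
have r1d1 : ball (0 : R) r1 `<=` ball 0 (d / 2) by exact: le_ball.
have [th th0 dth] := antiderivative_smooth 0 r10 (smooth_sub r1d1 sm1).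
have r2 : 0 < r1 / 2 by rewrite divr_gt0.
have r21 : r1 / 2 <= r1 by rewrite ler_pdivrMr// ler_peMr ?ler1n ?ltW.
have r2r1 : ball (0 : R) (r1 / 2) `<=` ball 0 r1 by exact: le_ball.
set J := ball (0 : R) (r1 / 2) in dth r2r1.
have oJ : open J by exact: ball_open.
have dphiJ : derives J phi (fun t => - eps * w t) by apply: derives_sub dphi => x /r2r1 /r1d1.
have mJ t : J t -> m t != 0 by move=> /r2r1 /mq[].
have qJ t : J t -> q t != 0 by move=> /r2r1 /mq[].
pose D := ball (0 : 'rV[R]_2) (r1 / 2); have oD : open D by exact: ball_open.
have DJ z : D z -> J (z 0 1).
  by move=> /(ball2P _ _ r2)[_]; rewrite mxE sub0r normrN => H; exact/ball0P.
have sphi2 : smooth D (fun z : 'rV[R]_2 => phi (z 0 1)).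
  exact: (@smooth_comp_R R _ _ D J _ _ oD DJ (smooth_sub (subsetT _) (@smooth_proj2 R 1)) (proj1 dphiJ)).
have sth2 : smooth D (fun z : 'rV[R]_2 => th (z 0 1)).
  exact: (@smooth_comp_R R _ _ D J _ _ oD DJ (smooth_sub (subsetT _) (@smooth_proj2 R 1)) (proj1 dth)).
have sz0 : smooth D (fun z : 'rV[R]_2 => z 0 0) := smooth_sub (subsetT _) (@smooth_proj2 R 0).
pose Psi (z : 'rV[R]_2) := row2 (z 0 0 - phi (z 0 1)) (th (z 0 1)).
have PsiE0 (z : 'rV[R]_2) : Psi z 0 0 = z 0 0 - phi (z 0 1) by rewrite row2_0.
have PsiE1 (z : 'rV[R]_2) : Psi z 0 1 = th (z 0 1) by rewrite row2_1.
have sPsi : smooth D Psi.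
  apply: smooth_row => //; apply: I2P.
    by apply: (smooth_ext oD (fun z _ => esym (PsiE0 z))); exact: smoothB.
  exact: (smooth_ext oD (fun z _ => esym (PsiE1 z))).
have D0 : D 0 by exact: ballxx.
have dP : differentiable Psi 0 := smooth_diff sPsi D0.
have J00 : J ((0 : 'rV[R]_2) 0 1) by exact: DJ.
have uJ : jacobian Psi 0 \in unitmx.
  have M i j : jacobian Psi 0 i j = 'D_(delta_mx 0 i) (fun y => Psi y 0 j) 0.
    by rewrite jacobianE// derive_coord.
  have e i j : (delta_mx 0 i : 'rV[R]_2) 0 j = (j == i)%:R by rewrite mxE.
  have ddf : differentiable (fun y : 'rV[R]_2 => phi (y 0 1)) 0 := smooth_diff sphi2 D0.
  have ddz : differentiable (fun y : 'rV[R]_2 => y 0 0) 0 := smooth_diff sz0 D0.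
  have M1 i : jacobian Psi 0 i 1 = (1 == i)%:R * m 0.
    rewrite M; have -> : (fun y => Psi y 0 1) = (fun y => th (y 0 1)) by apply/funext.
    have -> := derive_proj_comp (delta_mx 0 i) (smooth_diff (proj1 dth) J00).
    by rewrite (proj2 dth _ J00) e; congr (_ * m _); rewrite mxE.
  have M00 : jacobian Psi 0 0 0 = 1.
    rewrite M; have -> : (fun y => Psi y 0 0) = (fun y => y 0 0 - phi (y 0 1)) by apply/funext.
    rewrite deriveB; [|exact: diff_derivable|exact: diff_derivable].
    have -> := derive_proj_comp (delta_mx 0 0) (smooth_diff (proj1 dphiJ) J00).
    by rewrite derive_proj2 !e scale0r subr0.
  rewrite unitmxE unitfE det2 M00 !M1 mul0r mul0r subr0 !mul1r.
  exact: m0.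
have [U [Phi [r [r0 UD U0 LD]]]] := inverse_function oD D0 sPsi uJ.
have Psi0 : Psi 0 = row2 (- sg) 0 by rewrite /Psi !mxE phi0 th0 sub0r.
rewrite Psi0 in LD.
pose K := ball (0 : R) r; have oK : open K by exact: ball_open.
pose v t := row2 (- sg) t.
have BP y : ball (row2 (- sg) 0) r y -> K (y 0 1).
  by move=> /(ball2P _ _ r0)[_]; rewrite row2_1 sub0r normrN => H; exact/ball0P.
have Bv t : K t -> ball (row2 (- sg) 0) r (v t).
  by move=> /ball0P H; apply/(ball2P _ _ r0); rewrite !row2_0 !row2_1 subrr normr0 sub0r normrN.
pose h t := Phi (v t) 0 1.
have PhiJ y : ball (row2 (- sg) 0) r y -> J (Phi y 0 1) by move=> /(ld_inv LD) /UD /DJ.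
have hJ t : K t -> J (h t) by move=> /Bv /PhiJ.
have sh : smooth K h.
  apply: (@smooth_coord R R 1 2 K (fun t => Phi (v t)) 0 1 oK).
  exact: (smooth_comp_rV oK Bv (smooth_vertical _ oK) (ld_smooth_inv LD)).
have thPhi y : ball (row2 (- sg) 0) r y -> th (Phi y 0 1) = y 0 1.
  by move=> By; rewrite -PsiE1 (ld_invK LD By).
have thh t : K t -> th (h t) = t by move=> /Bv /thPhi ->; rewrite row2_1.
have hE y : ball (row2 (- sg) 0) r y -> Phi y 0 1 = h (y 0 1).
  move=> By; apply: (injective_of_derive dth mJ); [exact: PhiJ|exact/hJ/BP|].
  by rewrite thPhi// thh//; exact: BP.
pose h' t := (m (h t))^-1.
have sm : smooth J m by apply: smooth_sub sm1 => x /r2r1 /r1d1.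
have dh : derives K h h'.
  split=> // t Kt; have D1 := derives_comp oK hJ (derives_self sh) dth.
  have : 'D_1 (fun t => th (h t)) t = 1.
    rewrite -[RHS](derive_id t 1); apply: near_eq_derive.
    by apply: filterS (near_open oK Kt) => y; exact: thh.
  rewrite (proj2 D1 _ Kt) => H; apply: (mulIf (mJ _ (hJ _ Kt))).
  by rewrite /h' mulVf ?mJ//; exact: hJ.
have h'0 t : K t -> h' t != 0 by move=> Kt; rewrite invr_eq0 mJ//; exact: hJ.
have sh' : smooth K h'.
  apply: smoothV => // [t Kt|]; first by rewrite mJ//; exact: hJ.
  exact: (smooth_comp_R oK hJ sh sm).
have J1 : J `<=` ball 0 (d / 2) by move=> x /r2r1 /r1d1.
have MF2 := mf_comp oK hJ dh sh' h'0 (mf_sub J1 MF1).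
have {}MF2 := mf_eq oK (fun t _ => mulr0 (h' t)) (fun t Kt => mulVf (mJ _ (hJ _ Kt))) MF2.
exists (- sg), r, U, Psi, Phi; do 5 eexists; split; first split => //.
  by move=> z /UD; apply: le_ball; rewrite (le_trans r21)// (le_trans r1d).
split; [exact: MF2|by move=> t Kt; rewrite mulf_neq0 ?h'0 ?qJ//; exact: hJ|].
move=> y By; have Kt := BP _ By; have Phi1 := hE _ By.
have -> : Phi y 0 0 = y 0 0 + phi (h (y 0 1)).
  by have := PsiE0 (Phi y); rewrite (ld_invK LD By) Phi1 => ->; rewrite subrK.
rewrite Phi1 CD SD; move: (C _) (S _) (C _) (S _) (A _) (B _) => c1 c2 c3 c4 a b.
by apply/rowP => j; rewrite !mxE; ring.
Unshelve. all: by end_near. Qed.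

End Reparametrization.

Section NullFrame.
Variable R : realType.
Local Notation E := 'rV[R]_5.

Definition signature_mx : 'M[R]_5 := diag_mx (row5 (-1) (-1) 1 1 1).
Local Notation J := signature_mx.

Lemma pdot_mx (x y : E) : pdot 2 x y = (x *m J *m y^T) 0 0.
Proof.
rewrite pdotE !mxE; apply: eq_bigr => i _; rewrite mul_mx_diag !mxE mulrCA mulrA.
by congr (_ * _ * _); move: i; apply: I5P.
Qed.

Lemma signatureK : J *m J = 1%:M.
Proof.
rewrite /J mulmx_diag -diag_const_mx; congr diag_mx; apply/rowP; apply: I5P; rewrite !mxE /=; ring.
Qed.

Lemma signature_unit : J \in unitmx.
Proof. by have [] := mulmx1_unit signatureK. Qed.

Lemma det_signature : \det J = 1.
Proof. by rewrite det_diag !big_ord_recl big_ord0 !mxE /=; ring. Qed.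

Lemma gram_mxE (Q : 'M[R]_5) i j : (Q *m J *m Q^T) i j = pdot 2 (row i Q) (row j Q).
Proof.
rewrite pdot_mx -row_mul !mxE; apply: eq_bigr => k _; rewrite !mxE; congr (_ * _).
Qed.

(* The rows of Q are xi / 2 - z, n, a, m, xi / 2 + z for a null vector z dual
   to xi. *)
Definition null_basis (nu mu : R) (n a m xi : E) (Q : 'M[R]_5) :=
  Q *m J *m Q^T = diag_mx (row5 (-1) nu 1 mu 1) /\
  [/\ row 1 Q = n, row 2%:R Q = a, row 3%:R Q = m & xi = row 0 Q + row 4%:R Q].

Lemma dual_vector (xi : E) : xi != 0 -> exists z, pdot 2 xi z != 0.
Proof.
move=> xi0; apply: contrapT => H; move/eqP: xi0; apply; apply: (@pdot_nondeg R 2 5) => y.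
by apply: contrapT => /eqP xy; apply: H; exists y.
Qed.

Lemma null_basis_exists nu mu (n a m xi : E) : nu * nu = 1 -> mu * mu = 1 ->
  [/\ pdot 2 n n = nu, pdot 2 a a = 1 & pdot 2 m m = mu] ->
  [/\ pdot 2 n a = 0, pdot 2 n m = 0 & pdot 2 a m = 0] ->
  [/\ lightlike 2 xi, pdot 2 xi n = 0, pdot 2 xi a = 0 & pdot 2 xi m = 0] ->
  exists Q, null_basis nu mu n a m xi Q.
Proof.
move=> nu2 mu2 [nn aa mm] [na nm am] [[xi0 xx] xn xa xm].
have [z0 g0] := dual_vector xi0; set g := pdot 2 xi z0 in g0.
pose z1 := z0 - (nu * pdot 2 z0 n) *: n - pdot 2 z0 a *: a - (mu * pdot 2 z0 m) *: m.
have an := na; have mn := nm; have ma := am; rewrite pdotC in an; rewrite pdotC in mn.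
rewrite pdotC in ma.
have z1n : pdot 2 z1 n = 0.
  rewrite !pdotBl !pdotZl nn an mn mulrAC nu2; ring.
have z1a : pdot 2 z1 a = 0.
  rewrite !pdotBl !pdotZl aa na ma; ring.
have z1m : pdot 2 z1 m = 0.
  rewrite !pdotBl !pdotZl nm am mm [_ * _ * mu]mulrAC mu2; ring.
have z1x : pdot 2 xi z1 = g by rewrite !pdotBr !pdotZr xn xa xm !mulr0 !subr0.
pose c := pdot 2 z1 z1 / (2 * g * g).
pose z := g^-1 *: z1 - c *: xi.
have xz : pdot 2 xi z = 1 by rewrite pdotBr !pdotZr z1x xx mulr0 subr0 mulVf.
have zx : pdot 2 z xi = 1 by rewrite pdotC.
have zz : pdot 2 z z = 0.
  rewrite {1}/z pdotBl !pdotZl xz /z pdotBr !pdotZr [pdot 2 z1 xi]pdotC z1x /c.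
  by move: (pdot 2 z1 z1) => y; field.
have zn : pdot 2 z n = 0 by rewrite pdotBl !pdotZl z1n xn !mulr0 subrr.
have za : pdot 2 z a = 0 by rewrite pdotBl !pdotZl z1a xa !mulr0 subrr.
have zm : pdot 2 z m = 0 by rewrite pdotBl !pdotZl z1m xm !mulr0 subrr.
clearbody z; clear z1 z1n z1a z1m z1x c.
pose q i := nth 0 [:: 2^-1 *: xi - z; n; a; m; 2^-1 *: xi + z] i.
exists (\matrix_(i < 5) q i).
have rowq (i : 'I_5) : row i (\matrix_(i < 5) q i) = q i by rewrite rowK.
split; last first.
  split; rewrite !rowq //= /q /=.
  by apply/rowP => j; rewrite !mxE; field.
have nx := xn; have ax := xa; have mx := xm; have nz := zn; have az := za; have mz := zm.
rewrite pdotC in nx; rewrite pdotC in ax; rewrite pdotC in mx.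
rewrite pdotC in nz; rewrite pdotC in az; rewrite pdotC in mz.
apply/matrixP => i j; rewrite gram_mxE !rowq; move: i j; apply: I5P; apply: I5P;
  rewrite !mxE /q /= ?pdotDl ?pdotDr ?pdotZl ?pdotZr;
  rewrite ?pdotDr ?pdotZr ?pdotNl ?pdotNr ?pdotNr;
  rewrite ?nn ?aa ?mm ?na ?nm ?am ?an ?mn ?ma ?xx ?xz ?zx ?zz ?xn ?xa ?xm ?nx ?ax ?mx
    ?zn ?za ?zm ?nz ?az ?mz ?mulr0n ?mulr1n; by field.
Qed.

Section NullBasis.
Variables (nu mu : R) (n a m xi : E) (Q : 'M[R]_5).
Hypotheses (nu1 : nu = 1 \/ nu = -1) (mu1 : mu = 1 \/ mu = -1).
Hypothesis HQ : null_basis nu mu n a m xi Q.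

Lemma null_basis_sign : nu * mu = -1 /\ Q \in unitmx.
Proof.
have [H _] := HQ; have D : \det Q * \det Q = - (nu * mu).
  have := congr1 determinant H; rewrite !det_mulmx det_tr det_signature mulr1 => ->.
  by rewrite det_diag !big_ord_recl big_ord0 !mxE /=; ring.
have := sqr_ge0 (\det Q); rewrite expr2 D unitmxE unitfE => H1.
have nm : nu * mu = 1 \/ nu * mu = -1.
  by case: nu1 => ->; case: mu1 => ->; rewrite ?mulrNN ?mulr1 ?mul1r; [left|right|right|left].
case: nm => E; first by move: H1; rewrite E oppr_ge0 ler10.
split=> //; apply/eqP => Q0; move: D; rewrite Q0 E mul0r opprK => /eqP.
by rewrite eq_sym oner_eq0.
Qed.

Lemma null_basis_pdot i j :
  pdot 2 (row i Q) (row j Q) = diag_mx (row5 (-1) nu 1 mu 1) i j.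
Proof. by rewrite -gram_mxE (proj1 HQ). Qed.

Lemma null_basis_nondeg v : (forall i, pdot 2 v (row i Q) = 0) -> v = 0.
Proof.
move=> H; have uQ := (proj2 null_basis_sign).
have : v *m (J *m Q^T) = 0.
  apply/rowP => i; have := H i; rewrite pdot_mx mulmxA mxE => H0; rewrite [RHS]mxE -[RHS]H0 mxE.
  by apply: eq_bigr => k _; rewrite !mxE.
move/(congr1 (mulmx^~ (invmx (J *m Q^T)))); rewrite mul0mx mulmxK//.
by rewrite unitmx_mul signature_unit unitmx_tr.
Qed.

Lemma null_basis_colinear v : [/\ pdot 2 v n = 0, pdot 2 v a = 0, pdot 2 v m = 0
    & pdot 2 v xi = 0] -> v = pdot 2 v (row 4%:R Q) *: xi.
Proof.
move=> [vn va vm vx]; have [_ [rn ra rm rx]] := HQ.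
set c := pdot _ _ _; apply/eqP; rewrite -subr_eq0; apply/eqP; apply: null_basis_nondeg => i.
have G := null_basis_pdot; rewrite pdotBl pdotZl rx pdotDl !G.
move: i; apply: I5P; rewrite ?rn ?ra ?rm ?vn ?va ?vm -/c !mxE /=.
- have : pdot 2 v (row 0 Q) + c = 0 by rewrite -pdotDr -rx.
  by move/eqP; rewrite addr_eq0 => /eqP ->; ring.
- by ring.
- by ring.
- by ring.
- by ring.
Qed.

Lemma null_basis_dual : pdot 2 xi (row 4%:R Q) = 1 /\
  [/\ pdot 2 n (row 4%:R Q) = 0, pdot 2 a (row 4%:R Q) = 0 & pdot 2 m (row 4%:R Q) = 0].
Proof.
have [_ [<- <- <- ->]] := HQ; rewrite pdotDl !null_basis_pdot !mxE /=.
by rewrite ?mulr0n ?mulr1n add0r.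
Qed.

End NullBasis.

Lemma derive_zero_const (r : R) (f : R -> 'rV[R]_5) :
  derives (ball 0 r) f (fun=> 0) -> forall t, ball 0 r t -> f t = f 0.
Proof.
move=> [sf Df] t /ball0P tr; apply/rowP => k.
have seg x : 0 <= x <= 1 -> ball 0 r (0 + x *: t).
  move=> /andP[x0 x1]; apply/ball0P; rewrite add0r normrM (ger0_norm x0).
  by rewrite (le_lt_trans _ tr)// ler_piMl.
have [x x01] := @mvt_line R R (fun x => f x 0 k) 0 t 1 ltr01
  (fun x Hx => diff_coord 0 k (smooth_diff sf (seg x Hx))).
have Sx : ball 0 r (0 + x *: t) by apply: seg; case/andP: x01 => *; rewrite !ltW.
have df := smooth_diff sf Sx.
rewrite scale1r add0r mul1r derive_coord// (derive_R _ df) Df// scaler0 mxE => /eqP.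
by rewrite subr_eq0 => /eqP.
Qed.

Section ConstantNull.
Variables (eps del r : R) (al N T xi : R -> E) (kap : R -> R).
Hypotheses (eps1 : eps = 1 \/ eps = -1) (del1 : del = 1 \/ del = -1) (r0 : 0 < r).
Let K := ball (0 : R) r.
Hypothesis MF : moving_frame 2 eps del K al N T xi (fun=> 0) (fun=> 1) kap.

Lemma null_basis_at t : K t -> exists Q, null_basis eps del (N t) (al t) (T t) (xi t) Q.
Proof.
move=> Kt; have [q1 q2 q3] := mf_unit MF Kt; have [h1 h2 h3] := mf_orth MF Kt.
have [l0 l1 l2 l3] := mf_L MF Kt.
by apply: null_basis_exists; rewrite ?(eps2 eps1) ?(eps2 del1)//; split; rewrite // pdotC.
Qed.

Lemma mf_sign : eps * del = -1.
Proof.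
by have [Q HQ] := null_basis_at (ballxx 0 r0); have [] := null_basis_sign eps1 del1 HQ.
Qed.

Lemma smooth_null : smooth K xi.
Proof.
have oK : open K by exact: ball_open.
have [[sal _] [sN _] [sT DT] _ _ sk _ _ _] := MF.
apply: (@smooth_ext R R E K (fun t => 'D_1 T t + (1 * del) *: al t + (eps * kap t * del) *: N t)) => //.
  by move=> t Kt; rewrite DT//; apply/rowP => j; rewrite !mxE; ring.
apply: smoothD => //; [apply: smoothD => //; [exact: smooth_deriv|]|]; apply: smoothZ => //.
  exact: smooth_cst.
by do 2 (apply: smoothM => //; try exact: smooth_cst).
Qed.

Lemma derive_null t : K t -> exists c, 'D_1 xi t = c *: xi t.
Proof.
move=> Kt; have oK : open K by exact: ball_open.
have [Q HQ] := null_basis_at Kt; exists (pdot 2 ('D_1 xi t) (row 4%:R Q)).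
have [[sal Dal] [sN DN] [sT DT] _ _ _ _ _ HL] := MF.
have [[_ xx] l1 l2 l3] := HL _ Kt; have sx := smooth_null.
apply: (null_basis_colinear eps1 del1 HQ); split.
- have H := derive_pdot_curve oK sx sN (fun t Kt => let: And4 _ _ h _ := HL t Kt in h) Kt.
  by move: H; rewrite DN// pdotDr !pdotZr l1 l3 !mulr0 !addr0.
- have H := derive_pdot_curve oK sx sal (fun t Kt => let: And4 _ h _ _ := HL t Kt in h) Kt.
  by move: H; rewrite Dal// pdotDr !pdotZr l2 l3 !mulr0 !addr0.
- have H := derive_pdot_curve oK sx sT (fun t Kt => let: And4 _ _ _ h := HL t Kt in h) Kt.
  by move: H; rewrite DT// !pdotBr !pdotZr xx l1 l2 !mulr0 !subr0 addr0.
- have H := derive_pdot_curve oK sx sx (fun t Kt => let: And4 (conj _ h) _ _ _ := HL t Kt in h) Kt.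
  by move: H; rewrite [pdot 2 (xi t) _]pdotC => H; lra.
Qed.

Lemma null_constant : exists r' mu, [/\ 0 < r', r' <= r &
  forall t, ball 0 r' t -> xi t = mu t *: xi 0].
Proof.
have K0 : K 0 by exact: ballxx.
have oK : open K by exact: ball_open.
have [Q HQ] := null_basis_at K0; have [xz _] := null_basis_dual HQ.
set z := row 4%:R Q in xz; pose mu t := pdot 2 (xi t) z.
have smu : smooth K mu by apply: smooth_pdot => //; [exact: smooth_null|exact: smooth_cst].
have [r' [r'0 r'r mu0]] : exists r', [/\ 0 < r', r' <= r & forall t, ball 0 r' t -> mu t != 0].
  apply: shrink_ball => //; have cm := smooth_cont smu K0.
  by apply: (@cvgr_neq0 _ _ _ _ _ mu _ cm); rewrite [mu 0]xz oner_neq0.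
have K'K : ball (0 : R) r' `<=` K by exact: le_ball.
have oK' : open (ball (0 : R) r') by exact: ball_open.
set K' := ball (0 : R) r' in mu0 K'K oK'.
exists r', mu; split=> // t K't.
have sxi := smooth_sub K'K smooth_null; have smu' := smooth_sub K'K smu.
have sV : smooth K' (fun t => (mu t)^-1) by exact: smoothV.
have dZ : derives K' (fun t => (mu t)^-1 *: xi t) (fun=> 0).
  apply: derives_eq (derivesZ oK' (derives_self sV) (derives_self sxi)) => x K'x.
  have [c Dx] := derive_null (K'K _ K'x); rewrite Dx scalerA -scalerDl.
  have [_ Dmu] := diff_pdot 2 (smooth_diff sxi K'x) (smooth_diff (smooth_cst K' z) K'x).
  have {}Dmu : 'D_1 mu x = c * mu x.
    by apply: (etrans (Dmu 1)); rewrite derive_cst pdot0r addr0 Dx pdotZl.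
  have [_ DM] := diffZr (smooth_diff sV K'x) (smooth_diff smu' K'x).
  have E1 : 'D_1 (fun t => (mu t)^-1 *: (mu t : R)) x = 0.
    rewrite -[RHS](derive_cst (1 : R) x (1 : R)); apply: near_eq_derive.
    by apply: filterS (near_open oK' K'x) => y K'y; exact: (mulVf (mu0 _ K'y)).
  move: (DM 1); rewrite E1 Dmu => /esym E2.
  suff -> : 'D_1 (fun t => (mu t)^-1) x + (mu x)^-1 * c = 0 by rewrite scale0r.
  apply: (mulIf (mu0 _ K'x)); rewrite mul0r -[RHS]E2 /GRing.scale /=; ring.
have := derive_zero_const dZ K't; rewrite [mu 0]xz invr1 scale1r => <-.
by rewrite scalerA mulfV ?mu0// scale1r.
Qed.

End ConstantNull.
End NullFrame.

Section NormalForm.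
Variable R : realType.
Local Notation E := 'rV[R]_5.
Local Notation J := (signature_mx R).

Lemma pdot_mulmx (Q : 'M[R]_5) (x y : E) : Q *m J *m Q^T = J ->
  pdot 2 (x *m Q) (y *m Q) = pdot 2 x y.
Proof.
by move=> HQ; rewrite !pdot_mx trmx_mul -[in RHS]HQ !mulmxA.
Qed.

Lemma isometry_inv (Q : 'M[R]_5) : Q \in unitmx -> Q *m J *m Q^T = J ->
  invmx Q *m J *m (invmx Q)^T = J.
Proof.
move=> uQ HQ; rewrite -{1}HQ !mulmxA mulVmx// mul1mx -mulmxA -trmx_mul mulVmx//.
by rewrite trmx1 mulmx1.
Qed.

Lemma mulmx_smooth_near (Q : 'M[R]_5) : smooth_near_sphere 2 (fun x : E => x *m Q).
Proof.
exists setT; split; [exact: openT|by []|apply/smooth_onP; first exact: openT].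
exact: (smooth_mulmx Q (@openT _) (@smooth_id R _ setT)).
Qed.

Lemma mulmx_isometry (Q : 'M[R]_5) : Q \in unitmx -> Q *m J *m Q^T = J ->
  sphere_isometry 2 (fun x : E => x *m Q).
Proof.
move=> uQ HQ; have HQ' := isometry_inv uQ HQ.
split; first exact: mulmx_smooth_near.
- by move=> x; rewrite /pseudosphere /= pdot_mulmx.
- exists (fun x => x *m invmx Q); split; first exact: mulmx_smooth_near.
  + by move=> x; rewrite /pseudosphere /= pdot_mulmx.
  + by move=> x _; rewrite mulmxK.
  + by move=> x _; rewrite mulmxKV.
- move=> x u v _ _ _.
  have D w : 'D_w (fun x : E => x *m Q) x = w *m Q.
    have [_ H] := diff_mulmx Q (smooth_diff (@smooth_id R E setT) (Logic.I : setT x)).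
    by rewrite H derive_id.
  by rewrite !D pdot_mulmx.
Qed.

Lemma flank_mxK (y : R) v : flank y v *m (flank_mx R)^T = v.
Proof.
apply/rowP; apply: I3P; rewrite !mxE !big_ord_recl big_ord0 !mxE /=; ring.
Qed.

Lemma flank_of (y : E) : y 0 0 = y 0 4%:R -> y = flank (y 0 4%:R) (y *m (flank_mx R)^T).
Proof.
move=> y04; apply/rowP; apply: I5P; rewrite !mxE /= ?y04//;
  rewrite !big_ord_recl big_ord0 !mxE /= ?mulr0 ?mulr1 ?add0r ?addr0; congr (y 0 _);
  exact/val_inj.
Qed.

Lemma derives_mulmx n m (I : set R) (f f' : R -> 'rV[R]_n) (M : 'M[R]_(n, m)) : open I ->
  derives I f f' -> derives I (fun t => f t *m M) (fun t => f' t *m M).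
Proof.
move=> oI [sf Df]; split=> [|t It]; first exact: smooth_mulmx.
by have [_ ->] := diff_mulmx M (smooth_diff sf It); rewrite Df.
Qed.

Lemma derives_coord n (I : set R) (f f' : R -> 'rV[R]_n) i : open I ->
  derives I f f' -> derives I (fun t => f t 0 i) (fun t => f' t 0 i).
Proof.
move=> oI [sf Df]; split=> [|t It]; first exact: smooth_coord.
by rewrite derive_coord ?Df//; exact: smooth_diff sf It.
Qed.

Variables (eps del r : R) (C S : R -> R) (al N T xi : R -> E) (kap mu : R -> R).
Hypothesis del1 : del = 1 \/ del = -1.
Hypothesis CS : (eps = 1 /\ C = @cos R /\ S = @sin R) \/
  (eps = -1 /\ C = @cosh R /\ S = @sinh R).
Hypothesis r0 : 0 < r.
Let K := ball (0 : R) r.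
Hypothesis MF : moving_frame 2 eps del K al N T xi (fun=> 0) (fun=> 1) kap.
Hypothesis kap0 : forall t, K t -> kap t != 0.
Hypothesis xiE : forall t, K t -> xi t = mu t *: xi 0.

Let eps1 : eps = 1 \/ eps = -1.
Proof. by case: CS => -[H _]; [left|right]. Qed.

Lemma isometry_basis : exists Q, [/\ Q \in unitmx, Q *m J *m Q^T = J,
  xi 0 = row 0 Q + row 4%:R Q & pdot 2 (N 0) (row 4%:R Q) = 0].
Proof.
have K0 : K 0 by exact: ballxx.
have sgn := mf_sign eps1 del1 r0 MF.
have [q1 q2 q3] := mf_unit MF K0; have [h1 h2 h3] := mf_orth MF K0.
have [l0 l1 l2 l3] := mf_L MF K0.
case: CS => -[epsE _].
  have delE : del = -1 by move: sgn; rewrite epsE mul1r.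
  have [Q HQ] : exists Q, null_basis del eps (T 0) (al 0) (N 0) (xi 0) Q.
    by apply: null_basis_exists; rewrite ?(eps2 eps1) ?(eps2 del1)//; split; rewrite // pdotC.
  have [_ uQ] := null_basis_sign del1 eps1 HQ; have [_ [_ _ d]] := null_basis_dual HQ.
  have [G [_ _ _ x0]] := HQ; exists Q; split=> //.
  by rewrite G delE epsE.
have delE : del = 1 by move: sgn; rewrite epsE mulN1r => /oppr_inj.
have [Q HQ] := null_basis_at eps1 del1 MF K0.
have [_ uQ] := null_basis_sign eps1 del1 HQ; have [_ [d _ _]] := null_basis_dual HQ.
have [G [_ _ _ x0]] := HQ; exists Q; split=> //.
by rewrite G delE epsE.
Qed.

Lemma normal_form : exists D F Tm, [/\ family_ii D F \/ family_iv D F,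
  sphere_isometry 2 Tm, D = [set x : 'rV[R]_2 | K (x 0 1)] & forall y : 'rV[R]_2, K (y 0 1) ->
    C (y 0 0) *: al (y 0 1) + S (y 0 0) *: N (y 0 1) = Tm (F y)].
Proof.
have [Q [uQ HQ x0 N4]] := isometry_basis.
have sgn := mf_sign eps1 del1 r0 MF.
have oK : open K by exact: ball_open.
have K0 : K 0 by exact: ballxx.
have HQ' := isometry_inv uQ HQ.
pose c (x : E) := (x *m invmx Q) 0 4%:R; pose m (x : E) := x *m invmx Q *m (flank_mx R)^T.
have row0 : row5 1 0 0 0 1 *m Q = xi 0.
  have -> : row5 1 0 0 0 1 = delta_mx 0 0 + delta_mx 0 4%:R :> E.
    by apply/rowP; apply: I5P; rewrite !mxE /= ?addr0 ?add0r.
  by rewrite mulmxDl -!rowE x0.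
have mu0 t : K t -> mu t != 0.
  move=> Kt; have [[l0 _] _ _ _] := mf_L MF Kt; move: l0; rewrite xiE//.
  by apply: contra => /eqP ->; rewrite scale0r.
have xi_orth x t : K t -> pdot 2 (xi t) x = 0 -> pdot 2 (xi 0) x = 0.
  move=> Kt; rewrite xiE// pdotZl => /eqP; rewrite mulf_eq0 (negPf (mu0 _ Kt)).
  by move/eqP.
have xE x : pdot 2 (xi 0) x = 0 -> x = flank (c x) (m x) *m Q.
  move=> H; have : pdot 2 (row5 1 0 0 0 1) (x *m invmx Q) = 0.
    by rewrite -(pdot_mulmx _ _ HQ) row0 mulmxKV.
  move=> H2; rewrite -[LHS](mulmxKV uQ) /c /m; move: H2; move: (x *m invmx Q) => y.
  rewrite /pdot !big_ord_recl big_ord0 !mxE /= !mul0r oppr0 !mul1r !add0r addr0 => y04.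
  congr (_ *m Q); apply: flank_of; apply/eqP.
  rewrite -subr_eq0 -oppr_eq0 opprB addrC -[X in _ == X]y04; apply/eqP.
  by congr (- y 0 _ + y 0 _); exact/val_inj.
have mE x y : pdot 2 (xi 0) x = 0 -> pdot 2 (xi 0) y = 0 -> pdot 1 (m x) (m y) = pdot 2 x y.
  by move=> Hx Hy; rewrite [in RHS](xE x Hx) [in RHS](xE y Hy) pdot_mulmx// pdot_flank.
have mxi : m (xi 0) = 0.
  rewrite /m -row0 mulmxK//; have -> : row5 1 0 0 0 1 = flank 1 0 :> E.
    by apply/rowP; apply: I5P; rewrite !mxE.
  exact: flank_mxK.
have mD x y z a b1 : m (a *: x - b1 *: y - (z : E)) = a *: m x - b1 *: m y - m z.
  by rewrite /m !mulmxBl -!scalemxAl.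
have cZ a x : c (a *: x) = a * c x by rewrite /c -scalemxAl mxE.
have mZ a x : m (a *: x) = a *: m x by rewrite /m -!scalemxAl.
have [[sal Dal] [sN DN] [sT DT] _ _ sk Un Or HL] := MF.
have dm f f' : derives K f f' -> derives K (fun t => m (f t)) (fun t => m (f' t)).
  by move=> df; apply: derives_mulmx => //; exact: derives_mulmx.
have dc f f' : derives K f f' -> derives K (fun t => c (f t)) (fun t => c (f' t)).
  by move=> df; apply: derives_coord => //; exact: derives_mulmx.
have dal : derives K al T.
  by split=> // t Kt; rewrite Dal// mulr0 scale0r add0r scale1r.
have dN : derives K N (fun t => kap t *: T t).
  by split=> // t Kt; rewrite DN// oppr0 scale0r add0r.
have dT : derives K T (fun t => mu t *: xi 0 - del *: al t - (- kap t) *: N t).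
  split=> // t Kt; rewrite DT// xiE// mul1r; congr (_ - _ *: _).
  by rewrite mulrAC sgn mulN1r.
pose a t := m (al t); pose nu t := m (N t); pose b t := c (al t).
have sa : smooth K a := proj1 (dm _ _ dal).
have sb : smooth K b := proj1 (dc _ _ dal).
have da t : K t -> derive1 a t = m (T t) by move=> Kt; rewrite derive1E (proj2 (dm _ _ dal)).
have db t : K t -> derive1 b t = c (T t) by move=> Kt; rewrite derive1E (proj2 (dc _ _ dal)).
have dnu t : K t -> derive1 nu t = kap t *: derive1 a t.
  by move=> Kt; rewrite derive1E (proj2 (dm _ _ dN))// mZ da.
have dda t : K t -> derive1n 2 a t = kap t *: nu t - del *: a t.
  move=> Kt; rewrite /= derive1E.
  transitivity ('D_1 (fun t => m (T t)) t).
    by apply: near_eq_derive; apply: filterS (near_open oK Kt) => y; exact: da.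
  rewrite (proj2 (dm _ _ dT))// /nu /a; rewrite mD mxi scaler0 sub0r mZ.
  by rewrite scaleNr opprK addrC.
have xal t : K t -> pdot 2 (xi 0) (al t) = 0 by move=> Kt; have [_ H _ _] := HL t Kt; exact: xi_orth H.
have xN t : K t -> pdot 2 (xi 0) (N t) = 0 by move=> Kt; have [_ _ H _] := HL t Kt; exact: xi_orth H.
have xT t : K t -> pdot 2 (xi 0) (T t) = 0 by move=> Kt; have [_ _ _ H] := HL t Kt; exact: xi_orth H.
have epsE : eps = - del.
  by have := eps2 del1; rewrite -[eps]mulr1 => <-; rewrite mulrA sgn mulN1r.
have curve : spherical_curve del K a nu kap.
  split; first exact: smooth_curveW.
  split; first exact: (smooth_curveW oK (proj1 (dm _ _ dN))).
  move=> t Kt; have [q1 q2 q3] := Un t Kt; have [h1 h2 h3] := Or t Kt.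
  split; [| | |exact: dda|exact: dnu].
  - by rewrite /pseudosphere /= mE ?xal.
  - by rewrite !da// mE ?xT.
  - by rewrite !da// !mE ?xal ?xN ?xT// pdotC h1 q2.
have iK : is_interval K.
  move=> x y /ball0P xr /ball0P yr z /andP[xz zy]; apply/ball0P.
  by move: xr yr; rewrite !ltr_norml => /andP[xr _] /andP[_ yr]; rewrite (lt_le_trans xr)// (le_lt_trans zy).
have c0 : c (N 0) = 0.
  have -> : c (N 0) = pdot 2 (delta_mx 0 4%:R) (N 0 *m invmx Q).
    rewrite /c; move: (N 0 *m invmx Q) => y; rewrite pdotE (bigD1 4%:R)//= big1 => [|j /negPf j4].
      by rewrite /psign /= mxE eqxx !mul1r addr0.
    by rewrite mxE j4 andbF mul0r mulr0.
  by rewrite -(pdot_mulmx _ _ HQ) mulmxKV// -rowE pdotC.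
have intE t : K t -> oriented_integral 0 t (fun x => kap x * derive1 b x) = c (N t).
  move=> Kt; rewrite -[RHS]subr0 -[in RHS]c0.
  have [sc Dc] := dc _ _ dN.
  apply: (@oriented_integralE R K (fun t => c (N t)) _ 0 t iK K0 Kt) => x Kx.
    apply: DeriveDef; first by apply: diff_derivable; exact: (smooth_diff sc).
    by rewrite Dc// cZ db.
  by apply: smooth_cont Kx; apply: smoothM => //; exact: smooth_derive1.
pose F (y : 'rV[R]_2) := C (y 0 0) *: flank (b (y 0 1)) (a (y 0 1)) +
  S (y 0 0) *: flank (oriented_integral 0 (y 0 1) (fun x => kap x * derive1 b x)) (nu (y 0 1)).
exists [set x : 'rV[R]_2 | K (x 0 1)], F, (fun x => x *m Q); split=> //.
- case: CS => -[epsE' [CE SE]].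
    left; have delE : del = -1 by rewrite -[del]opprK -epsE epsE'.
    exists K, 0, b, kap, a, nu; split=> //.
    + by split=> //; exact: smooth_curveW.
    + by rewrite /timelike_spherical_curve -delE.
    + by rewrite /F CE SE.
  right; have delE : del = 1 by rewrite -[del]opprK -epsE epsE' opprK.
  exists K, 0, 1, b, kap, a, nu; split=> //.
  + by split=> //; [exact: smooth_curveW|left].
  + by rewrite /spacelike_spherical_curve -delE.
  + by rewrite /F CE SE; apply/funext => x /=; rewrite mul1r.
- exact: mulmx_isometry.
- move=> y Ky; rewrite /F intE// mulmxDl -!scalemxAl -!xE//; [exact: xN|exact: xal].
Qed.
End NormalForm.

(** * Charts *)

Section LocalDiffeos.
Variables (R : realType) (n : nat).
Implicit Types U V W : set 'rV[R]_n.

Lemma local_diffeo_restrict U V V' F G : local_diffeo U V F G -> open V' -> V' `<=` V ->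
  local_diffeo (U `&` F @^-1` V') V' F G.
Proof.
move=> [oU oV UV VU K iK sF sG] oV' V'V; split=> //.
- by apply: (open_preimage oU) => // x Ux; exact: smooth_cont sF Ux.
- by move=> x [].
- by move=> y V'y; split; [exact/VU/V'V|rewrite /= iK//; exact: V'V].
- by move=> x [Ux _]; exact: K.
- by move=> y /V'V/iK.
- by apply: smooth_sub sF => x [].
- exact: smooth_sub sG.
Qed.

Lemma local_diffeo_comp U V W F G F' G' : local_diffeo U V F G ->
  local_diffeo V W F' G' -> local_diffeo U W (F' \o F) (G \o G').
Proof.
move=> [oU oV UV VU K iK sF sG] [_ oW VW WV K' iK' sF' sG']; split=> //=.
- by move=> x /UV/VW.
- by move=> y /WV/VU.
- by move=> x Ux; rewrite K' ?K//; exact: UV.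
- by move=> y Wy; rewrite iK ?iK'//; exact: WV.
- exact: (smooth_comp_rV oU UV sF sF').
- exact: (smooth_comp_rV oW WV sG' sG).
Qed.

End LocalDiffeos.

Section LocalNormalForm.
Variables (R : realType).
Local Notation E := 'rV[R]_5.
Variables (X : 'rV[R]_2 -> E) (U : set 'rV[R]_2).
Hypotheses (oU : open U) (sX : smooth U X).
Hypothesis XS : forall x, U x -> pseudosphere 2 4 (X x).
Hypothesis detX : forall x, U x -> \det (metric 2 X x) != 0.
Hypothesis HX : forall x, U x -> lightlike 2 (mean_curvature 2 X x).
Hypothesis NX : forall x, U x -> positive_nullity_at 2 X x.

Lemma ball_vertical (d t : R) : 0 < d -> ball 0 d t -> ball (0 : 'rV[R]_2) d (row2 0 t).
Proof.
move=> d0 /ball0P td; apply/(ball2P _ _ d0).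
by rewrite row2_0 row2_1 !mxE subrr normr0 sub0r normrN.
Qed.

Lemma derive_on_axis (d : R) (f : 'rV[R]_2 -> E) t : 0 < d ->
  smooth (ball (0 : 'rV[R]_2) d) f -> ball 0 d t ->
  'D_1 (fun t => f (row2 0 t)) t = partial 1 f (row2 0 t).
Proof.
move=> d0 sf td; have Bt := ball_vertical d0 td.
have dv : differentiable (row2 0) t := smooth_diff (smooth_vertical 0 (@openT R)) Logic.I.
apply: (etrans (derive_chain _ dv (smooth_diff sf Bt))); by rewrite derive_vertical.
Qed.

Lemma local_normal_form x0 : U x0 -> exists U' V Psi Phi D F Tm,
  [/\ local_diffeo U' V Psi Phi, U' `<=` U & U' x0] /\
  [/\ family_ii D F \/ family_iv D F, V `<=` D, sphere_isometry 2 Tm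
    & forall y, V y -> X (Phi y) = Tm (F y)].
Proof.
move=> Ux0.
have [U1 [d [Psi1 [Phi1 [eps [[d0 U1U U1x0 Psi0 L1] [eps1 HY]]]]]]] :=
  adapted_chart oU sX XS detX HX NX Ux0.
set Y := X \o Phi1 in HY; pose Bd := ball (0 : 'rV[R]_2) d.
have oB : open Bd by exact: ball_open.
have sY : smooth Bd Y.
  exact: (@smooth_comp_rV R _ _ 2 Bd U Phi1 X oB (fun y By => U1U _ (ld_inv L1 By)) (ld_smooth_inv L1) sX).
pose A t := Y (row2 0 t); pose B t := partial 0 Y (row2 0 t).
pose I := ball (0 : R) d; have oI : open I by exact: ball_open.
have IB t : I t -> Bd (row2 0 t) by exact: ball_vertical.
have sP i : smooth Bd (partial i Y) by exact: smooth_deriv.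
have sA : smooth I A := smooth_comp_rV oI IB (smooth_vertical 0 oI) sY.
have sB : smooth I B := smooth_comp_rV oI IB (smooth_vertical 0 oI) (sP 0).
have DA t : I t -> 'D_1 A t = partial 1 Y (row2 0 t) by move=> It; exact: (derive_on_axis d0 sY It).
have DB t : I t -> 'D_1 B t = partial 1 (partial 0 Y) (row2 0 t).
  by move=> It; exact: (derive_on_axis d0 (sP 0) It).
have DDA t : I t -> 'D_1 (fun r => 'D_1 A r) t = partial 1 (partial 1 Y) (row2 0 t).
  move=> It; rewrite -(derive_on_axis d0 (sP 1) It); apply: near_eq_derive.
  by apply: filterS (near_open oI It) => r; exact: DA.
pose T t : 'I_2 -> E := fun i => if i == 0 then B t else 'D_1 A t.
have TE t : I t -> T t = frame Y (row2 0 t).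
  move=> It; apply/funext; apply: I2P; [by []|exact: DA].
have FT t : I t -> sphere_frame 2 (A t) (T t).
  by move=> It; rewrite TE//; have [] := HY _ (IB _ It).
have BB t : I t -> pdot 2 (B t) (B t) = eps by move=> It; have [] := HY _ (IB _ It).
have NB t : I t -> nproj 2 (A t) (T t) ('D_1 B t) = 0.
  by move=> It; rewrite TE// DB//; have [] := HY _ (IB _ It).
have NA t : I t -> lightlike 2 (nproj 2 (A t) (T t) ('D_1 (fun r => 'D_1 A r) t)).
  by move=> It; rewrite TE// DDA//; have [] := HY _ (IB _ It).
have [del [d' [u [L [w [p [k [d'0 d'd del1 MF p0]]]]]]]] := initial_frame eps1 d0 sA sB FT BB NB NA.
have [C [S [CS HT]]] : exists C S, ((eps = 1 /\ C = @cos R /\ S = @sin R) \/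
    (eps = -1 /\ C = @cosh R /\ S = @sinh R)) /\ trig eps C S.
  case: eps1 => ->; first by exists (@cos R), (@sin R); split; [left|exact: trig_circular].
  by exists (@cosh R), (@sinh R); split; [right|exact: trig_hyperbolic].
have RF y : Bd y -> Y y = C (y 0 0) *: A (y 0 1) + S (y 0 0) *: B (y 0 1).
  by apply: (ruled_form HT d0 sY) => z Bz; have [] := HY _ Bz.
have [sg [r [U2 [Psi2 [Phi2 [al [N [Tg [xi [kap [[r0 U2B U20 Psi20 LD2] [MF2 kap0 RF2]]]]]]]]]]]] :=
  reparametrization eps1 HT d'0 MF p0.
have [r' [mu [r'0 r'r xiE]]] := null_constant eps1 del1 r0 MF2.
have KK : ball (0 : R) r' `<=` ball 0 r by exact: le_ball.
have [D [F [Tm [Fam isoT DE FE]]]] := normal_form del1 CS r'0 (mf_sub KK MF2)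
  (fun t Kt => kap0 t (KK t Kt)) xiE.
pose B2 := ball (row2 sg 0) r; have oB2 : open B2 by exact: ball_open.
pose V := B2 `&` (fun y => y 0 1) @^-1` ball (0 : R) r'.
have oV : open V.
  apply: (open_preimage oB2); last exact: ball_open.
  by move=> x _; exact: (smooth_cont (@smooth_proj2 R 1) (Logic.I : setT x)).
have VB : V `<=` B2 by move=> y [].
have LD2' := local_diffeo_restrict LD2 oV VB.
set U2' := U2 `&` _ in LD2'.
have U2'B : U2' `<=` Bd by move=> z [/U2B H _]; exact: le_ball d'd _ H.
have L1' := local_diffeo_restrict L1 (ld_openU LD2') U2'B.
exists (U1 `&` Psi1 @^-1` U2'), V, (Psi2 \o Psi1), (Phi1 \o Phi2), D, F, Tm.
split; first split.
- exact: local_diffeo_comp L1' LD2'.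
- by move=> x [/U1U].
- split=> //; rewrite /= Psi0; split=> //; rewrite /= Psi20; split; first exact: ballxx.
  by rewrite /= row2_1; exact: ballxx.
split=> //; first by move=> y [_ Ky]; rewrite DE.
move=> y Vy; have [By Ky] := Vy.
rewrite -FE// -RF2//; have := ld_inv LD2' Vy => /U2'B; exact: RF.
Qed.

End LocalNormalForm.

Section Assembly.
Variables (R : realType) (M : surface R).

Lemma restrict_chart (c : chart R M) (U V : set 'rV[R]_2) Psi Phi : atlas c ->
  local_diffeo U V Psi Phi -> U `<=` cimg c -> exists e : chart R M,
  [/\ smooth_chart e, cdom e = cdom c `&` cmap c @^-1` U, cimg e = V
    & forall y, cinv e y = cinv c (Phi y)].
Proof.
move=> ac [oU oV UV VU K iK sF sG] Uc.
pose D := cdom c `&` cmap c @^-1` U.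
have oD : open D.
  rewrite openE => q [cq Uq]; rewrite /interior.
  near=> z; split; near: z; first by apply: open_nbhs_nbhs; split=> //; exact: cdom_open.
  by apply: (cmap_continuous cq); exact: open_nbhs_nbhs.
have DV q : D q -> V ((Psi \o cmap c) q) by move=> [_ /UV].
have VD y : V y -> D ((cinv c \o Phi) y).
  move=> /VU Uy; split; first exact: (cinv_dom (Uc _ Uy)).
  by rewrite /= (cinvK (Uc _ Uy)).
have DK q : D q -> (cinv c \o Phi) ((Psi \o cmap c) q) = q.
  by move=> [cq Uq] /=; rewrite K// cmapK.
have VK y : V y -> (Psi \o cmap c) ((cinv c \o Phi) y) = y.
  by move=> Vy /=; rewrite (cinvK (Uc _ (VU _ Vy))) iK.
have cD q : D q -> {for q, continuous (Psi \o cmap c)}.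
  move=> [cq Uq]; apply: (@continuous_comp _ _ _ (cmap c) Psi); first exact: cmap_continuous cq.
  exact: (smooth_cont sF Uq).
have cV y : V y -> {for y, continuous (cinv c \o Phi)}.
  move=> Vy; apply: (@continuous_comp _ _ _ Phi (cinv c)); first exact: (smooth_cont sG Vy).
  exact: (cinv_continuous (Uc _ (VU _ Vy))).
exists (Chart oD oV DV VD DK VK cD cV); split=> // g ag.
have [cg gc] : smooth_transition c g /\ smooth_transition g c.
  by split; exact: atlas_compatible.
split; rewrite /smooth_transition /=.
- have oW : open (V `&` (cinv c \o Phi) @^-1` cdom g).
    exact: (open_preimage oV cV (@cdom_open _ _ g)).
  apply/smooth_onP => //.
  have oc : open (cimg c `&` cinv c @^-1` cdom g).
    by apply: open_chart_preimage; exact: cdom_open.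
  have sc : smooth (cimg c `&` cinv c @^-1` cdom g) (cmap g \o cinv c) by exact/smooth_onP.
  apply: (smooth_comp_rV oW _ (smooth_sub _ sG) sc).
    by move=> y [Vy gy]; split; [exact/Uc/VU|].
  by move=> y [].
- have oW : open (cimg g `&` cinv g @^-1` D) by exact: open_chart_preimage.
  apply/smooth_onP => //.
  have oc : open (cimg g `&` cinv g @^-1` cdom c).
    by apply: open_chart_preimage; exact: cdom_open.
  have sc : smooth (cimg g `&` cinv g @^-1` cdom c) (cmap c \o cinv g) by exact/smooth_onP.
  apply: (smooth_comp_rV oW _ (smooth_sub _ sc) sF).
    by move=> y [_ []].
  by move=> y [gy [cy _]].
Unshelve. all: by end_near. Qed.

End Assembly.

Theorem theorem3p8 (R : realType) (M : surface R) (f : M -> 'rV[R]_5)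
    (f_immersion : pseudo_riemannian_immersion 2 f)
    (f_quasi_minimal : quasi_minimal 2 f) :
  positive_relative_nullity 2 f <->
  (forall p : M, exists (D : set 'rV[R]_2) (F : 'rV[R]_2 -> 'rV[R]_5),
     (family_i D F \/ family_ii D F \/ family_iii D F \/ family_iv D F) /\
     congruent_near 2 f p D F).
Proof.
split=> [PN p|H c x ac cx].
  have [c ac cp] := atlas_cover p; have [fS fI] := f_immersion; have [sc dc] := fI c ac.
  have oU := @cimg_open _ _ c.
  have sX : smooth (cimg c) (f \o cinv c) by exact/smooth_onP.
  have [U [V [Psi [Phi [D [F [Tm [[L UU Up] [Fam VD iso E]]]]]]]]] :=
    local_normal_form oU sX (fun x _ => fS (cinv c x)) dc (fun x cx => f_quasi_minimal c x ac cx)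
      (fun x cx => PN c x ac cx) (cmap_img cp).
  have [e [se de ie ce]] := restrict_chart ac L UU.
  exists D, F; split; first by case: Fam => ?; [right; left|right; right; right].
  exists e, Tm; split=> //; first by rewrite de; split.
    by rewrite ie.
  by move=> y; rewrite ie ce => /E.
have [D [F [Fam con]]] := H (cinv c x).
apply: congruent_nullity con => //.
case: Fam => [|[|[|]]] Fam.
- exact: family_i_ruled Fam.
- exact: family_ii_ruled Fam.
- exact: family_iii_ruled Fam.
- exact: family_iv_ruled Fam.
Qed.
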